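(* Let $N\ge1$, $\mu,\kappa>0$, and let $t\mapsto(\rho(t),u(t),T(t))$ be a $C^\infty$ solution on $\mathbb T^N$ of $$\partial_t\rho+\nabla\cdot(\rho u)=0,\quad \partial_t(\rho u)+\nabla\cdot(\rho u\otimes u)+\nabla(\rho T)=2\mu\nabla\cdot\{\nabla u\},$$ $$\partial_t\Big(\rho\frac{|u|^2}2+\frac N2\rho T\Big)+\nabla\cdot\Big(\rho\frac{|u|^2}2u+\frac{N+2}2\rho uT\Big)=2\mu\nabla\cdot(u\{\nabla u\})+\frac N2\kappa\Delta T,$$ normalized by $\int\rho=1$, $\int\rho u=0$, $\int\rho|u|^2/2+\frac N2\int\rho T=\frac N2$, and satisfying $\sup_{t\ge0}(\|\rho(t)\|_{C^k}+\|u(t)\|_{C^k}+\|T(t)\|_{C^k})<\infty$ for every $k\in\mathbb N$ and $\rho(t)\ge\rho_m>0$, $T(t)\ge T_m>0$ for all $t\ge0$. Then for every $k$, $\|(\rho(t),u(t),T(t))-(1,0,1)\|_{C^k}=O(t^{-\infty})$ as $t\to\infty$.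
   Context: $\{\nabla u\}$ is the traceless symmetric strain: $\{\nabla u\}_{ij}=\frac12(\partial_ju_i+\partial_iu_j)-\frac{\nabla\cdot u}N\delta_{ij}$. $C^k$ is the space of functions with bounded derivatives up to order $k$ on $\mathbb T^N$. $O(t^{-\infty})$ means $O(t^{-\beta})$ for every $\beta>0$. *)

(* Defs.v *)
From HB Require Import structures.
From mathcomp Require Import all_boot all_order all_algebra.
From mathcomp Require Import all_classical all_reals all_analysis.
Set Implicit Arguments. Unset Strict Implicit. Unset Printing Implicit Defensive.
Import Order.TTheory GRing.Theory Num.Theory.
Import numFieldNormedType.Exports.
Local Open Scope classical_set_scope.
Local Open Scope ring_scope.

Section Calculus.
Variable R : realType.
Variable n : nat.

Definition ev (j : 'I_n) : 'rV[R]_n := delta_mx 0 j.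

Definition pd (j : 'I_n) (f : 'rV[R]_n -> R) : 'rV[R]_n -> R :=
  fun z => 'D_(ev j) f z.

Fixpoint pds (js : seq 'I_n) (f : 'rV[R]_n -> R) : 'rV[R]_n -> R :=
  if js is j :: js' then pd j (pds js' f) else f.

Definition smooth_on (U : set 'rV[R]_n) (f : 'rV[R]_n -> R) : Prop :=
  forall (js : seq 'I_n) (z : 'rV[R]_n), U z ->
    {for z, continuous (pds js f)} /\ (forall j, derivable (pds js f) z (ev j)).

Definition setc (z : 'rV[R]_n) (j : 'I_n) (s : R) : 'rV[R]_n :=
  \row_k (if k == j then s else z ord0 k).

Fixpoint itint (js : seq 'I_n) (f : 'rV[R]_n -> R) (z : 'rV[R]_n) : R :=
  if js is j :: js' then
    Rintegral lebesgue_measure `[0%R, 1%R] (fun s => itint js' f (setc z j s))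
  else f z.
End Calculus.

(* Space-time R x R^N is encoded as 'rV[R]_N.+1; coordinate ord0 is time t,
   coordinate (lift ord0 i) is the spatial coordinate x_i. *)
Section SpaceTime.
Variable R : realType.
Variable N : nat.
Notation ST := ('rV[R]_N.+1).

Definition time (z : ST) : R := z ord0 ord0.
Definition xc (i : 'I_N) : 'I_N.+1 := lift ord0 i.
Definition dt (f : ST -> R) : ST -> R := pd ord0 f.
Definition dx (i : 'I_N) (f : ST -> R) : ST -> R := pd (xc i) f.

(* 1-periodic in each spatial variable, i.e. a function on T^N = R^N/Z^N *)
Definition xperiodic (f : ST -> R) : Prop :=
  forall (z : ST) (i : 'I_N), f (z + @ev R N.+1 (xc i)) = f z.

Definition space_int (f : ST -> R) (t : R) : R :=
  itint [seq xc i | i <- enum 'I_N] f (\row_k (if k == ord0 then t else 0)).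

Definition strain (u : 'I_N -> ST -> R) (i j : 'I_N) : ST -> R :=
  fun z => (dx j (u i) z + dx i (u j) z) / 2
           - (\sum_(k < N) dx k (u k) z) / N%:R * (i == j)%:R.

Definition usq (u : 'I_N -> ST -> R) : ST -> R :=
  fun z => \sum_(i < N) u i z ^+ 2.

Definition NSF_at (mu kappa : R) (rho : ST -> R) (u : 'I_N -> ST -> R)
    (T : ST -> R) (z : ST) : Prop :=
  [/\ dt rho z + \sum_(i < N) dx i (fun w => rho w * u i w) z = 0,
      (forall j : 'I_N,
        dt (fun w => rho w * u j w) z
        + \sum_(i < N) dx i (fun w => rho w * u i w * u j w) z
        + dx j (fun w => rho w * T w) z
        = 2 * mu * \sum_(i < N) dx i (strain u j i) z) &
      dt (fun w => rho w * usq u w / 2 + N%:R / 2 * (rho w * T w)) z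
      + \sum_(i < N) dx i (fun w => rho w * usq u w / 2 * u i w
                                  + (N%:R + 2) / 2 * (rho w * u i w * T w)) z
      = 2 * mu * \sum_(i < N) dx i (fun w => \sum_(j < N) u j w * strain u j i w) z
        + N%:R / 2 * kappa * \sum_(i < N) dx i (dx i T) z].

Definition Ck_bounded (f : ST -> R) : Prop :=
  forall k : nat, exists C : R, forall (z : ST), 0 < time z ->
    forall js : seq 'I_N, (size js <= k)%N ->
      `|pds [seq xc i | i <- js] f z| <= C.

Definition Ck_decay_fast (f : ST -> R) : Prop :=
  forall (k : nat) (beta : R), 0 < beta -> exists C t0 : R,
    forall (z : ST), t0 <= time z ->
      forall js : seq 'I_N, (size js <= k)%N ->
        `|pds [seq xc i | i <- js] f z| <= C * time z `^ (- beta).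
End SpaceTime.

(* Main.v *)
(** Write [<f>] for the space integral at time [t].  The relative entropy
    [E = <rho ln rho - (N/2) rho ln T>] is comparable to
    [Q = <(rho-1)^2 + |u|^2 + (T-1)^2>] and dissipates
    [a = <|grad T|^2 + |strain u|^2>] only.  The missing quantities
    [b = <(div u)^2>] and [r = <|grad rho|^2>] are recovered hypocoercively:
    by the temperature equation [b] is dominated by the time derivative of
    [<u . grad T>], and by the momentum equation [r] is dominated by minus the
    time derivative of [<u . grad rho>]; moreover [Q] is bounded by
    [a + b + r] (Poincare and a Korn identity).  The second derivatives which
    appear are controlled by interpolation, at the price of a factor [1/eta]
    and of a remainder [eta^P], with [eta] and [P] free.  Hence, for small
    [eps] and [k],
    [L = E - eps eta (<u . grad T> - k <u . grad rho>)] satisfies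
    [L' <= - c eta L + C eta^(P+1)], so that
    [E(t) <= C (exp (- c eta (t - 1)) + eta^P)] for all [eta] in (0, 1];
    [eta = t^(-1/2)] gives any polynomial rate.  Interpolation and a crude
    Sobolev inequality turn this into decay of all derivatives. *)
Require Import Defs.
From HB Require Import structures.
From mathcomp Require Import all_boot all_order all_algebra.
From mathcomp Require Import all_classical all_reals all_analysis.
From mathcomp Require Import ring lra.
Set Implicit Arguments. Unset Strict Implicit. Unset Printing Implicit Defensive.
Import Order.TTheory GRing.Theory Num.Theory.
Import numFieldNormedType.Exports.
Local Open Scope classical_set_scope.
Local Open Scope ring_scope.

(** * Partial derivatives and partial integrals *)

(** Both cross functionals rest on one integration by parts, [d/dt <u . grad f> = <dt u . grad f> -
    <div u dt f>]. For [f = T], the term [- (2/N) T div u] of [dt T] yields a positive multiple of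
    [b]; for [f = rho], the term [- (T/rho) grad rho] of [dt u] yields a negative multiple of [r].
    The two estimates are coupled, since [dt u] brings [grad rho] into the first one; this
    contribution can be given an arbitrarily small weight, fixed after [k], so the choice of
    constants is not circular. The obstacle is a loss of derivatives: [dt u] and [dt T] contain
    second derivatives, which [a] does not dominate. As all [C^k] norms are bounded, interpolation
    bounds them by [a / eta + eta^P], and the prefactor [eta] of the cross functionals cancels
    [1 / eta]. The parameter [eta] is constant while the inequality is integrated in time and is
    tied to the final time only afterwards. The space integral is an iterated one-dimensional
    integral, so the facts about the torus are proved one coordinate at a time, without exchanging
    integrals. *)

Section Lines.
Variables (R : realType) (n : nat).
Implicit Types (z v : 'rV[R]_n) (j k : 'I_n) (f : 'rV[R]_n -> R).

Lemma setcE z j s : setc z j s = (s - z ord0 j) *: ev R j + z.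
Proof.
apply/rowP => k; rewrite !mxE eqxx /=; case: eqVneq => [->|_].
  by rewrite mulr1 subrK.
by rewrite mulr0 add0r.
Qed.

Lemma setcK z j : setc z j (z ord0 j) = z.
Proof. by rewrite setcE subrr scale0r add0r. Qed.

Lemma setc_setc z j s s' : setc (setc z j s) j s' = setc z j s'.
Proof. by apply/rowP => k; rewrite !mxE; case: eqVneq. Qed.

Lemma setcC z j k s s' : j != k ->
  setc (setc z j s) k s' = setc (setc z k s') j s.
Proof.
move=> jk; apply/rowP => l; rewrite !mxE.
by case: (eqVneq l k) => [->|//]; rewrite eq_sym (negbTE jk).
Qed.

Lemma setc_shift z j s h : h *: ev R j + setc z j s = setc z j (h + s).
Proof. by rewrite !setcE addrA -scalerDl addrA. Qed.

Lemma setc_continuous2 j : continuous (fun p : R * 'rV[R]_n => setc p.2 j p.1).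
Proof.
move=> [s z] /=.
rewrite (_ : (fun p : R * 'rV[R]_n => setc p.2 j p.1) =
  (fun p => (p.1 - p.2 ord0 j) *: ev R j + p.2)); last first.
  by apply/funext => p; rewrite setcE.
apply: cvgD; last exact: cvg_snd.
apply: cvgZr_tmp; apply: cvgB; first exact: cvg_fst.
apply: (@cvg_comp _ _ _ snd (fun w : 'rV[R]_n => w ord0 j)); first exact: cvg_snd.
exact: coord_continuous.
Qed.

Lemma setc_continuous z j : continuous (setc z j).
Proof.
move=> s; rewrite (_ : setc z j = (fun t => (t - z ord0 j) *: ev R j + z)).
  apply: cvgD; last exact: cvg_cst.
  apply: cvgZr_tmp; apply: cvgB; [exact: cvg_id|exact: cvg_cst].
by apply/funext => t; rewrite setcE.
Qed.

Lemma derivable_line f z j s :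
  derivable f (setc z j s) (ev R j) <-> derivable (fun t => f (setc z j t)) s 1.
Proof.
rewrite /derivable; set g1 := fun h => h^-1 *: _; set g2 := fun h => h^-1 *: _.
suff -> : g1 = g2 by [].
apply/funext => h; rewrite /g1 /g2 /= setc_shift [h *: 1]mulr1//.
Qed.

Lemma derive_line f z j s :
  'D_(ev R j) f (setc z j s) = 'D_1 (fun t => f (setc z j t)) s.
Proof.
rewrite /derive; set g1 := fun h => h^-1 *: _; set g2 := fun h => h^-1 *: _.
suff -> : g1 = g2 by [].
apply/funext => h; rewrite /g1 /g2 /= setc_shift [h *: 1]mulr1//.
Qed.

Lemma is_derive_line f z j s : derivable f (setc z j s) (ev R j) ->
  is_derive s 1 (fun t => f (setc z j t)) (pd j f (setc z j s)).
Proof.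
move=> df; rewrite /pd derive_line; apply: derivableP.
exact/derivable_line.
Qed.

(** The difference quotient in direction [ev R j] is that of the restriction to a coordinate line,
    so one-variable calculus applies to [pd]. *)
Lemma is_derive_lineP f z j d :
  is_derive (z ord0 j) 1 (fun t => f (setc z j t)) d <->
  derivable f z (ev R j) /\ pd j f z = d.
Proof.
have e := setcK z j; split=> [[h1 h2]|[h1 <-]].
  split; first by rewrite -[X in derivable _ X _]e; exact/derivable_line.
  by rewrite /pd -[X in 'D__ _ X]e derive_line.
by rewrite -[X in pd _ _ X]e; apply: is_derive_line; rewrite e.
Qed.

End Lines.

(** * Calculus on the unit interval: Poincare and sup bounds in one variable *)

Section UnitInterval.
Variable R : realType.
Implicit Types (f g h : R -> R).
Notation mu := (@lebesgue_measure R).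
Notation J g := (Rintegral mu `[0%R, 1%R] g).

Lemma continuous_integrable f (a b : R) : continuous f ->
  mu.-integrable `[a, b] (EFin \o f).
Proof.
move=> cf; apply: continuous_compact_integrable; first exact: segment_compact.
exact: continuous_subspaceT.
Qed.

Lemma J_D f g : continuous f -> continuous g ->
  J (fun x => f x + g x) = J f + J g.
Proof. by move=> cf cg; apply: RintegralD => //; exact: continuous_integrable. Qed.

Lemma J_Z c f : continuous f -> J (fun x => c * f x) = c * J f.
Proof. by move=> cf; apply: RintegralZl => //; exact: continuous_integrable. Qed.

Lemma J_cst (c : R) : J (fun=> c) = c.
Proof.
rewrite Rintegral_cst//= lebesgue_measure_itv/= lte_fin ltr01/=.
by rewrite oppr0 addr0 mulr1.
Qed.

Lemma le_J f g : continuous f -> continuous g ->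
  (forall x, 0 <= x <= 1 -> f x <= g x) -> J f <= J g.
Proof.
move=> cf cg fg; apply: le_Rintegral => //; try exact: continuous_integrable.
Qed.

Lemma eq_J f g : (forall x, f x = g x) -> J f = J g.
Proof. by move=> fg; congr (J _); exact/funext. Qed.

Lemma FTC_seg h h' (a b : R) : a < b -> continuous h' ->
  (forall x : R, is_derive x 1 h (h' x)) ->
  Rintegral mu `[a, b] h' = h b - h a.
Proof.
move=> ab ch' dh.
have ch : continuous h.
  by move=> x; apply/differentiable_continuous/derivable1_diffP; case: (dh x).
rewrite /Rintegral (@continuous_FTC2 _ h' h)//.
- exact: continuous_subspaceT.
- split.
  + by move=> x _; case: (dh x).
  + exact/cvg_at_right_filter/ch.
  + exact/cvg_at_left_filter/ch.
- by move=> x _; rewrite derive1E; case: (dh x).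
Qed.

(** The increment is an integral of [h'] over a subinterval; extending [|h'|] to the whole of [0, 1]
    makes the bound independent of both points, so that it can be averaged over one of them. *)
Lemma variation_le_J h h' (r s : R) : 0 <= r <= 1 -> 0 <= s <= 1 ->
  continuous h' -> (forall x : R, is_derive x 1 h (h' x)) ->
  h s - h r <= J (fun x => `|h' x|).
Proof.
wlog suff : h h' r s / r < s -> 0 <= r -> s <= 1 -> continuous h' ->
   (forall x : R, is_derive x 1 h (h' x)) -> `|h s - h r| <= J (fun x => `|h' x|).
  move=> H /andP[r0 r1] /andP[s0 s1] ch dh.
  have [rs|sr|<-] := ltgtP r s; last by rewrite subrr; apply: Rintegral_ge0.
    exact: le_trans (ler_norm _) (H _ _ _ _ rs _ _ ch dh).
  by rewrite (le_trans (ler_norm _))// distrC; exact: (H _ _ _ _ sr).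
move=> rs r0 s1 ch dh; rewrite -(FTC_seg rs ch dh).
have ca : continuous (fun x => `|h' x|).
  by move=> x; apply: continuous_comp; [exact: ch|exact: norm_continuous].
apply: (le_trans (le_normr_Rintegral _ _)) => //.
  exact: continuous_integrable.
rewrite /Rintegral; apply: fine_le.
- exact/integrable_fin_num/(continuous_integrable _ _ ca).
- exact/integrable_fin_num/(continuous_integrable _ _ ca).
apply: ge0_subset_integral => //=.
- by have /integrableP[] := continuous_integrable 0 1 ca.
- apply: subset_itvScc => //; rewrite ?bnd_simp//.
Qed.

Lemma continuousMM f g : continuous f -> continuous g -> continuous (fun x => f x * g x).
Proof. by move=> cf cg x; apply: cvgM; [exact: cf|exact: cg]. Qed.

Lemma continuousDD f g : continuous f -> continuous g -> continuous (fun x => f x + g x).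
Proof. by move=> cf cg x; apply: cvgD; [exact: cf|exact: cg]. Qed.

Lemma continuous_cst (c : R) : continuous (fun _ : R => c).
Proof. by move=> x; exact: cvg_cst. Qed.

Lemma continuous_abs f : continuous f -> continuous (fun x => `|f x|).
Proof. by move=> cf x; apply: continuous_comp; [exact: cf|exact: norm_continuous]. Qed.

Lemma continuous_sum (I : Type) (s : seq I) (F : I -> R -> R) :
  (forall a, continuous (F a)) -> continuous (fun x => \sum_(a <- s) F a x).
Proof.
move=> cF; elim: s => [|a s IH].
  rewrite (_ : (fun x => _) = (fun=> 0)); first exact: continuous_cst.
  by apply/funext => x; rewrite big_nil.
rewrite (_ : (fun x => _) = (fun x => F a x + \sum_(b <- s) F b x)).
  exact: continuousDD.
by apply/funext => x; rewrite big_cons.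
Qed.

Lemma J_sum (I : Type) (s : seq I) (F : I -> R -> R) :
  (forall a, continuous (F a)) ->
  J (fun x => \sum_(a <- s) F a x) = \sum_(a <- s) J (F a).
Proof.
move=> cF; elim: s => [|a s IH].
  by rewrite big_nil -[RHS]J_cst; apply: eq_J => x; rewrite big_nil.
rewrite big_cons -IH -J_D//; last exact: continuous_sum.
by apply: eq_J => x; rewrite big_cons.
Qed.

Lemma J_variance g c : continuous g ->
  J (fun x => (g x - c) * (g x - c)) = J (fun x => g x * g x) - 2 * c * J g + c * c.
Proof.
move=> cg; have cgg := continuousMM cg cg; have cc := continuous_cst.
rewrite -mulNr -J_Z// -J_D//; last exact: continuousMM.
rewrite -[X in _ + X]J_cst -J_D//; last by apply: continuousDD => //; exact: continuousMM.
by apply: eq_J => x; ring.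
Qed.

Lemma J_jensen g : continuous g -> J g * J g <= J (fun x => g x * g x).
Proof.
move=> cg; have : 0 <= J (fun x => (g x - J g) * (g x - J g)).
  by apply: Rintegral_ge0 => x _; rewrite -expr2 sqr_ge0.
rewrite J_variance//; lra.
Qed.

(** Averaging the variation bound over one endpoint gives [|g s - J g| <= J |g'|] for every [s];
    squaring, integrating and Jensen finish. The constant 1 is not sharp. *)
Lemma J_poincare g g' : continuous g' -> (forall x : R, is_derive x 1 g (g' x)) ->
  J (fun x => g x * g x) <= J g * J g + J (fun x => g' x * g' x).
Proof.
move=> cg' dg.
have cg : continuous g.
  by move=> x; apply/differentiable_continuous/derivable1_diffP; case: (dg x).
have ca := continuous_abs cg'.
set A := J (fun x => `|g' x|).
have cc := continuous_cst.
have up s : 0 <= s <= 1 -> `|g s - J g| <= A.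
  move=> s01; rewrite ler_norml; apply/andP; split.
    suff : J g <= J (fun=> A + g s) by rewrite J_cst; lra.
    apply: le_J => // r r01.
    by have := variation_le_J s01 r01 cg' dg; rewrite -/A; lra.
  suff : J (fun=> g s) <= J (fun r => A + g r) by rewrite J_D// !J_cst; lra.
  apply: le_J => //; first exact: continuousDD.
  by move=> r r01; have := variation_le_J r01 s01 cg' dg; rewrite -/A; lra.
have : J (fun x => (g x - J g) * (g x - J g)) <= J (fun=> A * A).
  apply: le_J => //; first by apply: continuousMM; exact: continuousDD.
  move=> s /up h; rewrite -!expr2 -[leLHS]real_normK ?num_real//.
  have A0 : 0 <= A by apply: le_trans h.
  by rewrite ler_pXn2r ?nnegrE.
rewrite J_variance// J_cst.
have := J_jensen ca; rewrite -/A.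
have -> : J (fun x => `|g' x| * `|g' x|) = J (fun x => g' x * g' x).
  by apply: eq_J => x; rewrite -!expr2 real_normK ?num_real.
by lra.
Qed.

(** The variation bound is applied to [h^2]: the integrals of [|2 h h'|] and of [h^2] are both at
    most a constant times [J h]. The square on the left is the price for having only [J h] on the
    right. *)
Lemma J_sup h h' (K L s : R) : continuous h' -> (forall x : R, is_derive x 1 h (h' x)) ->
  (forall x, 0 <= h x <= K) -> (forall x, `|h' x| <= L) -> 0 <= s <= 1 ->
  h s * h s <= (K + 2 * L) * J h.
Proof.
move=> ch' dh hK hL s01.
have ch : continuous h.
  by move=> x; apply/differentiable_continuous/derivable1_diffP; case: (dh x).
have cc := continuous_cst.
have chh := continuousMM ch ch.
have c1 : continuous (fun x => 2 * (h x * h' x)).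
  by apply: continuousMM => //; exact: continuousMM.
have d1 (x : R) : is_derive x 1 (fun y => h y * h y) (2 * (h x * h' x)).
  by apply: is_derive_eq (is_deriveM (dh x) (dh x)) _; rewrite /GRing.scale/=; ring.
set A := J (fun x => `|2 * (h x * h' x)|).
have AL : A <= 2 * L * J h.
  rewrite -J_Z//; apply: le_J.
  - exact: continuous_abs.
  - exact: continuousMM.
  move=> x _; have /andP[h0 _] := hK x; have hl := hL x.
  rewrite !normrM (ger0_norm h0) ger0_norm// -mulrA ler_pM2l// mulrC.
  exact: ler_wpM2r.
have : J (fun=> h s * h s) <= J (fun r => A + h r * h r).
  apply: le_J => //; first exact: continuousDD.
  by move=> r r01; have := variation_le_J r01 s01 c1 d1; rewrite -/A; lra.
rewrite J_D// !J_cst.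
have : J (fun r => h r * h r) <= K * J h.
  rewrite -J_Z//; apply: le_J => //; first exact: continuousMM.
  by move=> x _; have /andP[h0 hk] := hK x; exact: ler_wpM2r.
rewrite mulrDl; lra.
Qed.

End UnitInterval.

(** Stated for [b] on either side of [a], because the increments of difference quotients have no
    sign. *)
Lemma MVT_between (R : realType) (phi dphi : R -> R) (a b : R) :
  (forall x, `|x - a| <= `|b - a| -> is_derive x 1 phi (dphi x)) ->
  exists2 c, `|c - a| <= `|b - a| & phi b - phi a = dphi c * (b - a).
Proof.
move=> dp; have [ab|ba|<-] := ltgtP a b; last first.
- by exists a; rewrite ?subrr ?normr0// mulr0.
- have dab x : b <= x <= a -> is_derive x 1 phi (dphi x).
    by move=> /andP[bx xa]; apply: dp; rewrite !ler0_norm ?subr_le0 ?(ltW ba)//; lra.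
  have [x xab|/=|c] := @MVT R phi dphi b a ba.
  + by apply: dab; move: xab; rewrite in_itv/= => /andP[/ltW-> /ltW->].
  + apply: derivable_within_continuous => x; rewrite in_itv/= => /dab.
    by case.
  + rewrite in_itv/= => /andP[/ltW bc /ltW ca] e; exists c.
      by rewrite !ler0_norm ?subr_le0 ?(ltW ba)//; lra.
    by rewrite -opprB e -mulrN opprB.
- have dab x : a <= x <= b -> is_derive x 1 phi (dphi x).
    by move=> /andP[ax xb]; apply: dp; rewrite !ger0_norm ?subr_ge0 ?(ltW ab)//; lra.
  have [x xab|/=|c] := @MVT R phi dphi a b ab.
  + by apply: dab; move: xab; rewrite in_itv/= => /andP[/ltW-> /ltW->].
  + apply: derivable_within_continuous => x; rewrite in_itv/= => /dab.
    by case.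
  + rewrite in_itv/= => /andP[/ltW ac /ltW cb] e; exists c => //.
    by rewrite !ger0_norm ?subr_ge0 ?(ltW ab)//; lra.
Qed.

(** * Integration in one coordinate and differentiation under the integral sign *)

Section PartialIntegral.
Variables (R : realType) (n : nat) (U : set 'rV[R]_n).
Hypothesis oU : open U.
Implicit Types (z v : 'rV[R]_n) (j k : 'I_n) (f : 'rV[R]_n -> R).
Notation J g := (Rintegral (@lebesgue_measure R) `[0%R, 1%R] g).

Definition stable j := forall z s, U z -> U (setc z j s).

Definition cont f := forall z, U z -> {for z, continuous f}.

Definition pint j f : 'rV[R]_n -> R := fun z => J (fun s => f (setc z j s)).

Lemma cont_line f j z : stable j -> cont f -> U z ->
  continuous (fun s => f (setc z j s)).
Proof.
move=> sj cf Uz s; apply: (@cvg_comp _ _ _ (setc z j) f); first exact: setc_continuous.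
exact/cf/sj.
Qed.

(** Tube argument: joint continuity of [(s, y) |-> f (setc y j s)] gives the bound near each [s],
    and compactness of [0, 1] makes the neighbourhood of [z] common to all [s]. *)
Lemma pint_near f j z (e : R) : stable j -> cont f -> U z -> 0 < e ->
  \forall y \near z, forall s, 0 <= s <= 1 ->
    `|f (setc z j s) - f (setc y j s)| < e.
Proof.
move=> sj cf Uz e0.
pose P y s := `|f (setc z j s) - f (setc y j s)| < e.
have := (@compact_near_coveringP R [set` `[0%R, 1%R]]).1 (@segment_compact _ 0 1) _ (nbhs z) P _.
suff H : forall x : R, [set` `[0%R, 1%R]] x -> \forall x' \near x & y \near z, P y x'.
  by move/(_ _ H); apply: filterS => y H' s s01; apply: H'; rewrite /= in_itv.
move=> s _.
have c1 : (fun p : R * 'rV[R]_n => f (setc p.2 j p.1)) @ (s, z) --> f (setc z j s).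
  apply: (@cvg_comp _ _ _ (fun p : R * 'rV[R]_n => setc p.2 j p.1) f); last exact/cf/sj.
  exact: (@setc_continuous2 R n j (s, z)).
have e2 : 0 < e / 2 by lra.
have /cvgrPdist_lt/(_ _ e2) [[A B] /= [As Bz] AB] := c1.
exists (A, B) => // -[s' y] /= [As' By].
have /= h1 := AB (s', y) (conj As' By).
have /= h2 := AB (s', z) (conj As' (nbhs_singleton Bz)).
rewrite /P (_ : _ - _ = (f (setc z j s) - f (setc y j s'))
  - (f (setc z j s) - f (setc z j s'))); last by ring.
by apply: le_lt_trans (ler_normB _ _) _; lra.
Qed.

Lemma nbhs_U z : U z -> nbhs z U.
Proof. by move=> Uz; exact: open_nbhs_nbhs. Qed.

Lemma pint_cont f j : stable j -> cont f -> cont (pint j f).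
Proof.
move=> sj cf z Uz; apply/(@cvgrPdist_le _ _ _ (nbhs z)) => e e0.
apply: (filterS _ (filterI (nbhs_U Uz) (pint_near sj cf Uz e0))) => y [Uy H].
have [cz cy] := (cont_line sj cf Uz, cont_line sj cf Uy).
rewrite ler_norml; apply/andP; split.
- rewrite lerBrDr addrC lerBlDr -[leRHS]addrC -[X in _ <= X + _]J_cst.
  rewrite -J_D //; last by move=> ?; exact: cvg_cst.
  apply: le_J => //; first by move=> s; apply: cvgD; [exact: cvg_cst|exact: cz].
  by move=> s /H; rewrite ltr_norml => /andP[]; lra.
- rewrite lerBlDr -[X in _ <= X + _]J_cst.
  rewrite -J_D //; last by move=> ?; exact: cvg_cst.
  apply: le_J => //; first by move=> s; apply: cvgD; [exact: cvg_cst|exact: cy].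
  by move=> s /H; rewrite ltr_norml => /andP[]; lra.
Qed.

(** No dominated convergence: for each [s] the mean value theorem writes the difference quotient as
    [pd k f] at an intermediate point, and [pint_near] keeps that value within [e] of
    [pd k f (setc z j s)], uniformly in [s]. *)
Lemma pint_pd f j k z : stable j -> k != j -> cont f -> cont (pd k f) ->
  (forall w, U w -> derivable f w (ev R k)) -> U z ->
  derivable (pint j f) z (ev R k) /\ pd k (pint j f) z = pint j (pd k f) z.
Proof.
move=> sj kj cf cdf df Uz; apply/is_derive_lineP; set t0 : R := z ord0 k.
suff lim : (fun h : R => h^-1 *: (pint j f (setc z k (h + t0)) - pint j f (setc z k t0)))
    @ 0^' --> pint j (pd k f) z.
  apply: DeriveDef.
    by apply/cvg_ex; exists (pint j (pd k f) z); move: lim; under eq_fun do rewrite -[X in X + t0](mulr1).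
  by apply: cvg_lim => //; move: lim; under eq_fun do rewrite -[X in X + t0](mulr1).
apply/cvgrPdist_le => e e0.
have ct : setc z k t @[t --> t0] --> z.
  by rewrite -[X in _ --> X](setcK z k); exact: setc_continuous.
have n1 : \forall t \near t0, U (setc z k t) by exact: (ct _ (nbhs_U Uz)).
have n2 : \forall t \near t0, forall s, 0 <= s <= 1 ->
    `|pd k f (setc z j s) - pd k f (setc (setc z k t) j s)| < e.
  exact: (ct _ (pint_near sj cdf Uz e0)).
have [d /= d0 Hd] := (@nbhs_ballP R R t0 _).1 (filterI n1 n2).
apply: ((@nbhs_ballP R R 0 _).2); exists d => //= h; rewrite /ball/= sub0r normrN => hd h0.
have Ud t : `|t - t0| <= `|h| -> U (setc z k t) /\ forall s, 0 <= s <= 1 ->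
    `|pd k f (setc z j s) - pd k f (setc (setc z k t) j s)| < e.
  by move=> th; apply: Hd; rewrite /ball/= distrC; exact: le_lt_trans th hd.
have key s : 0 <= s <= 1 ->
    `|pd k f (setc z j s) - h^-1 * (f (setc (setc z k (h + t0)) j s) - f (setc z j s))| < e.
  move=> s01.
  have [t|c] := @MVT_between R (fun t => f (setc (setc z j s) k t))
    (fun t => pd k f (setc (setc z j s) k t)) t0 (h + t0).
    rewrite addrK => /Ud[Ut _]; apply: is_derive_line; apply: df.
    by rewrite setcC 1?eq_sym//; exact: sj.
  rewrite addrK => /Ud[Uc /(_ s s01) H] /=.
  rewrite !(setcC _ _ _ (_ : j != k)) 1?eq_sym// setcK => ->.
  by rewrite mulrA mulrAC mulVf// mul1r.
have U1 : U (setc z k (h + t0)) by apply: (Ud _ _).1; rewrite addrK.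
have [cz c1] := (cont_line sj cf Uz, cont_line sj cf U1).
have cd := cont_line sj cdf Uz.
rewrite setcK.
have -> : h^-1 *: (pint j f (setc z k (h + t0)) - pint j f z) =
   J (fun s => h^-1 * (f (setc (setc z k (h + t0)) j s) + -1 * f (setc z j s))).
  rewrite J_Z; last first.
    move=> s; apply: cvgD; first exact: c1.
    by apply: cvgM; [exact: cvg_cst|exact: cz].
  rewrite J_D//; last by move=> s; apply: cvgM; [exact: cvg_cst|exact: cz].
  by rewrite J_Z// mulN1r.
have cq : continuous (fun s => h^-1 * (f (setc (setc z k (h + t0)) j s) + -1 * f (setc z j s))).
  move=> s; apply: cvgM; first exact: cvg_cst.
  apply: cvgD; first exact: c1.
  by apply: cvgM; [exact: cvg_cst|exact: cz].
rewrite ler_norml; apply/andP; split.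
- rewrite lerBrDr addrC lerBlDr -[leRHS]addrC -[X in _ <= X + _]J_cst.
  rewrite -J_D //; last by move=> ?; exact: cvg_cst.
  apply: le_J => //; first by move=> s; apply: cvgD; [exact: cvg_cst|exact: cd].
  by move=> s /key; rewrite ltr_norml mulN1r => /andP[]; lra.
- rewrite lerBlDr -[X in _ <= X + _]J_cst.
  rewrite -J_D //; last by move=> ?; exact: cvg_cst.
  apply: le_J => //; first by move=> s; apply: cvgD; [exact: cvg_cst|exact: cq].
  by move=> s /key; rewrite ltr_norml mulN1r => /andP[]; lra.
Qed.

Lemma pint_pd_same f j z : 
  derivable (pint j f) z (ev R j) /\ pd j (pint j f) z = 0.
Proof.
apply/is_derive_lineP.
rewrite (_ : (fun t => _) = cst (pint j f z)); first exact: is_derive_cst.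
by apply/funext => t /=; apply: eq_J => s; rewrite setc_setc.
Qed.

End PartialIntegral.

Lemma dist_le_split (R : realType) (x y w e : R) :
  `|x - w| < e / 2 -> `|y - w| < e / 2 -> `|x - y| <= e.
Proof.
move=> h1 h2; rewrite (_ : x - y = (x - w) - (y - w)); last by ring.
by apply: (le_trans (ler_normB _ _)); lra.
Qed.

Section PartialDerivatives.
Variables (R : realType) (n : nat).
Implicit Types (z v : 'rV[R]_n) (j k : 'I_n) (f g : 'rV[R]_n -> R).

Definition pderiv f z j d := derivable f z (ev R j) /\ pd j f z = d.

Lemma pderivE f z j d : pderiv f z j d <-> is_derive z (ev R j) f d.
Proof. by split=> [[h <-]|[h <-]]; [exact: derivableP|split]. Qed.

Lemma pderiv_cst c z j : pderiv (fun=> c) z j 0.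
Proof. by apply/pderivE; exact: is_derive_cst. Qed.

Lemma pderivD f g z j df dg : pderiv f z j df -> pderiv g z j dg ->
  pderiv (fun w => f w + g w) z j (df + dg).
Proof. by move=> /pderivE hf /pderivE hg; apply/pderivE; exact: is_deriveD. Qed.

Lemma pderivM f g z j df dg : pderiv f z j df -> pderiv g z j dg ->
  pderiv (fun w => f w * g w) z j (df * g z + f z * dg).
Proof.
move=> /pderivE hf /pderivE hg; apply/pderivE.
by apply: is_derive_eq (is_deriveM hf hg) _; rewrite /GRing.scale/= addrC mulrC.
Qed.

Lemma pderivV f z j df : f z != 0 -> pderiv f z j df ->
  pderiv (fun w => (f w)^-1) z j (- df / f z ^+ 2).
Proof.
move=> f0 [h <-]; split; first exact: derivableV.
by rewrite /pd deriveV// /GRing.scale/= !mulNr mulrC.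
Qed.

Lemma pderiv_ln f z j df : 0 < f z -> pderiv f z j df ->
  pderiv (fun w => ln (f w)) z j (df / f z).
Proof.
move=> f0 /is_derive_lineP h; apply/is_derive_lineP.
have f0' : 0 < f (setc z j (z ord0 j)) by rewrite setcK.
have := @is_derive1_comp _ (@ln R) _ _ _ _ (is_derive1_ln f0') h.
by rewrite setcK mulrC.
Qed.

Lemma near_pderiv f g z j d : (\near z, f z = g z) -> pderiv f z j d -> pderiv g z j d.
Proof. by move=> fg /pderivE h; apply/pderivE; exact: near_eq_is_derive h. Qed.

End PartialDerivatives.

(** * Closure properties of smooth functions and symmetry of mixed derivatives *)

Section Smooth.
Variables (R : realType) (n : nat) (U : set 'rV[R]_n).
Hypothesis oU : open U.
Implicit Types (z v : 'rV[R]_n) (j k : 'I_n) (f g : 'rV[R]_n -> R).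

Lemma near_eq_on f g z : U z -> (forall w, U w -> f w = g w) -> \near z, f z = g z.
Proof. by move=> Uz fg; apply: (filterS _ (nbhs_U oU Uz)) => w /fg. Qed.

Lemma pderiv_eq_on f g z j d : U z -> (forall w, U w -> f w = g w) ->
  pderiv f z j d -> pderiv g z j d.
Proof. by move=> Uz fg; apply: near_pderiv; exact: near_eq_on. Qed.

Lemma pd_eq_on f g z j : U z -> (forall w, U w -> f w = g w) ->
  pd j f z = pd j g z.
Proof. by move=> Uz fg; apply: near_eq_derive; exact: near_eq_on. Qed.

Lemma cont_eq_on f g : (forall w, U w -> f w = g w) -> cont U f -> cont U g.
Proof.
move=> fg cf z Uz; suff : g @ z --> g z by []; rewrite -(fg _ Uz).
apply: cvg_trans (cf z Uz); exact: (@near_eq_cvg _ _ (nbhs z) _ _ _ (near_eq_on Uz fg)).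
Qed.

(* The closure of the smooth functions under the operations needed below is
   stable under partial derivatives, which makes all its members smooth. *)
Inductive gen : ('rV[R]_n -> R) -> Prop :=
| gen_smooth f : smooth_on U f -> gen f
| gen_cst c : gen (fun=> c)
| gen_add f g : gen f -> gen g -> gen (fun w => f w + g w)
| gen_mul f g : gen f -> gen g -> gen (fun w => f w * g w)
| gen_inv f : (forall z, U z -> f z != 0) -> gen f -> gen (fun w => (f w)^-1)
| gen_ln f : (forall z, U z -> 0 < f z) -> gen f -> gen (fun w => ln (f w))
| gen_pint j f : stable U j -> gen f -> gen (pint j f).

Lemma gen_cont f : gen f -> cont U f.
Proof.
elim=> {f} [f sf|c|f g _ cf _ cg|f g _ cf _ cg|f f0 _ cf|f f0 _ cf|j f sj _ cf] z Uz.
- exact: (sf [::] z Uz).1.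
- exact: (@cvg_cst _ _ _ (nbhs z) _).
- exact: (continuousD (cf z Uz) (cg z Uz)).
- exact: (continuousM (cf z Uz) (cg z Uz)).
- exact: (continuousV (f0 z Uz) (cf z Uz)).
- exact: (continuous_comp (cf z Uz) (continuous_ln (f0 z Uz))).
- exact: (pint_cont oU sj cf Uz).
Qed.

(** The derivative formulas hold on [U] only, and [pd j f] is uncontrolled elsewhere. Hence [gen] is
    closed under derivation only up to equality on [U], which the witness [g] expresses. *)
Lemma gen_pderiv f : gen f -> forall j,
  exists2 g, gen g & forall z, U z -> pderiv f z j (g z).
Proof.
elim=> {f} [f sf|c|f g gf hf gg hg|f g gf hf gg hg|f f0 gf hf|f f0 gf hf|k f sk gf hf] j.
- exists (pd j f).
    apply: gen_smooth => js z Uz.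
    have -> : pds js (pd j f) = pds (rcons js j) f by elim: js => //= a js ->.
    exact: sf.
  by move=> z Uz; split=> //; exact: (sf [::] z Uz).2.
- by exists (fun=> 0); [exact: gen_cst|move=> z _; exact: pderiv_cst].
- have [f' gf' df] := hf j; have [g' gg' dg] := hg j.
  exists (fun w => f' w + g' w); first exact: gen_add.
  by move=> z Uz; apply: pderivD; [exact: df|exact: dg].
- have [f' gf' df] := hf j; have [g' gg' dg] := hg j.
  exists (fun w => f' w * g w + f w * g' w).
    by apply: gen_add; exact: gen_mul.
  by move=> z Uz; apply: pderivM; [exact: df|exact: dg].
- have [f' gf' df] := hf j.
  exists (fun w => (fun v => (fun=> -1) v * f' v) w * (fun v => (f v * f v)^-1) w).
    apply: gen_mul; first by apply: gen_mul => //; exact: gen_cst.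
    apply: gen_inv; last exact: gen_mul.
    by move=> z /f0 h; rewrite mulf_neq0.
  by move=> z Uz /=; rewrite mulN1r -expr2; apply: pderivV; [exact: f0|exact: df].
- have [f' gf' df] := hf j.
  exists (fun w => f' w * (fun v => (f v)^-1) w).
    apply: gen_mul => //; apply: gen_inv => // z Uz.
    by rewrite gt_eqF// f0.
  by move=> z Uz /=; apply: pderiv_ln; [exact: f0|exact: df].
- have [f' gf' df] := hf j.
  have [->|jk] := eqVneq j k.
    by exists (fun=> 0); [exact: gen_cst|move=> z _; exact: pint_pd_same].
  exists (pint k f'); first exact: gen_pint.
  move=> z Uz.
  have e w : U w -> f' w = pd j f w by move=> Uw; rewrite (df w Uw).2.
  have cd : cont U (pd j f) by apply: cont_eq_on e _; exact: gen_cont.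
  have [h1 h2] := pint_pd oU sk jk (gen_cont gf) cd (fun w Uw => (df w Uw).1) Uz.
  by split=> //; rewrite h2; apply: eq_J => s; rewrite e//; exact: sk.
Qed.

Lemma smooth_gen f : gen f -> smooth_on U f.
Proof.
move=> gf js.
have [g gg e] : exists2 g, gen g & forall z, U z -> g z = pds js f z.
  elim: js => [|j js [g gg e]] /=; first by exists f.
  have [g' gg' dg] := gen_pderiv gg j.
  exists g' => // z Uz; rewrite -(dg z Uz).2.
  exact: pd_eq_on.
move=> z Uz; split; first exact: (cont_eq_on e (gen_cont gg)).
move=> j; have [g' _ dg] := gen_pderiv gg j.
by have [] := pderiv_eq_on Uz e (dg z Uz).
Qed.

Lemma smooth_pds js f : smooth_on U f -> smooth_on U (pds js f).
Proof.
move=> sf ks z Uz; rewrite (_ : pds ks (pds js f) = pds (ks ++ js) f); first exact: sf.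
by elim: ks => //= k ks ->.
Qed.

Lemma smooth_pd j f : smooth_on U f -> smooth_on U (pd j f).
Proof. exact: (smooth_pds [:: j]). Qed.

Lemma smooth_cst c : smooth_on U (fun=> c).
Proof. exact/smooth_gen/gen_cst. Qed.

Lemma smoothD f g : smooth_on U f -> smooth_on U g -> smooth_on U (fun w => f w + g w).
Proof. by move=> sf sg; apply/smooth_gen/gen_add; exact: gen_smooth. Qed.

Lemma smoothM f g : smooth_on U f -> smooth_on U g -> smooth_on U (fun w => f w * g w).
Proof. by move=> sf sg; apply/smooth_gen/gen_mul; exact: gen_smooth. Qed.

Lemma smoothV f : (forall z, U z -> f z != 0) -> smooth_on U f ->
  smooth_on U (fun w => (f w)^-1).
Proof. by move=> f0 sf; apply/smooth_gen/gen_inv => //; exact: gen_smooth. Qed.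

Lemma smooth_ln f : (forall z, U z -> 0 < f z) -> smooth_on U f ->
  smooth_on U (fun w => ln (f w)).
Proof. by move=> f0 sf; apply/smooth_gen/gen_ln => //; exact: gen_smooth. Qed.

Lemma smooth_pint j f : stable U j -> smooth_on U f -> smooth_on U (pint j f).
Proof. by move=> sj sf; apply/smooth_gen/gen_pint => //; exact: gen_smooth. Qed.

Lemma smooth_cont f : smooth_on U f -> cont U f.
Proof. by move=> sf z Uz; exact: (sf [::] z Uz).1. Qed.

Lemma smooth_pderiv f z j : smooth_on U f -> U z -> pderiv f z j (pd j f z).
Proof. by move=> sf Uz; split=> //; exact: (sf [::] z Uz).2. Qed.

Lemma pint_pd_smooth f j k z : stable U j -> k != j -> smooth_on U f -> U z ->
  pd k (pint j f) z = pint j (pd k f) z.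
Proof.
move=> sj kj sf Uz; apply: (pint_pd oU sj kj _ _ _ Uz).2.
- exact: smooth_cont.
- exact/smooth_cont/smooth_pd.
- by move=> w Uw; exact: (smooth_pderiv k sf Uw).1.
Qed.

(** The second difference of Schwarz's theorem; its symmetry in [i] and [j] is what makes mixed
    derivatives commute. *)
Definition mixdiff f z i j (h : R) : R :=
  f (setc (setc z i (h + z ord0 i)) j (h + z ord0 j)) - f (setc z j (h + z ord0 j))
  - (f (setc z i (h + z ord0 i)) - f z).

Lemma mixdiff_sym f z i j h : i != j -> mixdiff f z i j h = mixdiff f z j i h.
Proof. by move=> ij; rewrite /mixdiff setcC//; ring. Qed.

Lemma mixdiff_MVT f z i j h : i != j -> smooth_on U f ->
  (forall c d, `|c - z ord0 i| <= `|h| -> `|d - z ord0 j| <= `|h| ->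
     U (setc (setc z i c) j d)) ->
  exists c d, [/\ `|c - z ord0 i| <= `|h|, `|d - z ord0 j| <= `|h| &
    mixdiff f z i j h = pd j (pd i f) (setc (setc z i c) j d) * (h * h)].
Proof.
move=> ij sf HU; set a := z ord0 i; set b := z ord0 j.
have z0 : `|b - b| <= `|h| by rewrite subrr normr0.
have zh : `|h + b - b| <= `|h| by rewrite addrK.
have ji : j != i by rewrite eq_sym.
have [t|c] := @MVT_between R
  (fun t => f (setc (setc z i t) j (h + b)) - f (setc z i t))
  (fun t => pd i f (setc (setc z i t) j (h + b)) - pd i f (setc z i t)) a (h + a).
  rewrite addrK => ta.
  have U1 : U (setc (setc z i t) j (h + b)) by exact: HU.
  have U2 : U (setc z i t).
    by have := HU _ _ ta z0; rewrite setcC// setcK.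
  have -> : (fun t => f (setc (setc z i t) j (h + b)) - f (setc z i t)) =
    (fun t => f (setc (setc z j (h + b)) i t)) - (fun t => f (setc z i t)).
    by apply/funext => t' /=; rewrite setcC.
  apply: is_deriveB; last first.
    exact: is_derive_line (smooth_pderiv i sf U2).1.
  rewrite setcC//; apply: is_derive_line; rewrite setcC//.
  exact: (smooth_pderiv i sf U1).1.
rewrite addrK => ca /= Hc.
have Ec : setc (setc z i c) j b = setc z i c by rewrite setcC// setcK.
have [t|d] := @MVT_between R (fun t => pd i f (setc (setc z i c) j t))
  (fun t => pd j (pd i f) (setc (setc z i c) j t)) b (h + b).
  rewrite addrK => tb; apply: is_derive_line.
  by apply: (smooth_pderiv j (smooth_pd i sf) _).1; exact: HU.
rewrite addrK => db /=; rewrite Ec => Hd.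
exists c, d; split=> //.
by rewrite mulrA -Hd -Hc /mixdiff -/a -/b setcK; ring.
Qed.

(** The second difference is evaluated by the mean value theorem in both orders. This equates the
    two mixed derivatives at two points near [z], and continuity brings both back to [z]. *)
Lemma pdC f z i j : smooth_on U f -> U z -> pd i (pd j f) z = pd j (pd i f) z.
Proof.
move=> sf Uz; have [->//|ij] := eqVneq i j.
have ji : j != i by rewrite eq_sym.
apply/eqP; rewrite -subr_eq0 -normr_le0; apply/ler_addgt0Pr => e e0; rewrite add0r.
have e2 : 0 < e / 2 by lra.
have c1 := smooth_cont (smooth_pd i (smooth_pd j sf)) Uz.
have c2 := smooth_cont (smooth_pd j (smooth_pd i sf)) Uz.
have n1 := (@cvgrPdist_lt _ _ _ (nbhs z) (nbhs_filter z) _ _).1 c1 _ e2.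
have n2 := (@cvgrPdist_lt _ _ _ (nbhs z) (nbhs_filter z) _ _).1 c2 _ e2.
have [d /= d0 Hd] := (@nbhs_ballP R 'rV[R]_n z _).1 (filterI (nbhs_U oU Uz) (filterI n1 n2)).
(* Half the radius serves as increment: each changed coordinate moves by at most [d / 2 < d], so all
   intermediate points stay in the open ball of the sup norm. *)
have Hb c c' : `|c - z ord0 i| <= `|d / 2| -> `|c' - z ord0 j| <= `|d / 2| ->
    ball z d (setc (setc z i c) j c').
  have d2 : 0 < d / 2 by rewrite divr_gt0.
  have dd : d / 2 < d by rewrite ltr_pdivrMr ?ltr_pMr ?ltr1n.
  rewrite (gtr0_norm d2).
  move=> h1 h2; split=> [|i0 k]; first exact: d0.
  rewrite ord1 !mxE /ball/= distrC.
  case: (eqVneq k j) => [->|_]; first exact: le_lt_trans h2 dd.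
  case: (eqVneq k i) => [->|_]; first exact: le_lt_trans h1 dd.
  by rewrite subrr normr0.
have [c [c' [hc hc' E1]]] := mixdiff_MVT ij sf (fun a b ha hb => (Hd _ (Hb a b ha hb)).1).
have Hb' a b : `|a - z ord0 j| <= `|d / 2| -> `|b - z ord0 i| <= `|d / 2| ->
    ball z d (setc (setc z j a) i b).
  by move=> h1 h2; rewrite setcC//; exact: Hb.
have [b [b' [hb hb' E2]]] := mixdiff_MVT ji sf (fun a b ha hb => (Hd _ (Hb' a b ha hb)).1).
have [_ [_ /= F1]] := Hd _ (Hb _ _ hc hc').
have [_ [/= F2 _]] := Hd _ (Hb' _ _ hb hb').
have E : pd j (pd i f) (setc (setc z i c) j c') = pd i (pd j f) (setc (setc z j b) i b').
  have d2 : d / 2 * (d / 2) != 0 by apply: mulf_neq0; rewrite gt_eqF // divr_gt0.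
  have E3 := etrans (esym E1) (etrans (mixdiff_sym f z (d / 2) ij) E2).
  exact: (mulIf d2 E3).
rewrite {}E in F1.
exact: dist_le_split F2 F1.
Qed.

End Smooth.

(** * Integration over the torus *)

Section SpaceTimeCalculus.
Variables (R : realType) (N : nat).
Notation ST := 'rV[R]_N.+1.
Implicit Types (f g : ST -> R) (z w : ST) (i : 'I_N) (j k : 'I_N.+1).
Notation J g := (Rintegral (@lebesgue_measure R) `[0%R, 1%R] g).

Definition Ut : set ST := [set z | 0 < time z].

Lemma open_Ut : open Ut.
Proof.
rewrite (_ : Ut = (fun w : ST => w ord0 ord0) @^-1` [set x | 0 < x])//.
by apply: open_comp; [move=> z _; exact: coord_continuous|exact: open_gt].
Qed.
Local Hint Resolve open_Ut : core.

Lemma time_setc z j s : j != ord0 -> time (setc z j s) = time z.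
Proof. by move=> j0; rewrite /time mxE eq_sym (negbTE j0). Qed.

Lemma stable_Ut j : j != ord0 -> stable Ut j.
Proof. by move=> j0 z s Uz; rewrite /Ut/= time_setc. Qed.

Lemma xc_neq0 i : xc i != ord0.
Proof. by rewrite eq_sym; exact: neq_lift. Qed.
Local Hint Resolve xc_neq0 : core.

Definition nice f := smooth_on Ut f /\ xperiodic f.

Lemma nice_cst c : nice (fun=> c).
Proof. by split; first exact: smooth_cst. Qed.

Lemma niceD f g : nice f -> nice g -> nice (fun w => f w + g w).
Proof.
by move=> [sf pf] [sg pg]; split; [exact: smoothD|move=> z i; rewrite pf pg].
Qed.

Lemma niceM f g : nice f -> nice g -> nice (fun w => f w * g w).
Proof.
by move=> [sf pf] [sg pg]; split; [exact: smoothM|move=> z i; rewrite pf pg].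
Qed.

Lemma niceN f : nice f -> nice (fun w => - f w).
Proof.
move=> nf; rewrite (_ : (fun w => _) = (fun w => -1 * f w)).
  exact: (niceM (nice_cst _)).
by apply/funext => w; rewrite mulN1r.
Qed.

Lemma niceX f n : nice f -> nice (fun w => f w ^+ n).
Proof.
move=> nf; elim: n => [|n IH]; first exact: nice_cst.
under eq_fun do rewrite exprS; exact: niceM.
Qed.

Lemma niceV f : (forall z, Ut z -> 0 < f z) -> nice f -> nice (fun w => (f w)^-1).
Proof.
move=> f0 [sf pf]; split; last by move=> z i; rewrite pf.
by apply: smoothV => // z /f0 h; rewrite gt_eqF.
Qed.

Lemma nice_ln f : (forall z, Ut z -> 0 < f z) -> nice f -> nice (fun w => ln (f w)).
Proof.
move=> f0 [sf pf]; split; last by move=> z i; rewrite pf.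
exact: smooth_ln.
Qed.

Lemma nice_sum (I : Type) (s : seq I) (F : I -> ST -> R) : (forall a, nice (F a)) ->
  nice (fun w => \sum_(a <- s) F a w).
Proof.
move=> nF; elim: s => [|a s IH].
  rewrite (_ : (fun w => _) = (fun=> 0)); first exact: nice_cst.
  by apply/funext => w; rewrite big_nil.
rewrite (_ : (fun w => _) = (fun w => F a w + \sum_(b <- s) F b w)); first exact: niceD.
by apply/funext => w; rewrite big_cons.
Qed.

Lemma nice_pd j f : nice f -> nice (pd j f).
Proof.
move=> [sf pf]; split; first exact: smooth_pd.
move=> z i; rewrite /pd /derive.
set g1 := fun h => h^-1 *: _; set g2 := fun h => h^-1 *: _.
suff -> : g1 = g2 by [].
by apply/funext => h; rewrite /g1 /g2 /= addrA !pf.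
Qed.

Lemma nice_pds js f : nice f -> nice (pds js f).
Proof. by move=> nf; elim: js => //= j js IH; exact: nice_pd. Qed.

Section Rules.
Variables (z : ST) (j : 'I_N.+1).
Hypothesis Uz : Ut z.

Lemma nice_pderiv f : nice f -> pderiv f z j (pd j f z).
Proof. by move=> [sf _]; exact: smooth_pderiv sf _. Qed.

Lemma pd_cst c : pd j (fun=> c) z = 0.
Proof. exact: (pderiv_cst c z j).2. Qed.

Lemma pdD f g : nice f -> nice g -> pd j (fun w => f w + g w) z = pd j f z + pd j g z.
Proof. by move=> /nice_pderiv hf /nice_pderiv hg; exact: (pderivD hf hg).2. Qed.

Lemma pdM f g : nice f -> nice g ->
  pd j (fun w => f w * g w) z = pd j f z * g z + f z * pd j g z.
Proof. by move=> /nice_pderiv hf /nice_pderiv hg; exact: (pderivM hf hg).2. Qed.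

Lemma pdZ c f : nice f -> pd j (fun w => c * f w) z = c * pd j f z.
Proof. by move=> nf; rewrite (pdM (nice_cst c) nf) pd_cst mul0r add0r. Qed.

Lemma pdZr c f : nice f -> pd j (fun w => f w * c) z = pd j f z * c.
Proof. by move=> nf; rewrite (pdM nf (nice_cst c)) pd_cst mulr0 addr0. Qed.

Lemma pdN f : nice f -> pd j (fun w => - f w) z = - pd j f z.
Proof.
move=> nf; rewrite -mulN1r -pdZ//; congr (pd j _ z).
by apply/funext => w; rewrite mulN1r.
Qed.

Lemma pdB f g : nice f -> nice g -> pd j (fun w => f w - g w) z = pd j f z - pd j g z.
Proof. by move=> nf ng; rewrite (pdD nf (niceN ng)) pdN. Qed.

Lemma pdX2 f : nice f -> pd j (fun w => f w ^+ 2) z = 2 * (f z * pd j f z).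
Proof. by move=> nf; under eq_fun do rewrite expr2; rewrite pdM//; ring. Qed.

Lemma pdV f : (forall w, Ut w -> 0 < f w) -> nice f ->
  pd j (fun w => (f w)^-1) z = - pd j f z / f z ^+ 2.
Proof.
by move=> f0 /nice_pderiv hf; apply: (pderivV _ hf).2; rewrite gt_eqF// f0.
Qed.

Lemma pd_ln f : (forall w, Ut w -> 0 < f w) -> nice f ->
  pd j (fun w => ln (f w)) z = pd j f z / f z.
Proof. by move=> f0 /nice_pderiv hf; apply: (pderiv_ln _ hf).2; rewrite f0. Qed.

Lemma pd_sum (I : Type) (s : seq I) (F : I -> ST -> R) : (forall a, nice (F a)) ->
  pd j (fun w => \sum_(a <- s) F a w) z = \sum_(a <- s) pd j (F a) z.
Proof.
move=> nF; elim: s => [|a s IH].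
  by rewrite big_nil; under eq_fun do rewrite big_nil; exact: pd_cst.
rewrite big_cons -IH -pdD//; last exact: nice_sum.
by congr (pd j _ z); apply/funext => w; rewrite big_cons.
Qed.

Lemma nice_pdC k f : nice f -> pd j (pd k f) z = pd k (pd j f) z.
Proof. by move=> [sf _]; apply: (pdC _ _ _ sf). Qed.

End Rules.

Definition spatial (js : seq 'I_N.+1) := all (fun j => j != ord0) js.

Lemma nice_pint j f : j != ord0 -> nice f -> nice (pint j f).
Proof.
move=> j0 [sf pf]; split; first by apply: smooth_pint => //; exact: stable_Ut.
move=> z i; apply: eq_J => s.
have [->|ij] := eqVneq j (xc i).
  by congr f; apply/rowP => k; rewrite !mxE; case: eqVneq => //; rewrite mulr0n addr0.
rewrite -[RHS](pf _ i); congr f; apply/rowP => k; rewrite !mxE.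
by case: (eqVneq k j) => [->|//]; rewrite (negbTE ij) andbF addr0.
Qed.

Lemma nice_itint js f : spatial js -> nice f -> nice (itint js f).
Proof. by elim: js => //= j js IH /andP[j0 sjs] nf; apply: nice_pint => //; exact: IH. Qed.

Lemma nice_line j f z : j != ord0 -> nice f -> Ut z -> continuous (fun s => f (setc z j s)).
Proof.
by move=> j0 [sf _] Uz; apply: (cont_line (stable_Ut j0) _ Uz); exact: smooth_cont.
Qed.

Lemma itint_line j js f z : j != ord0 -> spatial js -> nice f -> Ut z ->
  continuous (fun s => itint js f (setc z j s)).
Proof. by move=> j0 sj nf; apply: nice_line => //; exact: nice_itint. Qed.

Lemma itint_pd js k f z : spatial js -> k \notin js -> nice f -> Ut z ->
  pd k (itint js f) z = itint js (pd k f) z.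
Proof.
elim: js z => //= j js IH z /andP[j0 sjs]; rewrite inE negb_or => /andP[kj kjs] nf Uz.
have sj := stable_Ut j0.
transitivity (pd k (pint j (itint js f)) z) => //.
rewrite (pint_pd_smooth open_Ut sj kj _ Uz); last exact: (nice_itint sjs nf).1.
by apply: eq_J => s; apply: IH => //; exact: sj.
Qed.

Lemma eq_itint js f g z : spatial js -> (forall w, time w = time z -> f w = g w) ->
  itint js f z = itint js g z.
Proof.
elim: js z => [|j js IH] z /=; first by move=> _; exact.
move=> /andP[j0 sjs] fg; apply: eq_J => s; apply: IH => // w.
by rewrite time_setc//; exact: fg.
Qed.

Lemma itintD js f g z : spatial js -> nice f -> nice g -> Ut z ->
  itint js (fun w => f w + g w) z = itint js f z + itint js g z.
Proof.
elim: js z => //= j js IH z /andP[j0 sjs] nf ng Uz.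
rewrite -J_D; [|exact: itint_line..].
by apply: eq_J => s; apply: IH => //; exact: stable_Ut.
Qed.

Lemma itintZ js c f z : spatial js -> nice f -> Ut z ->
  itint js (fun w => c * f w) z = c * itint js f z.
Proof.
elim: js z => //= j js IH z /andP[j0 sjs] nf Uz.
rewrite -J_Z; last exact: itint_line.
by apply: eq_J => s; apply: IH => //; exact: stable_Ut.
Qed.

Lemma itint_cst js c z : itint js (fun=> c) z = c.
Proof.
elim: js z => //= j js IH z; rewrite -[RHS]J_cst; exact: eq_J.
Qed.

Lemma le_itint js f g z : spatial js -> nice f -> nice g -> Ut z ->
  (forall w, time w = time z -> f w <= g w) -> itint js f z <= itint js g z.
Proof.
elim: js z => [|j js IH] z /=; first by move=> _ _ _ _; exact.
move=> /andP[j0 sjs] nf ng Uz fg.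
apply: le_J => [||s _]; [exact: itint_line..|apply: IH => //; first exact: stable_Ut].
by move=> w; rewrite time_setc//; exact: fg.
Qed.

(** If [k] is integrated further inside, the inner integral already vanishes. If [k] is the
    outermost coordinate, the derivative is pulled out of the inner integrals, and the fundamental
    theorem leaves a difference of values one period apart. *)
Lemma itint_pd0 js k f z : spatial js -> k \in js -> nice f -> Ut z ->
  itint js (pd k f) z = 0.
Proof.
elim: js z => //= j js IH z /andP[j0 sjs] kjs nf Uz.
have [kin|knin] := boolP (k \in js).
  rewrite -[RHS]J_cst; apply: eq_J => s; apply: IH => //; exact: stable_Ut.
move: kjs; rewrite inE (negbTE knin) orbF => /eqP kj; rewrite {}kj in knin *.
have sU s : Ut (setc z j s) by exact: stable_Ut.
have [G [nG GE]] : exists G, nice G /\ G = itint js f by exists (itint js f); split=> //; exact: nice_itint.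
transitivity (J (fun s => pd j G (setc z j s))).
  by apply: eq_J => s; rewrite GE itint_pd.
have c1 : continuous (fun s => pd j G (setc z j s)).
  by apply: nice_line => //; exact: nice_pd.
have d1 (s : R) : is_derive s 1 (fun s => G (setc z j s)) (pd j G (setc z j s)).
  by apply: is_derive_line; exact: (nice_pderiv j (sU s) nG).1.
rewrite (FTC_seg ltr01 c1 d1).
have [i ->] : exists i, j = xc i.
  by case: (unliftP ord0 j) => [i ->|E]; [exists i|rewrite E eqxx in j0].
rewrite -(nG.2 (setc z (xc i) 0) i); apply/eqP; rewrite subr_eq0; apply/eqP.
congr G; apply/rowP => l; rewrite !mxE /=.
by case: eqVneq; rewrite ?add0r ?addr0.
Qed.

Lemma itint_variance js f c z : spatial js -> nice f -> Ut z ->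
  itint js (fun w => (f w - c) ^+ 2) z =
  itint js (fun w => f w ^+ 2) z - 2 * c * itint js f z + c ^+ 2.
Proof.
move=> sj nf Uz; have nf2 := niceX 2 nf.
rewrite -mulNr -itintZ// -itintD//; last exact: (niceM (nice_cst _)).
rewrite -[X in _ + X](itint_cst js _ z) -itintD//; last first.
- exact: nice_cst.
- by apply: niceD => //; exact: (niceM (nice_cst _)).
by apply: eq_itint => // w _; ring.
Qed.

Lemma itint_jensen js f z : spatial js -> nice f -> Ut z ->
  itint js f z ^+ 2 <= itint js (fun w => f w ^+ 2) z.
Proof.
move=> sj nf Uz.
have : 0 <= itint js (fun w => (f w - itint js f z) ^+ 2) z.
  rewrite -[leLHS](itint_cst js _ z); apply: le_itint => //; first exact: nice_cst.
    exact/niceX/(niceD nf)/nice_cst.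
  by move=> w _; rewrite sqr_ge0.
rewrite itint_variance//; move: (itint _ _ _) (itint _ _ _) => a b; nra.
Qed.

(** Tensorization: the induction hypothesis on each slice, then the one-dimensional inequality for
    the inner integral of [f] as a function of the outer coordinate. Jensen moves the last square
    inside. *)
Lemma itint_poincare js f z : spatial js -> uniq js -> nice f -> Ut z ->
  itint js (fun w => f w ^+ 2) z <= itint js f z ^+ 2
    + \sum_(j <- js) itint js (fun w => pd j f w ^+ 2) z.
Proof.
move=> + + nf; elim: js z => [|j js IH] z; first by rewrite big_nil addr0.
move=> /= /andP[j0 sjs] /andP[jjs ujs] Uz.
have sU s : Ut (setc z j s) by exact: stable_Ut.
have nq k : nice (fun w => pd k f w ^+ 2) by exact/niceX/nice_pd.
have nG : nice (itint js f) by exact: nice_itint.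
have cj k : continuous (fun s => itint js (fun w => pd k f w ^+ 2) (setc z j s)).
  exact: itint_line.
have csum : continuous (fun s => \sum_(k <- js) itint js (fun w => pd k f w ^+ 2) (setc z j s)).
  exact: continuous_sum.
have cg2 : continuous (fun s => itint js f (setc z j s) * itint js f (setc z j s)).
  by apply: continuousMM; exact: nice_line.
rewrite big_cons.
apply: (@le_trans _ _ (J (fun s => itint js f (setc z j s) * itint js f (setc z j s) +
     \sum_(k <- js) itint js (fun w => pd k f w ^+ 2) (setc z j s)))).
  apply: le_J; first by apply: itint_line => //; exact: niceX.
    exact: continuousDD.
  by move=> s _; rewrite -expr2; apply: IH.
rewrite J_D// J_sum// addrA lerD2r.
have cd : continuous (fun s => pd j (itint js f) (setc z j s)).
  by apply: nice_line => //; exact: nice_pd.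
apply: (le_trans (@J_poincare R _ (fun s => pd j (itint js f) (setc z j s)) cd _)).
  by move=> s; apply: is_derive_line; exact: (nice_pderiv j (sU s) nG).1.
rewrite -expr2 lerD2l; apply: le_J => //; first exact: continuousMM.
move=> s _; rewrite -expr2 itint_pd//; apply: itint_jensen => //.
exact: nice_pd.
Qed.

Lemma periodic_nat f i z (m : nat) : xperiodic f -> f (m%:R *: ev R (xc i) + z) = f z.
Proof.
move=> pf; elim: m => [|m IH]; first by rewrite scale0r add0r.
rewrite -[RHS]IH -[RHS](pf _ i); congr f.
by rewrite [m.+1%:R]mulrSr scalerDl scale1r addrAC.
Qed.

Lemma periodic_int f i z (m : int) : xperiodic f -> f (m%:~R *: ev R (xc i) + z) = f z.
Proof.
move=> pf; case: m => m; first exact: periodic_nat.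
rewrite -[LHS](periodic_nat i _ m.+1)//; congr f.
by rewrite NegzE rmorphN/= addrA -scalerDl subrr scale0r add0r.
Qed.

Lemma pint_sup j f z (K L : R) : j != ord0 -> nice f -> Ut z ->
  (forall w, time w = time z -> 0 <= f w <= K) ->
  (forall w, time w = time z -> `|pd j f w| <= L) ->
  f z ^+ 2 <= (K + 2 * L) * pint j f z.
Proof.
move=> j0 nf Uz hK hL.
have [i ij] : exists i, j = xc i.
  by case: (unliftP ord0 j) => [i ->|E]; [exists i|rewrite E eqxx in j0].
(* Subtracting the integer part moves the coordinate into [0, 1], where [J_sup] applies; periodicity
   preserves the value of [f]. *)
pose s := z ord0 j - (Num.floor (z ord0 j))%:~R.
have -> : f z = f (setc z j s).
  rewrite setcE /s addrAC subrr add0r -rmorphN ij /= periodic_int//.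
  exact: nf.2.
have sU t : Ut (setc z j t) by exact: stable_Ut.
rewrite expr2; apply: (@J_sup R (fun t => f (setc z j t))
    (fun t => pd j f (setc z j t)) K L s) => //.
- by apply: nice_line => //; exact: nice_pd.
- by move=> t; apply: is_derive_line; exact: (nice_pderiv j (sU t) nf).1.
- by move=> t; apply: hK; rewrite time_setc.
- by move=> t; apply: hL; rewrite time_setc.
- have := floor_le_tmp (z ord0 j); have := floorD1_gt (z ord0 j).
  rewrite /s rmorphD/=; lra.
Qed.

Lemma itint_bounds js f z K : spatial js -> nice f -> Ut z ->
  (forall w, time w = time z -> 0 <= f w <= K) -> 0 <= itint js f z <= K.
Proof.
move=> sj nf Uz hK; apply/andP; split.
  rewrite -[leLHS](itint_cst js _ z); apply: le_itint => //; first exact: nice_cst.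
  by move=> w /hK /andP[].
rewrite -[leRHS](itint_cst js _ z); apply: le_itint => //; first exact: nice_cst.
by move=> w /hK /andP[].
Qed.

Lemma itint_abs js f z L : spatial js -> nice f -> Ut z ->
  (forall w, time w = time z -> `|f w| <= L) -> `|itint js f z| <= L.
Proof.
move=> sj nf Uz hK; rewrite ler_norml; apply/andP; split.
  rewrite -[leLHS](itint_cst js _ z); apply: le_itint => //; first exact: nice_cst.
  by move=> w /hK; rewrite ler_norml => /andP[].
rewrite -[leRHS](itint_cst js _ z); apply: le_itint => //; first exact: nice_cst.
by move=> w /hK; rewrite ler_norml => /andP[].
Qed.

(** Each integration costs one squaring by [pint_sup], whence the exponent [2 ^ size js]. Dividing
    by [C = 1 + K + 2 L] gives each step the form [(x / C)^2 <= y / C], which iterates; the summand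
    1 keeps [C] positive. *)
Lemma itint_sup js f z (K L : R) : spatial js -> uniq js -> nice f -> Ut z ->
  0 <= K -> 0 <= L -> (forall w, time w = time z -> 0 <= f w <= K) ->
  (forall j w, j != ord0 -> time w = time z -> `|pd j f w| <= L) ->
  (f z / (1 + K + 2 * L)) ^+ (2 ^ size js) <= itint js f z / (1 + K + 2 * L).
Proof.
move=> + + nf Uz K0 L0 hK hL; set C := 1 + K + 2 * L.
have C0 : 0 < C by rewrite /C; lra.
elim: js => [|j js IH] //= /andP[j0 sjs] /andP[jjs ujs].
have nG := nice_itint sjs nf.
have bG w : time w = time z -> 0 <= itint js f w <= K.
  move=> wz; apply: itint_bounds => //; first by rewrite /Ut/= wz.
  by move=> w'; rewrite wz; exact: hK.
have bdG w : time w = time z -> `|pd j (itint js f) w| <= L.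
  move=> wz; have Uw : Ut w by rewrite /Ut/= wz.
  rewrite itint_pd//; apply: itint_abs => //; first exact: nice_pd.
  by move=> w'; rewrite wz; exact: hL.
have h := pint_sup j0 nG Uz bG bdG.
rewrite expnS mulnC exprM.
have /andP[f0 _] := hK z erefl; have /andP[G0 _] := bG z erefl.
have /andP[P0 _] := @itint_bounds (j :: js) f z K (introT andP (conj j0 sjs)) nf Uz hK.
have le2 : ((f z / C) ^+ (2 ^ size js)) ^+ 2 <= (itint js f z / C) ^+ 2.
  by rewrite ler_pXn2r ?nnegrE ?IH// ?exprn_ge0// divr_ge0// ltW.
apply: (le_trans le2).
rewrite ler_pdivlMr// exprMn exprVn expr2 invfM mulrA mulfVK ?gt_eqF//.
rewrite ler_pdivrMr//; apply: (le_trans h); rewrite [leLHS]mulrC; apply: ler_wpM2l => //.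
by rewrite /C; lra.
Qed.

End SpaceTimeCalculus.
Arguments nice_cst {R N} c.

Lemma nice_dx (R : realType) N (i : 'I_N) (f : 'rV[R]_N.+1 -> R) : nice f -> nice (dx i f).
Proof. exact: nice_pd. Qed.

Lemma nice_dt (R : realType) N (f : 'rV[R]_N.+1 -> R) : nice f -> nice (dt f).
Proof. exact: nice_pd. Qed.

Ltac nice_step :=
  lazymatch goal with
  | |- nice (fun w => @?f w + @?g w) => apply: (@niceD _ _ f g)
  | |- nice (fun w => @?f w * @?g w) => apply: (@niceM _ _ f g)
  | |- nice (fun w => - @?f w) => apply: (@niceN _ _ f)
  | |- nice (fun w => @?f w ^+ ?n) => apply: (@niceX _ _ f n)
  | |- nice (fun w => bigop _ _ _) => apply: nice_sum => ?
  | |- nice (dx ?i ?f) => apply: nice_dx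
  | |- nice (fun w => dx ?i ?f w) => apply: nice_dx
  | |- nice (dt ?f) => apply: nice_dt
  | |- nice (fun w => dt ?f w) => apply: nice_dt
  | |- nice (pd ?j ?f) => apply: nice_pd
  | |- nice (fun w => pd ?j ?f w) => apply: nice_pd
  | |- nice (fun w => ?c) => exact: nice_cst
  | |- nice (fun w => ?f w) => change (nice f)
  end.
Ltac nice := repeat first [assumption | nice_step | by auto].

(** Inserting the bound on [x2] leaves [x1 / 2] on the right, which the left side absorbs. *)
Lemma interp_step (R : realType) (eta p x0 x1 x2 xm : R) : 0 < eta ->
  x1 <= 2^-1 * (eta^-1 * x0 + eta * x2) -> x2 <= eta^-1 * x1 + p * xm ->
  x1 <= eta^-1 * x0 + eta * p * xm.
Proof.
move=> e0 h1 h2.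
have : eta * x2 <= x1 + eta * p * xm.
  have := ler_wpM2l (ltW e0) h2.
  by rewrite mulrDr mulrA mulfV ?gt_eqF// mul1r mulrA.
lra.
Qed.

(** * Space integrals at a fixed time *)

Section SpaceIntegral.
Variables (R : realType) (N : nat).
Notation ST := 'rV[R]_N.+1.
Implicit Types (f g : ST -> R) (z w : ST) (i : 'I_N) (t : R).

Definition pt t : ST := \row_k (if k == ord0 then t else 0).
Definition sjs : seq 'I_N.+1 := [seq xc i | i <- enum 'I_N].

Lemma time_pt t : time (pt t) = t.
Proof. by rewrite /time mxE eqxx. Qed.

Lemma Ut_pt t : 0 < t -> Ut (pt t).
Proof. by rewrite /Ut/= time_pt. Qed.

Lemma spatial_sjs : spatial sjs.
Proof. by apply/allP => j /mapP[i _ ->]; exact: xc_neq0. Qed.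

Lemma uniq_sjs : uniq sjs.
Proof. by rewrite map_inj_uniq ?enum_uniq//; exact: lift_inj. Qed.

Lemma xc_sjs i : xc i \in sjs.
Proof. by apply: map_f; rewrite mem_enum. Qed.

Lemma size_sjs : size sjs = N.
Proof. by rewrite size_map -cardE card_ord. Qed.

Local Hint Resolve spatial_sjs uniq_sjs xc_sjs Ut_pt : core.

Section FixedTime.
Variable t : R.
Hypothesis t0 : 0 < t.

Lemma si_eq f g : (forall w, time w = t -> f w = g w) -> space_int f t = space_int g t.
Proof. by move=> fg; apply: eq_itint => // w; rewrite time_pt; exact: fg. Qed.

Lemma siD f g : nice f -> nice g ->
  space_int (fun w => f w + g w) t = space_int f t + space_int g t.
Proof. by move=> nf ng; apply: itintD => //; exact: Ut_pt. Qed.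

Lemma siZ c f : nice f -> space_int (fun w => c * f w) t = c * space_int f t.
Proof. by move=> nf; apply: itintZ => //; exact: Ut_pt. Qed.

Lemma siN f : nice f -> space_int (fun w => - f w) t = - space_int f t.
Proof. by move=> nf; rewrite -mulN1r -siZ//; apply: si_eq => w _; rewrite mulN1r. Qed.

Lemma siB f g : nice f -> nice g ->
  space_int (fun w => f w - g w) t = space_int f t - space_int g t.
Proof. by move=> nf ng; rewrite (siD nf (niceN ng)) siN. Qed.

Lemma si_cst c : space_int (fun _ : ST => c) t = c.
Proof. exact: itint_cst. Qed.

Lemma si_sum (I : Type) (s : seq I) (F : I -> ST -> R) : (forall a, nice (F a)) ->
  space_int (fun w => \sum_(a <- s) F a w) t = \sum_(a <- s) space_int (F a) t.
Proof.
move=> nF; elim: s => [|a s IH].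
  by rewrite big_nil -[RHS]si_cst; apply: si_eq => x; rewrite big_nil.
rewrite big_cons -IH -siD//; last exact: nice_sum.
by apply: si_eq => w _; rewrite big_cons.
Qed.

Lemma le_si f g : nice f -> nice g -> (forall w, Ut w -> f w <= g w) ->
  space_int f t <= space_int g t.
Proof.
move=> nf ng fg; apply: le_itint => //; first exact: Ut_pt.
by move=> w; rewrite time_pt => wt; apply: fg; rewrite /Ut/= wt.
Qed.

Lemma si_ge0 f : nice f -> (forall w, Ut w -> 0 <= f w) -> 0 <= space_int f t.
Proof. by move=> nf f0; rewrite -[leLHS]si_cst; apply: le_si => //; exact: nice_cst. Qed.

Lemma si_dx0 i f : nice f -> space_int (dx i f) t = 0.
Proof. by move=> nf; apply: itint_pd0 => //; exact: Ut_pt. Qed.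

Lemma si_ibp i f g : nice f -> nice g ->
  space_int (fun w => f w * dx i g w) t = - space_int (fun w => dx i f w * g w) t.
Proof.
move=> nf ng; apply/eqP; rewrite -addr_eq0 -siD; try by nice.
rewrite -(si_dx0 i (niceM nf ng)); apply/eqP/si_eq => w wt.
by rewrite [RHS](pdM _ _ nf ng) 1?addrC// /Ut/= wt.
Qed.

Lemma si_dt f : nice f -> is_derive t 1 (space_int f) (space_int (dt f) t).
Proof.
move=> nf; have nG := nice_itint spatial_sjs nf.
have e : (fun s => itint sjs f (setc (pt t) ord0 s)) = space_int f.
  apply/funext => s; rewrite /space_int; congr (itint _ _ _).
  by apply/rowP => k; rewrite !mxE; case: eqVneq.
have := @is_derive_line R N.+1 (itint sjs f) (pt t) ord0 t.
rewrite e (_ : setc (pt t) ord0 t = pt t); last first.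
  by rewrite -[X in setc _ _ X](time_pt t) setcK.
rewrite itint_pd//; last first.
- exact: Ut_pt.
- apply/negP => /mapP[i _ /eqP]; apply/negP; rewrite eq_sym; exact: xc_neq0.
by apply; exact: (nice_pderiv ord0 (Ut_pt t0) nG).1.
Qed.

Lemma si_jensen f : nice f ->
  space_int f t ^+ 2 <= space_int (fun w => f w ^+ 2) t.
Proof. by move=> nf; apply: itint_jensen => //; exact: Ut_pt. Qed.

Lemma si_poincare f : nice f ->
  space_int (fun w => f w ^+ 2) t <=
  space_int f t ^+ 2 + \sum_(i < N) space_int (fun w => dx i f w ^+ 2) t.
Proof.
move=> nf; apply: (le_trans (itint_poincare spatial_sjs uniq_sjs nf (Ut_pt t0))).
by rewrite lerD2l /sjs big_map big_enum.
Qed.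

End FixedTime.

(** Coordinates that are integrated out do not matter, so the base point of [space_int], the spatial
    origin, may be exchanged for any point at the same time. *)
Lemma itint_agree js f z z' : (forall k, k \notin js -> z ord0 k = z' ord0 k) ->
  itint js f z = itint js f z'.
Proof.
elim: js z z' => [|j js IH] z z' zz /=.
  by congr f; apply/rowP => k; exact: zz.
apply: eq_J => s; apply: IH => k kjs; rewrite !mxE.
by case: eqVneq => // kj; apply: zz; rewrite inE negb_or kj.
Qed.

Lemma si_sup f z (K L : R) : nice f -> Ut z -> 0 <= K -> 0 <= L ->
  (forall w, Ut w -> 0 <= f w <= K) ->
  (forall i w, Ut w -> `|dx i f w| <= L) ->
  (f z / (1 + K + 2 * L)) ^+ (2 ^ N) <= space_int f (time z) / (1 + K + 2 * L).
Proof.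
move=> nf Uz K0 L0 hK hL; rewrite -{1}size_sjs.
rewrite (_ : space_int f (time z) = itint sjs f z).
  apply: itint_sup => //; first by move=> w wz; apply: hK; rewrite /Ut/= wz.
  move=> j w j0 wz.
  have [i ->] : exists i, j = xc i.
    by case: (unliftP ord0 j) => [i ->|E]; [exists i|rewrite E eqxx in j0].
  by apply: hL; rewrite /Ut/= wz.
apply: itint_agree => k kjs; rewrite mxE; case: eqVneq => [->//|k0].
by case: (unliftP ord0 k) k0 kjs => [i ->|->]; rewrite ?eqxx// xc_sjs.
Qed.

Local Opaque space_int pd.

Lemma si_young f g t (eps : R) : nice f -> nice g -> 0 < t -> 0 < eps ->
  `|space_int (fun w => f w * g w) t| <=
    2^-1 * (eps^-1 * space_int (fun w => f w ^+ 2) t + eps * space_int (fun w => g w ^+ 2) t).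
Proof.
move=> nf ng t0 e0.
have [nf2 ng2] := (niceX 2 nf, niceX 2 ng).
rewrite -(siZ t0 _ nf2) -(siZ t0 _ ng2).
rewrite -(siD t0 (niceM (nice_cst _) nf2) (niceM (nice_cst _) ng2)).
rewrite -(siZ t0); last by nice.
have key a b : `|a * b| <= 2^-1 * (eps^-1 * a ^+ 2 + eps * b ^+ 2).
  (* Expanding the square for [c = 1] and [c = -1] bounds the product from below and from above. *)
  have h c : 0 <= eps^-1 * (a + c * eps * b) ^+ 2.
    by rewrite mulr_ge0 ?invr_ge0 ?sqr_ge0 ?ltW.
  have E c : eps^-1 * (a + c * eps * b) ^+ 2 =
    eps^-1 * a ^+ 2 + 2 * c * (a * b) + c ^+ 2 * (eps * b ^+ 2).
    by field; rewrite gt_eqF.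
  move: (h 1) (h (-1)); rewrite !E; move: (eps^-1 * _) (eps * _) (a * b) => x y p h1 h2.
  by rewrite ler_norml; apply/andP; split; lra.
rewrite ler_norml; apply/andP; split.
  rewrite -(siN t0); last by nice.
  by apply: le_si => //; [nice|nice|move=> w _; have := key (f w) (g w); rewrite ler_norml => /andP[]].
by apply: le_si => //; [nice|nice|move=> w _; have := key (f w) (g w); rewrite ler_norml => /andP[]].
Qed.

(* Integration by parts and Young give [X_1 <= (X_0 / eta + eta X_2) / 2] for
   [X_k] the squared norm of the k-th derivative; iterating trades the order of
   the remainder for powers of [eta]. *)
Lemma si_interp i f t (eta : R) m : nice f -> 0 < t -> 0 < eta ->
  space_int (fun w => dx i f w ^+ 2) t <=
  eta^-1 * space_int (fun w => f w ^+ 2) t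
   + eta ^+ m * space_int (fun w => iter m.+1 (dx i) f w ^+ 2) t.
Proof.
move=> + t0 e0; elim: m f => [|m IH] f nf.
  rewrite expr0 mul1r lerDr mulr_ge0 ?invr_ge0 ?(ltW e0)//.
  by apply: si_ge0 => //; [nice|move=> w _; rewrite sqr_ge0].
have /IH := nice_dx i nf; rewrite -iterSr.
have nI k : nice (iter k (dx i) f) by elim: k => //= k IHk; exact: nice_dx.
have : space_int (fun w => dx i f w ^+ 2) t <=
   2^-1 * (eta^-1 * space_int (fun w => f w ^+ 2) t
           + eta * space_int (fun w => dx i (dx i f) w ^+ 2) t).
  rewrite (_ : space_int _ _ = space_int (fun w => dx i f w * dx i f w) t); last first.
    by apply: si_eq => // w _; rewrite expr2.
  rewrite si_ibp//; last exact: nice_dx.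
  apply: (le_trans (ler_norm _)); rewrite normrN.
  rewrite (_ : space_int _ _ = space_int (fun w => f w * dx i (dx i f) w) t); last first.
    by apply: si_eq => // w _; rewrite mulrC.
  exact: (si_young nf (nice_dx i (nice_dx i nf)) t0 e0).
by move=> h1 h2; rewrite exprS; exact: (interp_step e0 h1 h2).
Qed.

End SpaceIntegral.

Local Opaque space_int pd.

(** * Fluid equations *)

Section StrainAlgebra.
Variables (R : realType) (N : nat) (d : 'I_N -> 'I_N -> R).
Hypothesis N0 : (0 < N)%N.
Let tr := \sum_(k < N) d k k.
Let s i j := (d i j + d j i) / 2 - tr / N%:R * (i == j)%:R.

Let N0' : N%:R != 0 :> R. Proof. by rewrite pnatr_eq0 -lt0n. Qed.

Lemma sum_diag (F : 'I_N -> 'I_N -> R) c :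
  \sum_(i < N) \sum_(j < N) F i j * (c * (j == i)%:R) = c * \sum_(i < N) F i i.
Proof.
rewrite mulr_sumr; apply: eq_bigr => i _; rewrite (bigD1 i)//= big1 ?addr0.
  by rewrite eqxx mulr1 mulrC.
by move=> j /negbTE ->; rewrite !mulr0.
Qed.

Lemma strain_trace : \sum_(i < N) s i i = 0.
Proof.
rewrite /s big_split/= sumrN -mulr_suml big_split/=.
under [X in _ - X]eq_bigr do rewrite eqxx mulr1.
rewrite sumr_const card_ord -mulr_natr -/tr; by field.
Qed.

(** The strain is symmetric, so contracting it with [d] or with the transpose of [d] gives the same;
    its multiple of the identity contributes nothing because the trace vanishes. *)
Lemma strain_contract : \sum_(i < N) \sum_(j < N) d j i * s j i =
  \sum_(i < N) \sum_(j < N) s j i ^+ 2.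
Proof.
have sC i j : s i j = s j i by rewrite /s [d i j + _]addrC eq_sym.
have e : \sum_(i < N) \sum_(j < N) d i j * s j i = \sum_(i < N) \sum_(j < N) d j i * s j i.
  by rewrite exchange_big; apply: eq_bigr => i _; apply: eq_bigr => j _; rewrite sC.
have h : \sum_(i < N) \sum_(j < N) s j i ^+ 2 =
   2^-1 * (\sum_(i < N) \sum_(j < N) d j i * s j i)
   + 2^-1 * (\sum_(i < N) \sum_(j < N) d i j * s j i)
   - \sum_(i < N) \sum_(j < N) s j i * (tr / N%:R * (j == i)%:R).
  rewrite !mulr_sumr -!big_split -sumrB/=; apply: eq_bigr => i _.
  rewrite !mulr_sumr -!big_split -sumrB/=; apply: eq_bigr => j _.
  by rewrite expr2 {1}/s; lra.
rewrite h e sum_diag strain_trace; lra.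
Qed.

(** Pointwise Korn identity, from [strain_contract] and the definition of [s]. The middle sum has no
    sign, but its space integral will be that of the squared divergence. *)
Lemma strain_norm : \sum_(i < N) \sum_(j < N) d j i ^+ 2 =
  2 * (\sum_(i < N) \sum_(j < N) s j i ^+ 2) - \sum_(i < N) \sum_(j < N) d j i * d i j
  + 2 / N%:R * tr ^+ 2.
Proof.
rewrite -strain_contract.
have -> : 2 / N%:R * tr ^+ 2 =
    \sum_(i < N) \sum_(j < N) d j i * (2 * (tr / N%:R) * (j == i)%:R).
  by rewrite sum_diag; rewrite /tr; ring.
rewrite mulr_sumr -sumrB -big_split/=; apply: eq_bigr => i _.
rewrite mulr_sumr -sumrB -big_split/=; apply: eq_bigr => j _.
by rewrite /s; field.
Qed.

End StrainAlgebra.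

(** * Balance laws in non-conservative form and entropy production *)

Section Fluid.
Variables (R : realType) (N : nat) (mu kappa : R).
Variables (rho : 'rV[R]_N.+1 -> R) (u : 'I_N -> 'rV[R]_N.+1 -> R)
  (T : 'rV[R]_N.+1 -> R).
Notation ST := 'rV[R]_N.+1.
Hypothesis N0 : (0 < N)%N.
Hypotheses (nrho : nice rho) (nu : forall i, nice (u i)) (nT : nice T).
Hypothesis eqs : forall z, Ut z -> NSF_at mu kappa rho u T z.
Hypotheses (rho0 : forall z, Ut z -> 0 < rho z) (T0 : forall z, Ut z -> 0 < T z).

Definition divergence : ST -> R := fun z => \sum_(k < N) dx k (u k) z.
Definition advection (f : ST -> R) : ST -> R := fun z => \sum_(i < N) u i z * dx i f z.
Definition div_strain (j : 'I_N) : ST -> R := fun z => \sum_(i < N) dx i (strain u j i) z.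
Definition strain_sq : ST -> R := fun z => \sum_(i < N) \sum_(j < N) strain u j i z ^+ 2.
Definition laplacian : ST -> R := fun z => \sum_(i < N) dx i (dx i T) z.

Let N0' : N%:R != 0 :> R. Proof. by rewrite pnatr_eq0 -lt0n. Qed.

Lemma nice_divergence : nice divergence. Proof. by rewrite /divergence; nice. Qed.
Lemma nice_strain i j : nice (strain u i j).
Proof. by rewrite /strain; nice. Qed.
Lemma nice_advection f : nice f -> nice (advection f).
Proof. by move=> nf; rewrite /advection; nice. Qed.
Lemma nice_strain_sq : nice strain_sq.
Proof. by apply: nice_sum => i; apply: nice_sum => j; apply/niceX/nice_strain. Qed.
Lemma nice_laplacian : nice laplacian. Proof. by rewrite /laplacian; nice. Qed.
Lemma nice_usq : nice (usq u). Proof. by rewrite /usq; nice. Qed.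

Lemma mass z : Ut z -> dt rho z = - (advection rho z + rho z * divergence z).
Proof.
move=> Uz; have [/eqP] := eqs Uz; rewrite addr_eq0 => /eqP -> _ _; congr (- _).
rewrite /advection /divergence mulr_sumr -big_split/=; apply: eq_bigr => i _.
by rewrite /dx pdM//; ring.
Qed.

(** Mass conservation cancels every term in which [f] is not differentiated: a conservative balance
    law becomes [rho] times a material derivative. *)
Lemma transport f z : nice f -> Ut z ->
  dt (fun w => rho w * f w) z + \sum_(i < N) dx i (fun w => rho w * u i w * f w) z
  = rho z * (dt f z + advection f z).
Proof.
move=> nf Uz; rewrite /dt pdM//.
have -> : \sum_(i < N) dx i (fun w => rho w * u i w * f w) z
    = f z * (advection rho z + rho z * divergence z) + rho z * advection f z.
  rewrite /advection /divergence mulrDr !mulr_sumr -!big_split/=; apply: eq_bigr => i _.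
  by rewrite /dx !pdM//; [ring|nice].
by have := mass Uz; rewrite /dt => ->; ring.
Qed.

Lemma momentum z j : Ut z ->
  rho z * (dt (u j) z + advection (u j) z) = - dx j (fun w => rho w * T w) z + 2 * mu * div_strain j z.
Proof.
move=> Uz; have [_ /(_ j)] := eqs Uz.
by rewrite (transport (nu j) Uz) -/(div_strain j z) => <- _; ring.
Qed.

(** Energy balance minus [u] times the momentum balance: the kinetic energy and the work of
    [div_strain] cancel, and by [strain_contract] what remains of the viscous work is the heating
    [strain_sq]. *)
Lemma temperature z : Ut z ->
  N%:R / 2 * (rho z * (dt T z + advection T z)) =
  - (rho z * T z * divergence z) + 2 * mu * strain_sq z + N%:R / 2 * kappa * laplacian z.
Proof.
move=> Uz; have nus := nice_usq; have nS := nice_strain.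
(* Total energy per unit mass, to which [transport] applies. *)
pose e w := usq u w / 2 + N%:R / 2 * T w.
have ne : nice e by rewrite /e; nice.
have [_ _] := eqs Uz.
rewrite -/(laplacian z).
have -> : (fun w => rho w * usq u w / 2 + N%:R / 2 * (rho w * T w)) = (fun w => rho w * e w).
  by apply/funext => w; rewrite /e; ring.
(* Since [(N + 2) / 2 = N / 2 + 1], the energy flux is [rho u e] plus the pressure work
   [rho T u]. *)
have -> : \sum_(i < N) dx i (fun w => rho w * usq u w / 2 * u i w
     + (N%:R + 2) / 2 * (rho w * u i w * T w)) z =
   \sum_(i < N) dx i (fun w => rho w * u i w * e w) z
   + \sum_(i < N) (dx i (fun w => rho w * T w) z * u i z + rho z * T z * dx i (u i) z).
  rewrite -big_split/=; apply: eq_bigr => i _.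
  rewrite -(pdM (xc i) Uz (niceM nrho nT) (nu i)) -pdD//; try by nice.
  by congr (pd _ _ z); apply/funext => w; rewrite /e; field.
rewrite addrA transport//.
have -> : dt e z + advection e z = \sum_(j < N) u j z * (dt (u j) z + advection (u j) z)
    + N%:R / 2 * (dt T z + advection T z).
  have E k : pd k e z = \sum_(j < N) u j z * pd k (u j) z + N%:R / 2 * pd k T z.
    rewrite /e pdD//; try by nice.
    rewrite pdZ// pdZr// /usq pd_sum//; last by move=> j; nice.
    congr (_ + _); rewrite mulr_suml; apply: eq_bigr => j _.
    by rewrite pdX2//; field.
  have -> : advection e z = \sum_(j < N) u j z * advection (u j) z + N%:R / 2 * advection T z.
    rewrite /advection mulr_sumr; under eq_bigr do rewrite {1}/dx E mulrDr mulr_sumr.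
    rewrite big_split/= exchange_big/=; congr (_ + _); apply: eq_bigr => i _.
      by rewrite mulr_sumr; apply: eq_bigr => j _; rewrite /dx; ring.
    by rewrite /dx; ring.
  rewrite /dt E.
  under [in RHS]eq_bigr do rewrite mulrDr.
  by rewrite [in RHS]big_split/=; ring.
rewrite mulrDr.
have -> : \sum_(i < N) dx i (fun w => \sum_(j < N) u j w * strain u j i w) z
  = strain_sq z + \sum_(j < N) u j z * div_strain j z.
  rewrite /strain_sq -(strain_contract (fun i j => dx j (u i) z) N0).
  rewrite /div_strain; under [X in _ = _ + X]eq_bigr do rewrite mulr_sumr.
  rewrite [X in _ = _ + X]exchange_big/= -big_split/=; apply: eq_bigr => i _.
  rewrite /dx pd_sum//; last by move=> j; nice.
  rewrite -big_split/=; apply: eq_bigr => j _.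
  by rewrite pdM.
rewrite big_split/=.
have -> : \sum_(i < N) rho z * T z * dx i (u i) z = rho z * T z * divergence z by rewrite mulr_sumr.
have -> : rho z * (\sum_(i < N) u i z * (dt (u i) z + advection (u i) z)) =
    - \sum_(i < N) dx i (fun w => rho w * T w) z * u i z
    + 2 * mu * \sum_(j < N) u j z * div_strain j z.
  rewrite -sumrN !mulr_sumr -big_split/=; apply: eq_bigr => i _.
  by rewrite mulrCA momentum//; ring.
move: (\sum_(j < N) u j z * div_strain j z) (\sum_(i < N) _) => a b.
move: (dt T z + advection T z) (strain_sq z) (laplacian z) (divergence z) => p q r s; lra.
Qed.

Definition ent : ST -> R := fun w => rho w * (ln (rho w) - N%:R / 2 * ln (T w)).

Lemma nice_invT : nice (fun w => (T w)^-1). Proof. exact: niceV. Qed.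
Lemma nice_invrho : nice (fun w => (rho w)^-1). Proof. exact: niceV. Qed.

Lemma nice_lns : nice (fun w => ln (rho w) - N%:R / 2 * ln (T w)).
Proof.
have n1 : nice (fun w => ln (rho w)) by exact: nice_ln.
have n2 : nice (fun w => ln (T w)) by exact: nice_ln.
by apply: niceD => //; apply: niceN; apply: niceM => //; exact: nice_cst.
Qed.

Lemma nice_ent : nice ent. Proof. exact: (niceM nrho nice_lns). Qed.

(** The compression terms [- rho div u] from the mass equation and [+ rho div u] from the
    temperature equation cancel; this dictates the factor [N / 2] of [ln T]. *)
Lemma dt_ent z : Ut z ->
  dt ent z = - (\sum_(i < N) dx i (fun w => rho w * u i w *
        (ln (rho w) - N%:R / 2 * ln (T w))) z)
   - 2 * mu * (strain_sq z * (T z)^-1) - N%:R / 2 * kappa * (laplacian z * (T z)^-1).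
Proof.
move=> Uz; have n1 : nice (fun w => ln (rho w)) by exact: nice_ln.
have n2 : nice (fun w => ln (T w)) by exact: nice_ln.
have := transport nice_lns Uz.
have -> : dt (fun w => rho w * (ln (rho w) - N%:R / 2 * ln (T w))) z = dt ent z by [].
set X := \sum_(i < N) _ => /(canRL (addrK _)) ->.
have E k : pd k (fun w => ln (rho w) - N%:R / 2 * ln (T w)) z =
  (rho z)^-1 * pd k rho z - N%:R / 2 * ((T z)^-1 * pd k T z).
  by rewrite pdB ?pdZ ?pd_ln//; [ring|nice].
have -> : dt (fun w => ln (rho w) - N%:R / 2 * ln (T w)) z
   + advection (fun w => ln (rho w) - N%:R / 2 * ln (T w)) z =
   (rho z)^-1 * (dt rho z + advection rho z) - N%:R / 2 * ((T z)^-1 * (dt T z + advection T z)).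
  rewrite /dt E.
  have -> : advection (fun w => ln (rho w) - N%:R / 2 * ln (T w)) z =
     (rho z)^-1 * advection rho z - N%:R / 2 * ((T z)^-1 * advection T z).
    rewrite /advection !mulr_sumr -sumrB; apply: eq_bigr => i _.
    by rewrite {1}/dx E /dx; ring.
  by ring.
have r0 := lt0r_neq0 (rho0 Uz); have t0 := lt0r_neq0 (T0 Uz).
rewrite (_ : rho z * _ = dt rho z + advection rho z
   - (T z)^-1 * (N%:R / 2 * (rho z * (dt T z + advection T z)))); last by field; rewrite ?r0 ?t0.
rewrite temperature// mass//; move: (strain_sq z) (laplacian z) (advection rho z) (divergence z) => a b c d.
by field; rewrite t0.
Qed.

(** The flux integrates to zero, and integrating by parts against [1 / T] turns the Laplacian into
    [|grad T|^2 / T^2]: only squares with positive weights remain. *)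
Lemma int_dt_ent t : 0 < t ->
  space_int (dt ent) t = - (2 * mu * space_int (fun w => strain_sq w * (T w)^-1) t
   + N%:R / 2 * kappa * \sum_(i < N) space_int (fun w => dx i T w ^+ 2 * (T w)^-1 ^+ 2) t).
Proof.
move=> t0; have nS2 := nice_strain_sq; have nV := nice_invT; have nl := nice_lns.
have nL := nice_laplacian.
rewrite (@si_eq _ _ _ _ (fun w => - (\sum_(i < N) dx i (fun w => rho w * u i w *
        (ln (rho w) - N%:R / 2 * ln (T w))) w)
   - 2 * mu * (strain_sq w * (T w)^-1) - N%:R / 2 * kappa * (laplacian w * (T w)^-1))); last first.
  by move=> w wt; apply: dt_ent; rewrite /Ut/= wt.
have nF i : nice (fun w => rho w * u i w * (ln (rho w) - N%:R / 2 * ln (T w))).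
  exact: niceM (niceM nrho (nu i)) nl.
have nX : nice (fun w => \sum_(i < N) dx i (fun w => rho w * u i w *
        (ln (rho w) - N%:R / 2 * ln (T w))) w).
  exact: nice_sum (fun i => nice_dx i (nF i)).
have nA : nice (fun w => strain_sq w * (T w)^-1) by exact: niceM.
have nB : nice (fun w => laplacian w * (T w)^-1) by exact: niceM.
rewrite (siB t0 (niceD (niceN nX) (niceN (niceM (nice_cst _) nA))) (niceM (nice_cst _) nB)).
rewrite (siB t0 (niceN nX) (niceM (nice_cst _) nA)) (siN t0 nX) (siZ t0 _ nA) (siZ t0 _ nB).
rewrite (si_sum t0 _ (fun i => nice_dx i (nF i))).
rewrite big1 ?oppr0; last by move=> i _; exact: si_dx0.
rewrite sub0r opprD; congr (_ - _); congr (_ * _).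
rewrite (@si_eq _ _ _ _ (fun w => \sum_(i < N) (T w)^-1 * dx i (dx i T) w)); last first.
  by move=> w _; rewrite /laplacian mulrC mulr_sumr.
rewrite (si_sum t0 _ (fun i => niceM nV (nice_dx i (nice_dx i nT)))).
apply: eq_bigr => i _; rewrite si_ibp//; last by nice.
rewrite -(siN t0); last by apply: niceM; nice.
apply: si_eq => w wt; have Uw : Ut w by rewrite /Ut/= wt.
rewrite {1}/dx pdV// -/(dx i T w); field.
by rewrite gt_eqF// T0.
Qed.

End Fluid.

(** * Uniform bounds and domination of squared L2 norms *)

Section Domination.
Variables (R : realType) (N : nat).
Notation ST := 'rV[R]_N.+1.
Implicit Types (f g h : ST -> R) (i : 'I_N) (F G : R -> R -> R).

Definition bnd f := exists2 C, 0 <= C & forall z, Ut z -> `|f z| <= C.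

Lemma bnd_cst c : bnd (fun=> c).
Proof. by exists `|c|. Qed.

Lemma bndD f g : bnd f -> bnd g -> bnd (fun w => f w + g w).
Proof.
move=> [C C0 hf] [D D0 hg]; exists (C + D); first exact: addr_ge0.
by move=> z Uz; apply: le_trans (ler_normD _ _) _; apply: lerD; [exact: hf|exact: hg].
Qed.

Lemma bndM f g : bnd f -> bnd g -> bnd (fun w => f w * g w).
Proof.
move=> [C C0 hf] [D D0 hg]; exists (C * D); first exact: mulr_ge0.
by move=> z Uz; rewrite normrM; apply: ler_pM => //; [exact: hf|exact: hg].
Qed.

Lemma bnd_sum (I : Type) (s : seq I) (F : I -> ST -> R) : (forall a, bnd (F a)) ->
  bnd (fun w => \sum_(a <- s) F a w).
Proof.
move=> bF; elim: s => [|a s IH].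
  rewrite (_ : (fun w => _) = (fun=> 0)); first exact: bnd_cst.
  by apply/funext => w; rewrite big_nil.
rewrite (_ : (fun w => _) = (fun w => F a w + \sum_(b <- s) F b w)); first exact: bndD.
by apply/funext => w; rewrite big_cons.
Qed.

Lemma bnd_inv f c : 0 < c -> (forall z, Ut z -> c <= f z) -> bnd (fun w => (f w)^-1).
Proof.
move=> c0 cf; exists c^-1; first by rewrite invr_ge0 ltW.
move=> z Uz; have fz := cf z Uz; have f0 : 0 < f z by exact: lt_le_trans fz.
by rewrite ger0_norm ?invr_ge0 ?(ltW f0)// lef_pV2 ?posrE.
Qed.

(** Only spatial derivatives are bounded by assumption; time derivatives of the unknowns are
    replaced through the equations. *)
Definition Cb f := nice f /\ forall js : seq 'I_N, bnd (pds [seq xc i | i <- js] f).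

Lemma Cb_nice f : Cb f -> nice f. Proof. by case. Qed.

Lemma Cb_bnd f : Cb f -> bnd f. Proof. by case=> _ /(_ [::]). Qed.

Lemma Cb_of_Ck f : nice f -> Ck_bounded f -> Cb f.
Proof.
move=> nf cf; split=> // js; have [C hC] := cf (size js).
exists `|C| => // z Uz; exact: le_trans (hC z Uz js (leqnn _)) (ler_norm _).
Qed.

Lemma Cb_dx i f : Cb f -> Cb (dx i f).
Proof.
move=> [nf bf]; split; first exact: nice_dx.
move=> js; have := bf (rcons js i); congr bnd; rewrite map_rcons.
by elim: [seq xc k | k <- js] => //= a s ->.
Qed.

Lemma Cb_lin c d f g : Cb f -> Cb g -> Cb (fun w => c * f w + d * g w).
Proof.
move=> [nf bf] [ng bg]; split; first by nice.
move=> js; have e z : Ut z -> pds [seq xc i | i <- js] (fun w => c * f w + d * g w) z =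
    c * pds [seq xc i | i <- js] f z + d * pds [seq xc i | i <- js] g z.
  elim: js z => [//|j js IH] z Uz /=.
  rewrite (pd_eq_on (@open_Ut R N) _ Uz IH).
  have [n1 n2] := (nice_pds [seq xc i | i <- js] nf, nice_pds [seq xc i | i <- js] ng).
  by rewrite pdD ?pdZ//; exact: (niceM (nice_cst _)).
have [C C0 hC] := bndD (bndM (bnd_cst c) (bf js)) (bndM (bnd_cst d) (bg js)).
by exists C => // z Uz; rewrite e//; exact: hC.
Qed.

Lemma Cb_cst c : Cb (fun _ : ST => c).
Proof.
split; first exact: nice_cst.
move=> js; exists `|c| => // z Uz.
suff [->|->] : pds [seq xc i | i <- js] (fun=> c) = (fun=> 0) :> (ST -> R) \/
   pds [seq xc i | i <- js] (fun=> c) = (fun=> c) :> (ST -> R) by rewrite ?normr0.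
elim: js => [|j js /= [->|->]] /=; [by right|left..];
  by apply/funext => w; exact: pd_cst.
Qed.

Lemma Cb_sum (I : Type) (s : seq I) (F : I -> ST -> R) : (forall a, Cb (F a)) ->
  Cb (fun w => \sum_(a <- s) F a w).
Proof.
move=> bF; elim: s => [|a s IH].
  rewrite (_ : (fun w => _) = (fun=> 0)); first exact: Cb_cst.
  by apply/funext => w; rewrite big_nil.
rewrite (_ : (fun w => _) = (fun w => 1 * F a w + 1 * \sum_(b <- s) F b w)).
  exact: Cb_lin.
by apply/funext => w; rewrite big_cons !mul1r.
Qed.

Lemma Cb_strain (u : 'I_N -> ST -> R) i j : (forall k, Cb (u k)) -> Cb (strain u i j).
Proof.
move=> bu; rewrite (_ : strain u i j =
   (fun w => 2^-1 * (1 * dx j (u i) w + 1 * dx i (u j) w)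
     + (- (i == j)%:R / N%:R) * \sum_(k < N) dx k (u k) w)).
  apply: Cb_lin; first by apply: Cb_lin; exact: Cb_dx.
  by apply: Cb_sum => k; exact: Cb_dx.
by apply/funext => w; rewrite /strain; ring.
Qed.

(** The remainder in [si_interp] involves the derivative of order [P + 1]; its uniform bound reduces
    it to a multiple of [eta^P]. *)
Lemma Cb_interp i f P : Cb f -> exists2 C, 0 <= C &
  forall eta t, 0 < eta <= 1 -> 0 < t ->
    space_int (fun w => dx i f w ^+ 2) t <=
    C * (eta^-1 * space_int (fun w => f w ^+ 2) t + eta ^+ P).
Proof.
move=> [nf bf]; have [C C0 hC] := bf (nseq P.+1 i).
exists (1 + C ^+ 2); first by rewrite addr_ge0// sqr_ge0.
move=> eta t /andP[e0 e1] t0.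
have nI k : nice (iter k (dx i) f) by elim: k => //= k IHk; exact: nice_dx.
apply: (le_trans (si_interp i P nf t0 e0)).
set x := space_int (fun w => f w ^+ 2) t.
have x0 : 0 <= x by apply: si_ge0 => //; [nice|move=> w _; rewrite sqr_ge0].
have y0 : 0 <= eta^-1 * x by rewrite mulr_ge0// invr_ge0 ltW.
have p0 : 0 <= eta ^+ P by rewrite exprn_ge0// ltW.
have le : space_int (fun w => iter P.+1 (dx i) f w ^+ 2) t <= C ^+ 2.
  rewrite -[leRHS](@si_cst R N t); apply: le_si => //; [exact/niceX/nI|exact: nice_cst|].
  move=> w Uw; rewrite -real_normK ?num_real// ler_pXn2r ?nnegrE//.
  have := hC w Uw; congr (_ <= _); congr (`| _ |).
  by elim: (P.+1) w {Uw} => //= k IHk w; rewrite /dx; congr (pd _ _ _); apply/funext.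
have := ler_wpM2l p0 le.
move: (eta^-1 * x) (eta ^+ P) (space_int _ _) (sqr_ge0 C) y0 p0 => a b c; nra.
Qed.

(* Constants in [dom] are uniform in the time [t] and in the interpolation
   parameter [eta]; [sqO f G] means that the squared L2 norm of [f] is [O(G)]. *)
Definition dom F G := exists2 C, 0 <= C &
  forall eta t, 0 < eta <= 1 -> 0 < t -> F eta t <= C * G eta t.

Definition nng G := forall eta t, 0 < eta <= 1 -> 0 < t -> 0 <= G eta t.

Definition sqO f G := nice f /\ dom (fun _ t => space_int (fun w => f w ^+ 2) t) G.

Lemma dom_le F G : nng G -> (forall eta t, 0 < eta <= 1 -> 0 < t -> F eta t <= G eta t) ->
  dom F G.
Proof. by move=> G0 h; exists 1 => // eta t he t0; rewrite mul1r h. Qed.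

Lemma dom_trans F G H : dom F G -> dom G H -> dom F H.
Proof.
move=> [C C0 h1] [D D0 h2]; exists (C * D); first exact: mulr_ge0.
move=> eta t he t0; apply: (le_trans (h1 _ _ he t0)).
by rewrite -mulrA; apply: ler_wpM2l => //; exact: h2.
Qed.

Lemma domD F F' G : dom F G -> dom F' G -> dom (fun eta t => F eta t + F' eta t) G.
Proof.
move=> [C C0 h1] [D D0 h2]; exists (C + D); first exact: addr_ge0.
by move=> eta t he t0; rewrite mulrDl; apply: lerD; [exact: h1|exact: h2].
Qed.

Lemma dom_sum (I : Type) (s : seq I) (F : I -> R -> R -> R) G :
  (forall a, dom (F a) G) -> dom (fun eta t => \sum_(a <- s) F a eta t) G.
Proof.
move=> dF; elim: s => [|a s [D D0 hD]].
  by exists 0 => // eta t _ _; rewrite big_nil mul0r.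
have [C C0 hC] := dF a; exists (C + D); first exact: addr_ge0.
by move=> eta t he t0; rewrite big_cons mulrDl; apply: lerD; [exact: hC|exact: hD].
Qed.

Lemma sqint_ge0 f t : nice f -> 0 < t -> 0 <= space_int (fun w => f w ^+ 2) t.
Proof. by move=> nf t0; apply: si_ge0 => //; [nice|move=> w _; rewrite sqr_ge0]. Qed.

Lemma sqO_le f G G' : sqO f G -> dom G G' -> sqO f G'.
Proof. by move=> [nf df] dG; split=> //; exact: dom_trans dG. Qed.

Lemma sqO_eq f g G : nice g -> (forall w, Ut w -> f w = g w) -> sqO f G -> sqO g G.
Proof.
move=> ng fg [nf [C C0 h]]; split=> //; exists C => // eta t he t0.
rewrite -(@si_eq R N t (fun w => f w ^+ 2)); first exact: h.
by move=> w wt; rewrite fg// /Ut/= wt.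
Qed.

Lemma sqO_D f g G : sqO f G -> sqO g G -> sqO (fun w => f w + g w) G.
Proof.
move=> [nf [C C0 hf]] [ng [D D0 hg]]; split; first by nice.
exists (2 * C + 2 * D); first lra.
move=> eta t he t0.
have [n1 n2] := (niceX 2 nf, niceX 2 ng).
have := hf eta t he t0; have := hg eta t he t0 => h1 h2.
apply: (@le_trans _ _ (2 * space_int (fun w => f w ^+ 2) t
    + 2 * space_int (fun w => g w ^+ 2) t)); last by rewrite mulrDl; lra.
rewrite -(siZ t0 _ n1) -(siZ t0 _ n2) -(siD t0 (niceM (nice_cst 2) n1) (niceM (nice_cst 2) n2)).
apply: le_si => //; try by nice.
by move=> w _; move: (f w) (g w) => a b; have := sqr_ge0 (a - b); lra.
Qed.

Lemma sqO_M f h G : nice h -> bnd h -> sqO f G -> sqO (fun w => h w * f w) G.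
Proof.
move=> nh [D D0 hD] [nf [C C0 hf]]; split; first by nice.
exists (D ^+ 2 * C); first by rewrite mulr_ge0// sqr_ge0.
move=> eta t he t0.
apply: (@le_trans _ _ (D ^+ 2 * space_int (fun w => f w ^+ 2) t)); last first.
  by rewrite -mulrA; apply: ler_wpM2l; [rewrite sqr_ge0|exact: hf].
rewrite -siZ//; last by nice.
apply: le_si => //; try by nice.
move=> w Uw; rewrite exprMn; apply: ler_wpM2r; first exact: sqr_ge0.
by rewrite -real_normK ?num_real// ler_pXn2r ?nnegrE// hD.
Qed.

Lemma sqO_Z c f G : sqO f G -> sqO (fun w => c * f w) G.
Proof. by apply: sqO_M; [exact: nice_cst|exact: bnd_cst]. Qed.

Lemma sqO_N f G : sqO f G -> sqO (fun w => - f w) G.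
Proof.
move=> Of; apply: sqO_eq (sqO_Z (-1) Of); first by apply: niceN; case: Of.
by move=> w _; rewrite mulN1r.
Qed.

Lemma sqO_0 G : nng G -> sqO (fun=> 0) G.
Proof.
move=> G0; split; first exact: nice_cst.
exists 0 => // eta t he t0; rewrite mul0r (@si_eq R N t _ (fun=> 0)) ?si_cst//.
by move=> w _; rewrite expr2 mul0r.
Qed.

Lemma sqO_sum (I : Type) (s : seq I) (F : I -> ST -> R) G : nng G ->
  (forall a, sqO (F a) G) -> sqO (fun w => \sum_(a <- s) F a w) G.
Proof.
move=> G0 bF; elim: s => [|a s IH].
  rewrite (_ : (fun w => _) = (fun=> 0)); first exact: sqO_0.
  by apply/funext => w; rewrite big_nil.
rewrite (_ : (fun w => _) = (fun w => F a w + \sum_(b <- s) F b w)); first exact: sqO_D.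
by apply/funext => w; rewrite big_cons.
Qed.

Lemma sqO_young f g F G y : nng F -> nng G -> sqO f F -> sqO g G -> 0 < y ->
  exists2 C, 0 <= C & forall eta t, 0 < eta <= 1 -> 0 < t ->
    `|space_int (fun w => f w * g w) t| <= y * F eta t + C * G eta t.
Proof.
move=> F0 G0 [nf [C C0 hf]] [ng [D D0 hg]] y0.
(* Young's parameter [C / y + 1] makes the weight of [F] at most [y]; the added 1 keeps it positive
   when [C = 0]. *)
have e0 : 0 < C / y + 1 by rewrite ltr_wpDl// divr_ge0// ltW.
exists ((C / y + 1) * D); first by rewrite mulr_ge0// ltW.
move=> eta t he t0; apply: (le_trans (si_young nf ng t0 e0)).
have h1 := hf _ _ he t0; have h2 := hg _ _ he t0.
have f0 := sqint_ge0 nf t0; have g0 := sqint_ge0 ng t0.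
have k1 : (C / y + 1)^-1 * space_int (fun w => f w ^+ 2) t <= y * F eta t.
  rewrite ler_pdivrMl//; apply: (le_trans h1).
  rewrite mulrA mulrDl divfK ?gt_eqF// mul1r; apply: ler_wpM2r; first exact: F0.
  by rewrite lerDl ltW.
have k2 : (C / y + 1) * space_int (fun w => g w ^+ 2) t <= (C / y + 1) * D * G eta t.
  by rewrite -mulrA; apply: ler_wpM2l => //; exact: ltW.
have k3 : 0 <= y * F eta t by rewrite mulr_ge0 ?F0// ltW.
have k4 : 0 <= (C / y + 1) * D * G eta t.
  by apply: mulr_ge0; [rewrite mulr_ge0// ltW|exact: G0].
move: k1 k2 k3 k4; move: (_^-1 * _) (_ * space_int _ _) (y * _) (_ * G _ _) => p q r s.
by lra.
Qed.

End Domination.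

(** * Hypocoercive estimates *)

Section Estimates.
Variables (R : realType) (N : nat) (mu kappa : R).
Variables (rho : 'rV[R]_N.+1 -> R) (u : 'I_N -> 'rV[R]_N.+1 -> R)
  (T : 'rV[R]_N.+1 -> R) (rho_m T_m : R).
Notation ST := 'rV[R]_N.+1.
Hypotheses (N0 : (0 < N)%N) (mu0 : 0 < mu) (kappa0 : 0 < kappa).
Hypotheses (Crho : Cb rho) (Cu : forall i, Cb (u i)) (CT : Cb T).
Hypothesis eqs : forall z, Ut z -> NSF_at mu kappa rho u T z.
Hypothesis norms : forall t : R, 0 < t ->
     [/\ space_int rho t = 1,
         (forall j, space_int (fun w => rho w * u j w) t = 0) &
         space_int (fun w => rho w * usq u w / 2) t
           + N%:R / 2 * space_int (fun w => rho w * T w) t = N%:R / 2].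
Hypotheses (rm0 : 0 < rho_m) (Tm0 : 0 < T_m).
Hypothesis low : forall z, Ut z -> rho_m <= rho z /\ T_m <= T z.
Variable P : nat.

Local Notation div := (divergence u).
Local Notation S2 := (strain_sq u).
Local Notation adv := (advection u).
Local Notation lapT := (laplacian T).
Local Notation divS := (div_strain u).

Let nrho : nice rho := Cb_nice Crho.
Let nu i : nice (u i) := Cb_nice (Cu i).
Let nT : nice T := Cb_nice CT.
Let rho0 z : Ut z -> 0 < rho z. Proof. by move=> /low[h _]; exact: lt_le_trans h. Qed.
Let T0 z : Ut z -> 0 < T z. Proof. by move=> /low[_ h]; exact: lt_le_trans h. Qed.
Let nirho : nice (fun w => (rho w)^-1). Proof. exact: nice_invrho. Qed.
Let birho : bnd (fun w => (rho w)^-1).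
Proof. by apply: (bnd_inv rm0) => z /low[]. Qed.
Let N0' : N%:R != 0 :> R. Proof. by rewrite pnatr_eq0 -lt0n. Qed.
Let N1 : 1 <= N%:R :> R. Proof. by rewrite ler1n. Qed.

Definition heat_strain_sq (t : R) : R := \sum_(i < N) space_int (fun w => dx i T w ^+ 2) t + space_int S2 t.
Definition div_sq (t : R) : R := space_int (fun w => div w ^+ 2) t.
Definition grad_rho_sq (t : R) : R := \sum_(i < N) space_int (fun w => dx i rho w ^+ 2) t.
(* The majorants [maj1], [maj2], [maj3] control successively the quantities that
   vanish with the heat flux and the strain, with the velocity, and with the
   density fluctuation. *)
Definition maj1 (eta t : R) : R := eta^-1 * heat_strain_sq t + eta ^+ P.
Definition maj2 (eta t : R) : R := maj1 eta t + div_sq t.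
Definition maj3 (eta t : R) : R := maj2 eta t + grad_rho_sq t.

Lemma heat_strain_sq_ge0 t : 0 < t -> 0 <= heat_strain_sq t.
Proof.
move=> t0; apply: addr_ge0.
  by apply: sumr_ge0 => i _; apply: sqint_ge0 => //; exact: nice_dx.
apply: si_ge0 => //; first exact: nice_strain_sq.
by move=> w _; apply: sumr_ge0 => i _; apply: sumr_ge0 => j _; exact: sqr_ge0.
Qed.

Lemma div_sq_ge0 t : 0 < t -> 0 <= div_sq t.
Proof. by move=> t0; apply: sqint_ge0 => //; exact: nice_divergence. Qed.

Lemma grad_rho_sq_ge0 t : 0 < t -> 0 <= grad_rho_sq t.
Proof.
by move=> t0; apply: sumr_ge0 => i _; apply: sqint_ge0 => //; exact: nice_dx.
Qed.

Lemma heat_strain_sq_le_maj1 eta t : 0 < eta <= 1 -> 0 < t -> heat_strain_sq t <= maj1 eta t.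
Proof.
move=> /andP[e0 e1] t0; have a0 := heat_strain_sq_ge0 t0.
rewrite /maj1 -[leLHS]addr0 lerD// ?exprn_ge0 ?(ltW e0)//.
by rewrite ler_peMl// invf_ge1.
Qed.

Lemma nng_maj1 : nng maj1.
Proof. by move=> eta t he t0; exact: le_trans (heat_strain_sq_ge0 t0) (heat_strain_sq_le_maj1 he t0). Qed.

Lemma nng_maj2 : nng maj2.
Proof. by move=> eta t he t0; rewrite addr_ge0 ?nng_maj1 ?div_sq_ge0. Qed.

Lemma nng_maj3 : nng maj3.
Proof. by move=> eta t he t0; rewrite addr_ge0 ?nng_maj2 ?grad_rho_sq_ge0. Qed.

Lemma dom_maj12 : dom maj1 maj2.
Proof. by apply: dom_le; [exact: nng_maj2|move=> eta t he t0; rewrite lerDl div_sq_ge0]. Qed.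

Lemma dom_maj23 : dom maj2 maj3.
Proof. by apply: dom_le; [exact: nng_maj3|move=> eta t he t0; rewrite lerDl grad_rho_sq_ge0]. Qed.

Lemma dom_maj13 : dom maj1 maj3. Proof. exact: dom_trans dom_maj12 dom_maj23. Qed.

Lemma le_sqO (f : ST -> R) (G : R -> R -> R) : nice f -> nng G ->
  (forall eta t, 0 < eta <= 1 -> 0 < t -> space_int (fun w => f w ^+ 2) t <= G eta t) -> sqO f G.
Proof. by move=> nf G0 h; split=> //; exact: dom_le. Qed.

Lemma ler_sum1 (I : finType) (F : I -> R) i : (forall j, 0 <= F j) -> F i <= \sum_j F j.
Proof. by move=> F0; rewrite (bigD1 i)//= lerDl sumr_ge0. Qed.

Lemma O_dxT i : sqO (dx i T) maj1.
Proof.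
apply: le_sqO; [exact: nice_dx|exact: nng_maj1|move=> eta t he t0].
apply: le_trans (heat_strain_sq_le_maj1 he t0); rewrite /heat_strain_sq -[leLHS]addr0 lerD//.
  apply: (@ler_sum1 _ (fun i => space_int (fun w => dx i T w ^+ 2) t)) => j.
  by apply: sqint_ge0 => //; exact: nice_dx.
apply: si_ge0 => //; first exact: nice_strain_sq.
by move=> w _; apply: sumr_ge0 => k _; apply: sumr_ge0 => j _; exact: sqr_ge0.
Qed.

Lemma strain_le_strain_sq w i j : strain u j i w ^+ 2 <= S2 w.
Proof.
apply: (@le_trans _ _ (\sum_(k < N) strain u k i w ^+ 2)).
  by apply: (@ler_sum1 _ (fun k => strain u k i w ^+ 2)) => k; exact: sqr_ge0.
apply: (@ler_sum1 _ (fun i => \sum_(k < N) strain u k i w ^+ 2)) => l.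
by apply: sumr_ge0 => k _; exact: sqr_ge0.
Qed.

Lemma int_strain_sq_le t : 0 < t -> space_int S2 t <= heat_strain_sq t.
Proof.
move=> t0; rewrite lerDr; apply: sumr_ge0 => i _.
by apply: sqint_ge0 => //; exact: nice_dx.
Qed.

Lemma O_strain i j : sqO (strain u j i) maj1.
Proof.
have ns : nice (strain u j i) by exact: nice_strain.
apply: le_sqO => //; first exact: nng_maj1.
move=> eta t he t0; apply: le_trans (heat_strain_sq_le_maj1 he t0); apply: le_trans (int_strain_sq_le t0).
by apply: le_si => //; [exact: niceX|exact: nice_strain_sq|move=> w _; exact: strain_le_strain_sq].
Qed.

(** Here one derivative is lost: interpolation pays with the factor [1 / eta] and the remainder that
    define [maj1]. This serves second derivatives of [T] and first derivatives of the strain. *)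
Lemma O_dx_maj1 (i : 'I_N) (f : ST -> R) : Cb f -> (forall t, 0 < t -> space_int (fun w => f w ^+ 2) t <= heat_strain_sq t) ->
  sqO (dx i f) maj1.
Proof.
move=> Cf h; split; first exact: nice_dx (Cb_nice Cf).
have [C C0 hC] := Cb_interp i P Cf; exists C => // eta t he t0.
apply: (le_trans (hC _ _ he t0)); apply: ler_wpM2l => //.
rewrite /maj1 lerD2r ler_wpM2l ?h// invr_ge0 ltW//; by case/andP: he.
Qed.

Lemma O_laplacian : sqO lapT maj1.
Proof.
apply: sqO_sum; first exact: nng_maj1.
move=> i; apply: O_dx_maj1; first exact: Cb_dx.
move=> t t0; rewrite /heat_strain_sq -[leLHS]addr0 lerD//.
  apply: (@ler_sum1 _ (fun i => space_int (fun w => dx i T w ^+ 2) t)) => j.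
  by apply: sqint_ge0 => //; exact: nice_dx.
apply: si_ge0 => //; first exact: nice_strain_sq.
by move=> w _; apply: sumr_ge0 => k _; apply: sumr_ge0 => j _; exact: sqr_ge0.
Qed.

Lemma O_div_strain j : sqO (divS j) maj1.
Proof.
apply: sqO_sum; first exact: nng_maj1.
move=> i; apply: O_dx_maj1; first exact: Cb_strain.
move=> t t0; apply: le_trans (int_strain_sq_le t0).
apply: le_si => //; [apply/niceX/nice_strain => //|exact: nice_strain_sq|move=> w _; exact: strain_le_strain_sq].
Qed.

(** Viscous heating is quadratic; with one factor bounded uniformly it is estimated like a linear
    term. *)
Lemma O_strain_sq : sqO S2 maj1.
Proof.
apply: sqO_sum; first exact: nng_maj1.
move=> i; apply: sqO_sum; first exact: nng_maj1.
move=> j; have Cs : Cb (strain u j i) by exact: Cb_strain.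
rewrite (_ : (fun w => _) = (fun w => strain u j i w * strain u j i w)); last first.
  by apply/funext => w; rewrite expr2.
by apply: sqO_M; [exact: Cb_nice|exact: Cb_bnd|exact: O_strain].
Qed.

Lemma O_divergence : sqO div (fun _ => div_sq).
Proof.
apply: le_sqO; [exact: nice_divergence| |by move=> *; exact: lexx].
by move=> eta t _ t0; exact: div_sq_ge0.
Qed.

Lemma nng_div_sq : nng (fun _ => div_sq). Proof. by move=> eta t _ t0; exact: div_sq_ge0. Qed.
Lemma nng_grad_rho_sq : nng (fun _ => grad_rho_sq). Proof. by move=> eta t _ t0; exact: grad_rho_sq_ge0. Qed.

Lemma dom_div_sq : dom (fun _ => div_sq) maj2.
Proof. by apply: dom_le; [exact: nng_maj2|move=> eta t he t0; rewrite lerDr nng_maj1]. Qed.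

Lemma dom_grad_rho_sq : dom (fun _ => grad_rho_sq) maj3.
Proof. by apply: dom_le; [exact: nng_maj3|move=> eta t he t0; rewrite lerDr nng_maj2]. Qed.

Lemma O_dxrho i : sqO (dx i rho) (fun _ => grad_rho_sq).
Proof.
apply: le_sqO; [exact: nice_dx|exact: nng_grad_rho_sq|move=> eta t _ t0].
apply: (@ler_sum1 _ (fun i => space_int (fun w => dx i rho w ^+ 2) t)) => j.
by apply: sqint_ge0 => //; exact: nice_dx.
Qed.

(** One integration by parts on each side leads to the same integrand, once mixed derivatives of
    [u j] commute. *)
Lemma int_grad_swap i j t : 0 < t ->
  space_int (fun w => dx i (u j) w * dx j (u i) w) t =
  space_int (fun w => dx j (u j) w * dx i (u i) w) t.
Proof.
move=> t0; rewrite (si_ibp t0 j (nice_dx i (nu j)) (nu i)).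
rewrite (si_ibp t0 i (nice_dx j (nu j)) (nu i)).
apply: (congr1 -%R).
apply: si_eq => w wt.
have Uw : Ut w by rewrite /Ut/= wt.
by rewrite /dx (nice_pdC _ Uw _ (nu j)).
Qed.

(** Korn's inequality on the torus: the mixed sum of [strain_norm] integrates to [div_sq], and
    [2 / N - 1 <= 1]. *)
Lemma int_grad_u t : 0 < t ->
  space_int (fun w => \sum_(i < N) \sum_(j < N) dx i (u j) w ^+ 2) t <= 2 * heat_strain_sq t + div_sq t.
Proof.
move=> t0; have nd := nice_divergence nu; have nS := nice_strain_sq nu.
pose X w := \sum_(i < N) \sum_(j < N) dx i (u j) w * dx j (u i) w.
have nX : nice X by rewrite /X; nice.
have eX : space_int X t = div_sq t.
  rewrite /X (si_sum t0); last by move=> i; nice.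
  rewrite /div_sq (@si_eq _ _ _ _ (fun w => \sum_(i < N) \sum_(j < N) dx j (u j) w * dx i (u i) w)).
    rewrite (si_sum t0); last by move=> i; nice.
    apply: eq_bigr => i _.
    rewrite !(si_sum t0); try by move=> j; nice.
    by apply: eq_bigr => j _; exact: int_grad_swap.
  move=> w _; rewrite expr2 mulr_sumr; apply: eq_bigr => i _.
  by rewrite mulr_suml.
have -> : space_int (fun w => \sum_(i < N) \sum_(j < N) dx i (u j) w ^+ 2) t =
    space_int (fun w => 2 * S2 w - X w + 2 / N%:R * div w ^+ 2) t.
  apply: si_eq => w _.
  by rewrite (strain_norm (fun i j => dx j (u i) w) N0).
rewrite (siD t0 (niceD (niceM (nice_cst _) nS) (niceN nX)) (niceM (nice_cst _) (niceX 2 nd))).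
rewrite (siB t0 (niceM (nice_cst _) nS) nX) (siZ t0 _ nS) (siZ t0 _ (niceX 2 nd)) eX -/(div_sq t).
have b0 := div_sq_ge0 t0.
have h1 := int_strain_sq_le t0.
have : 2 / N%:R * div_sq t <= 2 * div_sq t.
  by rewrite ler_wpM2r// ler_pdivrMr ?ler_peMr// ltr0n.
by lra.
Qed.

Lemma O_gradu i j : sqO (dx i (u j)) maj2.
Proof.
split; first exact: nice_dx.
exists 2 => // eta t he t0.
have h : space_int (fun w => dx i (u j) w ^+ 2) t <= 2 * heat_strain_sq t + div_sq t.
  apply: le_trans (int_grad_u t0); apply: le_si => //; [by nice|by nice|].
  move=> w _; apply: (@le_trans _ _ (\sum_(j < N) dx i (u j) w ^+ 2)).
    by apply: (@ler_sum1 _ (fun k => dx i (u k) w ^+ 2)) => k; exact: sqr_ge0.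
  apply: (@ler_sum1 _ (fun i => \sum_(k < N) dx i (u k) w ^+ 2)) => l.
  by apply: sumr_ge0 => k _; exact: sqr_ge0.
apply: (le_trans h); have := heat_strain_sq_le_maj1 he t0; have := div_sq_ge0 t0; rewrite /maj2; lra.
Qed.

(* Poincare with the mean taken against the density [rho]: since rho is a
   probability density, the two means differ by at most the deviation of [f]. *)
Lemma weighted_poincare (f : ST -> R) : nice f -> exists2 C, 0 <= C & forall t, 0 < t ->
  space_int (fun w => f w ^+ 2) t <= 2 * space_int (fun w => rho w * f w) t ^+ 2
   + C * \sum_(i < N) space_int (fun w => dx i f w ^+ 2) t.
Proof.
move=> nf; have [K K0 hK] := Cb_bnd Crho.
exists (1 + 2 * K ^+ 2); first by have := sqr_ge0 K; lra.
move=> t t0; have [r1 _ _] := norms t0.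
set D := \sum_(i < N) _; set q := space_int (fun w => rho w * f w) t.
set m := space_int f t; set F2 := space_int (fun w => f w ^+ 2) t.
have hp : F2 <= m ^+ 2 + D by exact: si_poincare.
have nf2 : nice (fun w => f w ^+ 2) by nice.
have nfm : nice (fun w => f w - m) by nice.
have var : space_int (fun w => (f w - m) ^+ 2) t = F2 - m ^+ 2.
  rewrite (@si_eq _ _ _ _ (fun w => f w ^+ 2 + ((- 2 * m) * f w + m ^+ 2))).
    rewrite (siD t0 nf2 (niceD (niceM (nice_cst _) nf) (nice_cst _))).
    rewrite (siD t0 (niceM (nice_cst _) nf) (nice_cst _)) (siZ t0 _ nf) si_cst.
    by rewrite -/m -/F2; ring.
  by move=> w _; ring.
have dq : space_int (fun w => rho w * (f w - m)) t = q - m.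
  rewrite (@si_eq _ _ _ _ (fun w => rho w * f w + (- m) * rho w)).
    by rewrite (siD t0 (niceM nrho nf) (niceM (nice_cst _) nrho)) (siZ t0 _ nrho) r1 mulr1.
  by move=> w _; ring.
have js : (q - m) ^+ 2 <= K ^+ 2 * D.
  rewrite -dq; apply: (le_trans (si_jensen t0 (niceM nrho nfm))).
  apply: (@le_trans _ _ (K ^+ 2 * (F2 - m ^+ 2))); last first.
    by rewrite ler_wpM2l ?sqr_ge0//; lra.
  rewrite -var -(siZ t0); last by nice.
  apply: le_si => //; [by nice|by nice|move=> w Uw].
  rewrite exprMn ler_wpM2r ?sqr_ge0//.
  by rewrite -real_normK ?num_real// ler_pXn2r ?nnegrE// hK.
have : m ^+ 2 <= 2 * q ^+ 2 + 2 * (q - m) ^+ 2 by have := sqr_ge0 (2 * q - m); lra.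
by lra.
Qed.

(** The normalization fixes the [rho]-weighted mean of [u j], which vanishes, rather than its plain
    mean; hence the weighted Poincare inequality. *)
Lemma O_u j : sqO (u j) maj2.
Proof.
split=> //; have [C C0 hC] := weighted_poincare (nu j).
have [D D0 hD] : dom (fun _ t => \sum_(i < N) space_int (fun w => dx i (u j) w ^+ 2) t) maj2.
  by apply: dom_sum => i; case: (O_gradu i j).
exists (C * D); first exact: mulr_ge0.
move=> eta t he t0; apply: (le_trans (hC t t0)).
have [_ -> _] := norms t0; rewrite expr2 mul0r mulr0 add0r -mulrA.
by apply: ler_wpM2l => //; exact: hD.
Qed.

Lemma O_rho1 : sqO (fun w => rho w - 1) maj3.
Proof.
have n1 : nice (fun w => rho w - 1) by nice.
split=> //; exists 1 => // eta t he t0; rewrite mul1r.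
apply: (le_trans (si_poincare t0 n1)).
rewrite (siB t0 nrho (nice_cst 1)) si_cst; have [-> _ _] := norms t0.
rewrite subrr expr2 mul0r add0r /maj3 -[leLHS]add0r lerD ?nng_maj2//.
apply: ler_sum => i _; rewrite le_eqVlt; apply/orP; left; apply/eqP.
apply: si_eq => w wt; congr (_ ^+ 2).
by rewrite /dx (pdB _ _ nrho (nice_cst 1)) ?pd_cst ?subr0// /Ut/= wt.
Qed.

Lemma usq_ge0 w : 0 <= usq u w.
Proof. by apply: sumr_ge0 => i _; exact: sqr_ge0. Qed.

(** The energy normalization makes the [rho]-weighted mean of [T - 1] equal to [- <rho |u|^2> / N].
    By Jensen and the uniform bounds, its square is at most a constant times [<|u|^2>], which [O_u]
    controls. *)
Lemma O_T1 : sqO (fun w => T w - 1) maj3.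
Proof.
have n1 : nice (fun w => T w - 1) by nice.
split=> //; have [C C0 hC] := weighted_poincare n1.
have nus : nice (usq u) by exact: nice_usq.
have [K K0 hK] := Cb_bnd Crho.
have [L L0 hL] : bnd (usq u).
  apply: bnd_sum => i; rewrite (_ : (fun w => _) = (fun w => u i w * u i w)).
    by apply: bndM; exact: Cb_bnd.
  by apply/funext => w; rewrite expr2.
have [D D0 hD] : dom (fun _ t => \sum_(i < N) space_int (fun w => dx i T w ^+ 2) t) maj3.
  by apply: dom_sum => i; have [_ d] := O_dxT i; exact: dom_trans d dom_maj13.
have [D' D'0 hD'] : dom (fun _ t => \sum_(i < N) space_int (fun w => u i w ^+ 2) t) maj3.
  by apply: dom_sum => i; have [_ d] := O_u i; exact: dom_trans d dom_maj23.
exists (2 * (K ^+ 2 * L) * D' + C * D).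
  by rewrite addr_ge0 ?mulr_ge0// sqr_ge0.
move=> eta t he t0; apply: (le_trans (hC t t0)).
rewrite [leRHS]mulrDl; apply: lerD; last first.
  rewrite -mulrA; apply: ler_wpM2l => //; apply: le_trans (hD _ _ he t0).
  apply: ler_sum => i _; rewrite le_eqVlt; apply/orP; left; apply/eqP.
  apply: si_eq => w wt; congr (_ ^+ 2).
  by rewrite /dx (pdB _ _ nT (nice_cst 1)) ?pd_cst ?subr0// /Ut/= wt.
rewrite -!mulrA; apply: ler_wpM2l => //.
have [r1 _ en] := norms t0.
have e1 : space_int (fun w => rho w * (T w - 1)) t = - N%:R^-1 * space_int (fun w => rho w * usq u w) t.
  rewrite (@si_eq _ _ _ _ (fun w => rho w * T w - rho w)); last by move=> w _; ring.
  rewrite (siB t0 (niceM nrho nT) nrho) r1.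
  move: en; rewrite (@si_eq _ _ _ _ (fun w => 2^-1 * (rho w * usq u w))); last by move=> w _; ring.
  rewrite (siZ t0 _ (niceM nrho nus)).
  move: (space_int _ t) (space_int _ t) => y x en.
  have -> : y = 1 - N%:R^-1 * x.
    apply: (@mulfI _ (N%:R / 2)); first by rewrite mulf_neq0// invr_eq0 pnatr_eq0.
    rewrite (_ : N%:R / 2 * (1 - N%:R^-1 * x) = N%:R / 2 - 2^-1 * x); last by field.
    by rewrite -[LHS](addKr (2^-1 * x)) en addrC.
  by ring.
have js : space_int (fun w => rho w * (T w - 1)) t ^+ 2 <= space_int (fun w => rho w * usq u w) t ^+ 2.
  rewrite e1 exprMn sqrrN ler_piMl ?sqr_ge0// exprn_ile1 ?invr_ge0// invf_le1//.
  by rewrite ltr0n.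
apply: (le_trans js).
apply: (le_trans (si_jensen t0 (niceM nrho nus))).
apply: (@le_trans _ _ (K ^+ 2 * (L * space_int (usq u) t))); last first.
  rewrite expr2 -mulrA; do 3 apply: ler_wpM2l => //.
  by apply: le_trans (hD' _ _ he t0); rewrite (si_sum t0)// => i; nice.
rewrite -(siZ t0 _ nus) -(siZ t0); last by nice.
apply: le_si => //; [by nice|by nice|move=> w Uw].
rewrite exprMn; apply: ler_pM; rewrite ?sqr_ge0//.
  by rewrite -real_normK ?num_real// ler_pXn2r ?nnegrE// hK.
rewrite expr2 ler_wpM2r ?usq_ge0//; exact: le_trans (ler_norm _) (hL _ Uw).
Qed.

Lemma O_advection (f : ST -> R) (G : R -> R -> R) : nng G -> (forall i, sqO (dx i f) G) -> sqO (adv f) G.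
Proof.
move=> G0 Of; apply: sqO_sum => // i.
by apply: sqO_M => //; exact: Cb_bnd.
Qed.

(** The part of [dt T] dominated by [maj1]. The term left out, [- (2 / N) T div u], is the one that
    produces [div_sq] with a definite sign. *)
Definition dtT_rem : ST -> R := fun w => - adv T w + (4 * mu / N%:R * ((rho w)^-1 * S2 w)
  + kappa * ((rho w)^-1 * lapT w)).

(** The part of [dt (u j)] dominated by [maj2]. The term left out, [- (T / rho) dx j rho], produces
    [grad_rho_sq]. *)
Definition dtu_rem (j : 'I_N) : ST -> R := fun w => - adv (u j) w + (- dx j T w
  + 2 * mu * ((rho w)^-1 * divS j w)).

Lemma dtTE w : Ut w -> dt T w = dtT_rem w - 2 / N%:R * (T w * div w).
Proof.
move=> Uw; have := temperature N0 nrho nu nT eqs Uw.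
have r0 := lt0r_neq0 (rho0 Uw); rewrite /dtT_rem.
move: (dt T w) (adv T w) (S2 w) (lapT w) (div w) => p q x y d h.
apply: (@mulfI _ (N%:R / 2 * rho w)); first by apply: mulf_neq0 => //; apply: mulf_neq0 => //; rewrite invr_eq0 pnatr_eq0.
rewrite (_ : N%:R / 2 * rho w * p = N%:R / 2 * (rho w * (p + q)) - N%:R / 2 * rho w * q); last by ring.
by rewrite h; field; rewrite N0' r0.
Qed.

Lemma dtuE j w : Ut w -> dt (u j) w = dtu_rem j w - (rho w)^-1 * (T w * dx j rho w).
Proof.
move=> Uw; have := momentum nrho nu eqs j Uw.
rewrite (_ : dx j (fun w => rho w * T w) w = dx j rho w * T w + rho w * dx j T w); last first.
  by rewrite /dx (pdM _ Uw nrho nT).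
have r0 := lt0r_neq0 (rho0 Uw); rewrite /dtu_rem.
move: (dt (u j) w) (adv _ w) (divS j w) (dx j rho w) (dx j T w) => p q x y d h.
apply: (@mulfI _ (rho w)) => //.
rewrite (_ : rho w * p = rho w * (p + q) - rho w * q); last by ring.
by rewrite h; field.
Qed.

Lemma O_dtT_rem : sqO dtT_rem maj1.
Proof.
apply: sqO_D; first by apply/sqO_N/O_advection; [exact: nng_maj1|exact: O_dxT].
apply: sqO_D; apply: sqO_Z; apply: (sqO_M nirho birho); [exact: O_strain_sq|exact: O_laplacian].
Qed.

Lemma O_dtu_rem j : sqO (dtu_rem j) maj2.
Proof.
apply: sqO_D; first by apply/sqO_N/O_advection; [exact: nng_maj2|move=> i; exact: O_gradu].
apply: sqO_D; first by apply: sqO_N; exact: sqO_le (O_dxT j) dom_maj12.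
by apply: sqO_Z; apply: (sqO_M nirho birho); exact: sqO_le (O_div_strain j) dom_maj12.
Qed.

Lemma O_dxrho_maj3 i : sqO (dx i rho) maj3.
Proof. exact: sqO_le (O_dxrho i) dom_grad_rho_sq. Qed.

Lemma O_dtu j : sqO (dt (u j)) maj3.
Proof.
have O1 : sqO (fun w => dtu_rem j w + (- ((rho w)^-1 * (T w * dx j rho w)))) maj3.
  apply: sqO_D; first exact: sqO_le (O_dtu_rem j) dom_maj23.
  apply: sqO_N; apply: (sqO_M nirho birho); apply: (sqO_M nT (Cb_bnd CT)).
  exact: O_dxrho_maj3.
apply: sqO_eq O1; first exact: nice_dt.
by move=> w Uw; rewrite dtuE.
Qed.

Lemma O_dtrho : sqO (dt rho) maj3.
Proof.
have O1 : sqO (fun w => - (adv rho w + rho w * div w)) maj3.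
  apply: sqO_N; apply: sqO_D; first by apply: O_advection; [exact: nng_maj3|exact: O_dxrho_maj3].
  apply: (sqO_M nrho (Cb_bnd Crho)).
  exact: sqO_le O_divergence (dom_trans dom_div_sq dom_maj23).
apply: sqO_eq O1; first exact: nice_dt.
by move=> w Uw; rewrite (mass nrho nu eqs).
Qed.

(** Time and space derivatives commute, and integration by parts moves the space derivative from
    [dt f] to [u], so that no derivative of [dt f] has to be estimated. *)
Lemma int_dt_advection f t : nice f -> 0 < t ->
  space_int (dt (adv f)) t = \sum_(j < N) space_int (fun w => dt (u j) w * dx j f w) t
   - space_int (fun w => div w * dt f w) t.
Proof.
move=> nf t0.
have ndt : nice (dt f) by exact: nice_dt.
have n1 j : nice (fun w => dt (u j) w * dx j f w).
  exact: niceM (nice_dt (nu j)) (nice_dx j nf).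
have n2 j : nice (fun w => u j w * dx j (dt f) w).
  exact: niceM (nu j) (nice_dx j ndt).
have n3 j : nice (fun w => dx j (u j) w * dt f w).
  exact: niceM (nice_dx j (nu j)) ndt.
rewrite (@si_eq _ _ _ _ (fun w => \sum_(j < N) dt (u j) w * dx j f w
   + \sum_(j < N) u j w * dx j (dt f) w)); last first.
  move=> w wt; have Uw : Ut w by rewrite /Ut/= wt.
  rewrite /dt /advection (pd_sum _ Uw _ (fun i => niceM (nu i) (nice_dx i nf))).
  rewrite -big_split/=; apply: eq_bigr => i _.
  by rewrite (pdM _ Uw (nu i) (nice_dx i nf)) /dx (nice_pdC _ Uw _ nf).
rewrite (siD t0 (nice_sum _ n1) (nice_sum _ n2)) (si_sum t0 _ n1) (si_sum t0 _ n2).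
congr (_ + _).
rewrite (@si_eq _ _ _ (fun w => div w * dt f w) (fun w => \sum_(j < N) dx j (u j) w * dt f w)).
  rewrite (si_sum t0 _ n3) -sumrN; apply: eq_bigr => j _.
  by rewrite (si_ibp t0 j (nu j) ndt).
by move=> w _; rewrite mulr_suml.
Qed.

Lemma young_dom (f g : ST -> R) (F G : R -> R -> R) (y : R) : nng F -> nng G -> sqO f F -> sqO g G -> 0 < y ->
  dom (fun eta t => `|space_int (fun w => f w * g w) t| - y * F eta t) G.
Proof.
move=> F0 G0 Of Og y0; have [C C0 hC] := @sqO_young R N f g F G y F0 G0 Of Og y0.
by exists C => // eta t he t0; rewrite lerBlDl; exact: hC.
Qed.

(** By [dtTE], [- <div u dt T>] contains [(2 / N) <T (div u)^2>]. The other term [<dt u . grad T>]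
    involves the gradient of [rho], not yet controlled; Young's inequality gives it an arbitrary
    weight [y] at the expense of [C]. *)
Lemma dt_int_advT_ge y : 0 < y -> exists2 C, 0 <= C & forall eta t, 0 < eta <= 1 -> 0 < t ->
  2 / N%:R * T_m * div_sq t - y * (div_sq t + grad_rho_sq t) - C * maj1 eta t <= space_int (dt (adv T)) t.
Proof.
(* The [N] components carry [y1] each, in total [y / 2]; another [y / 2] is spent on the product of
   the divergence and [dtT_rem]. *)
move=> y0; pose y1 := y / (2 * N%:R).
have N0r : 0 < N%:R :> R by rewrite ltr0n.
have y10 : 0 < y1 by rewrite divr_gt0// mulr_gt0.
have [C C0 hC] : dom (fun eta t => \sum_(j < N)
    (`|space_int (fun w => dt (u j) w * dx j T w) t| - y1 * maj3 eta t)) maj1.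
  by apply: dom_sum => j; exact: (young_dom nng_maj3 nng_maj1 (O_dtu j) (O_dxT j) y10).
have y20 : 0 < y / 2 by rewrite divr_gt0.
have [D D0 hD] := young_dom nng_div_sq nng_maj1 O_divergence O_dtT_rem y20.
exists (C + D + y); first by rewrite !addr_ge0// ltW.
move=> eta t he t0; have := hC _ _ he t0; rewrite sumrB sumr_const card_ord -[(y1 * _) *+ N]mulr_natr.
have -> : y1 * maj3 eta t * N%:R = y / 2 * maj3 eta t by rewrite /y1; field.
have := hD _ _ he t0.
have nd := nice_divergence nu.
have nW : nice dtT_rem by case: O_dtT_rem.
have nTd : nice (fun w => T w * div w ^+ 2) by nice.
rewrite (int_dt_advection nT t0).
have E : space_int (fun w => div w * dt T w) t = space_int (fun w => div w * dtT_rem w) t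
   - 2 / N%:R * space_int (fun w => T w * div w ^+ 2) t.
  rewrite -(siZ t0 _ nTd) -(siB t0 (niceM nd nW) (niceM (nice_cst _) nTd)).
  apply: si_eq => w wt; rewrite dtTE; last by rewrite /Ut/= wt.
  by ring.
rewrite E.
have hT : T_m * div_sq t <= space_int (fun w => T w * div w ^+ 2) t.
  rewrite -(siZ t0 _ (niceX 2 nd)); apply: le_si => //; first by nice.
  by move=> w /low[_ h]; rewrite ler_wpM2r// sqr_ge0.
have n20 : 0 <= 2 / N%:R :> R by rewrite divr_ge0// ltW.
have := ler_wpM2l n20 hT.
have : - \sum_(j < N) `|space_int (fun w => dt (u j) w * dx j T w) t|
    <= \sum_(j < N) space_int (fun w => dt (u j) w * dx j T w) t.
  by rewrite -sumrN; apply: ler_sum => j _; rewrite lerNl -normrN ler_norm.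
have := ler_norm (space_int (fun w => div w * dtT_rem w) t).
have := nng_maj1 he t0; have := div_sq_ge0 t0; have := grad_rho_sq_ge0 t0.
rewrite /maj3 /maj2 mulrA.
move: (maj1 eta t) (div_sq t) (grad_rho_sq t) (space_int _ t) (space_int _ t) (2 / N%:R) => g b r X Z n2.
move: (\sum_(j < N) _) (\sum_(j < N) _) => s1 s2.
move: hC hD => _ _ r0 b0 g0 *.
have : 0 <= y / 2 * g by rewrite mulr_ge0// ltW.
have : 0 <= y * r by rewrite mulr_ge0// ltW.
have : 0 <= y * b by rewrite mulr_ge0// ltW.
by lra.
Qed.

(** By [dtuE], [- <dt u . grad rho>] contains [<(T / rho) |grad rho|^2>]. A large coefficient of
    [div_sq] is acceptable here, since a small multiple of this estimate will be added to the
    previous one. *)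
Lemma dt_int_advrho_le : exists c C, [/\ 0 < c, 0 <= C & forall eta t, 0 < eta <= 1 -> 0 < t ->
  c * grad_rho_sq t - C * (maj1 eta t + div_sq t) <= - space_int (dt (adv rho)) t].
Proof.
have [K K0 hK] := Cb_bnd Crho.
(* A lower bound for [T / rho], as [K] bounds [rho]. *)
pose c := T_m / (K + 1).
have K1 : 0 < K + 1 by rewrite ltr_wpDl.
have c0 : 0 < c by rewrite divr_gt0.
have N0r : 0 < N%:R :> R by rewrite ltr0n.
(* [grad_rho_sq] is lost twice with weight [y], through [dtu_rem] and through [dt rho]; half of [c]
   survives. *)
pose y := c / 4; have y0 : 0 < y by rewrite divr_gt0.
pose y1 := y / N%:R; have y10 : 0 < y1 by rewrite divr_gt0.
have [C C0 hC] : dom (fun eta t => \sum_(j < N)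
    (`|space_int (fun w => dx j rho w * dtu_rem j w) t| - y1 * grad_rho_sq t)) maj2.
  by apply: dom_sum => j; exact: (young_dom nng_grad_rho_sq nng_maj2 (O_dxrho j) (O_dtu_rem j) y10).
have [D D0 hD] := young_dom nng_maj3 nng_div_sq O_dtrho O_divergence y0.
exists (c / 2), (C + D + y); split; [by rewrite divr_gt0|by rewrite !addr_ge0// ltW|].
move=> eta t he t0; have := hC _ _ he t0; rewrite sumrB sumr_const card_ord -[(y1 * _) *+ N]mulr_natr.
have -> : y1 * grad_rho_sq t * N%:R = y * grad_rho_sq t by rewrite /y1; field.
have := hD _ _ he t0.
have nd := nice_divergence nu.
have nV j : nice (dtu_rem j) by case: (O_dtu_rem j).
have ndr j : nice (dx j rho) by exact: nice_dx.
have ndtr : nice (dt rho) by exact: nice_dt.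
have nq j : nice (fun w => (rho w)^-1 * (T w * dx j rho w ^+ 2)).
  exact: niceM nirho (niceM nT (niceX 2 (ndr j))).
rewrite (int_dt_advection nrho t0).
have -> : \sum_(j < N) space_int (fun w => dt (u j) w * dx j rho w) t =
   \sum_(j < N) space_int (fun w => dx j rho w * dtu_rem j w) t
   - \sum_(j < N) space_int (fun w => (rho w)^-1 * (T w * dx j rho w ^+ 2)) t.
  rewrite -sumrB; apply: eq_bigr => j _.
  rewrite -(siB t0 (niceM (ndr j) (nV j)) (nq j)).
  apply: si_eq => w wt; rewrite dtuE; last by rewrite /Ut/= wt.
  by ring.
have hr : c * grad_rho_sq t <= \sum_(j < N) space_int (fun w => (rho w)^-1 * (T w * dx j rho w ^+ 2)) t.
  rewrite /grad_rho_sq mulr_sumr; apply: ler_sum => j _.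
  rewrite -(siZ t0 _ (niceX 2 (ndr j))); apply: (le_si t0 (niceM (nice_cst _) (niceX 2 (ndr j))) (nq j)).
  move=> w Uw; have [h1 h2] := low Uw; have r0 := rho0 Uw.
  rewrite [leRHS]mulrA; apply: ler_wpM2r; first exact: sqr_ge0.
  rewrite /c mulrC; apply: ler_pM => //.
  - by rewrite invr_ge0 ltW.
  - exact: ltW.
  - rewrite lef_pV2 ?posrE//; apply: (le_trans (le_trans (ler_norm _) (hK _ Uw))).
    by rewrite lerDl.
have -> : space_int (fun w => div w * dt rho w) t = space_int (fun w => dt rho w * div w) t.
  by apply: si_eq => w _; rewrite mulrC.
have : \sum_(j < N) space_int (fun w => dx j rho w * dtu_rem j w) t <=
   \sum_(j < N) `|space_int (fun w => dx j rho w * dtu_rem j w) t|.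
  by apply: ler_sum => j _; rewrite ler_norm.
have : - space_int (fun w => dt rho w * div w) t <= `|space_int (fun w => dt rho w * div w) t|.
  by rewrite -normrN ler_norm.
move: hr; have := nng_maj1 he t0; have := div_sq_ge0 t0; have := grad_rho_sq_ge0 t0.
rewrite /maj3 /maj2.
move: (maj1 eta t) (div_sq t) (grad_rho_sq t) (space_int _ t) => g b r X.
move: (\sum_(j < N) _) (\sum_(j < N) _) (\sum_(j < N) _) => s1 s2 s3.
move: hC hD => _ _ r0 b0 g0 *.
have : 0 <= D * g by rewrite mulr_ge0.
have : 0 <= y * b by rewrite mulr_ge0// ltW.
have : y * r = c * r / 4 by rewrite /y; ring.
by lra.
Qed.

End Estimates.

(** * Scalar inequalities: logarithm, Gronwall, exponential against powers *)

Section RealInequalities.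
Variable R : realType.
Implicit Types x K : R.

Lemma ln_le_subr1 x : 0 < x -> ln x <= x - 1.
Proof.
move=> x0; have := @le_ln1Dx R (x - 1).
by rewrite (_ : 1 + (x - 1) = x); [apply; lra|ring].
Qed.

(** With [s] the square root of [x], [ln x = 2 ln s]; the tangent bound at [s] and at [1 / s] then
    leaves the full square [(s - 1)^2] in [xlnx_lower] and [subr_ln_lower], a quadratic lower bound
    without Taylor expansion. *)
Lemma ln_half_bounds x : 0 < x ->
  exists s : R, [/\ 0 < s, x = s ^+ 2, ln x <= 2 * (s - 1) & 2 * (1 - s^-1) <= ln x].
Proof.
move=> x0; exists (Num.sqrt x); set s := Num.sqrt x.
have s0 : 0 < s by rewrite sqrtr_gt0.
have xs : x = s ^+ 2 by rewrite sqr_sqrtr// ltW.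
have l2 : ln x = 2 * ln s by rewrite xs lnXn// mulr_natl.
have v0 : 0 < s^-1 by rewrite invr_gt0.
split=> //; first by have := ln_le_subr1 s0; lra.
by have := ln_le_subr1 v0; rewrite lnV ?posrE//; lra.
Qed.

Lemma sqr_sub1_le (s K : R) : 0 < s -> s ^+ 2 <= K ->
  (s ^+ 2 - 1) ^+ 2 / (2 * K + 2) <= (s - 1) ^+ 2.
Proof.
move=> s0 sK; have K0 : 0 < 2 * K + 2 by have := sqr_ge0 s; lra.
rewrite ler_pdivrMr// (_ : (s ^+ 2 - 1) ^+ 2 = (s - 1) ^+ 2 * (s + 1) ^+ 2); last by ring.
by apply: ler_wpM2l; [exact: sqr_ge0|have := sqr_ge0 (s - 1); lra].
Qed.

Lemma xlnx_lower x K : 0 < x -> x <= K -> (x - 1) ^+ 2 / (2 * K + 2) <= x * ln x - x + 1.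
Proof.
move=> x0 xK; have [s [s0 xs _ h]] := ln_half_bounds x0.
rewrite xs in xK; apply: (@le_trans _ _ ((s - 1) ^+ 2)).
  by rewrite {1}xs; exact: sqr_sub1_le.
have := ler_wpM2l (ltW x0) h.
have -> : x * (2 * (1 - s^-1)) = 2 * s ^+ 2 - 2 * s by rewrite xs; field; rewrite gt_eqF.
by lra.
Qed.

Lemma xlnx_upper x : 0 < x -> x * ln x - x + 1 <= (x - 1) ^+ 2.
Proof. by move=> x0; have := ler_wpM2l (ltW x0) (ln_le_subr1 x0); lra. Qed.

Lemma subr_ln_lower x K : 0 < x -> x <= K -> (x - 1) ^+ 2 / (2 * K + 2) <= x - 1 - ln x.
Proof.
move=> x0 xK; have [s [s0 xs h _]] := ln_half_bounds x0.
rewrite xs in xK; apply: (@le_trans _ _ ((s - 1) ^+ 2)).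
  by rewrite {1}xs; exact: sqr_sub1_le.
by lra.
Qed.

Lemma subr_ln_upper x c : 0 < c -> c <= x -> x - 1 - ln x <= c^-1 * (x - 1) ^+ 2.
Proof.
move=> c0 cx; have x0 : 0 < x by exact: lt_le_trans cx.
have v0 : 0 < x^-1 by rewrite invr_gt0.
apply: (@le_trans _ _ (x^-1 * (x - 1) ^+ 2)).
  have := ln_le_subr1 v0; rewrite lnV ?posrE// => h.
  rewrite (_ : x^-1 * (x - 1) ^+ 2 = x - 2 + x^-1); first by lra.
  by field; rewrite gt_eqF.
by apply: ler_wpM2r; [exact: sqr_ge0|rewrite lef_pV2 ?posrE].
Qed.

(** [(L - M) exp (k (t - 1))] is compared at 1 and [t] by the mean value theorem. Time starts at 1
    because the inequality is given at positive times only. *)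
Lemma gronwall (L L' : R -> R) (k M : R) : 0 < k ->
  (forall t : R, 0 < t -> is_derive t 1 L (L' t)) ->
  (forall t : R, 0 < t -> L' t <= - k * L t + k * M) ->
  forall t, 1 <= t -> L t <= M + (L 1 - M) * expR (- (k * (t - 1))).
Proof.
move=> k0 dL hL t t1.
pose H (s : R) := (L s - M) * expR (k * (s - 1)).
have dH (s : R) : 0 < s -> is_derive s 1 H ((L' s + k * (L s - M)) * expR (k * (s - 1))).
  move=> s0; have dLs := dL s s0.
  have d1 : is_derive s 1 (fun s => k * (s - 1)) k.
    by apply: is_derive_eq; rewrite /GRing.scale/= !(mulr1,mulr0,addr0,subr0,add0r).
  have d2 : is_derive s 1 (fun s => expR (k * (s - 1))) (expR (k * (s - 1)) * k).
    exact: (@is_derive1_comp _ (@expR R) _ _ _ _ (is_derive_expR _) d1).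
  have d3 : is_derive s 1 (fun s => L s - M) (L' s).
    by apply: is_derive_eq; rewrite subr0.
  apply: is_derive_eq (is_deriveM d3 d2) _; rewrite /GRing.scale/=; ring.
have [x|/=|c] := @MVT_segment R H (fun s => (L' s + k * (L s - M)) * expR (k * (s - 1))) 1 t t1.
- by rewrite in_itv/= => /andP[x1 _]; apply: dH; lra.
- apply: derivable_within_continuous => x; rewrite in_itv/= => /andP[x1 _].
  have x0 : 0 < x by lra.
  by have [] := dH x x0.
rewrite in_itv/= => /andP[c1 _] /eqP; rewrite subr_eq => /eqP Ht.
have c0 : 0 < c by lra.
have : H t <= H 1.
  rewrite Ht gerDr; apply: mulr_le0_ge0; last by rewrite subr_ge0.
  by apply: mulr_le0_ge0; [have := hL c c0; lra|exact: expR_ge0].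
rewrite /H subrr mulr0 expR0 mulr1 => h.
have e0 := expR_gt0 (k * (t - 1)).
by rewrite expRN -lerBlDl ler_pdivlMr.
Qed.

(** The bound [1 + y <= exp y] at [y = x / (P + 1)], raised to the power [P + 1]. *)
Lemma expRN_le (x : R) (P : nat) : 0 < x -> expR (- x) <= P.+1%:R ^+ P.+1 / x ^+ P.+1.
Proof.
move=> x0; have q0 : 0 < x / P.+1%:R by rewrite divr_gt0// ltr0n.
have le : (x / P.+1%:R) ^+ P.+1 <= expR x.
  rewrite (_ : expR x = expR (x / P.+1%:R) ^+ P.+1); last first.
    by rewrite -expRM_natl; congr expR; rewrite mulrCA mulfV ?mulr1// pnatr_eq0.
  rewrite ler_pXn2r ?nnegrE ?expR_ge0 ?(ltW q0)//.
  by apply: le_trans (expR_ge1Dx _); rewrite lerDr.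
rewrite expRN -[leRHS]invrK lef_pV2 ?posrE ?expR_gt0//; last first.
  by rewrite invr_gt0 divr_gt0// exprn_gt0// ltr0n.
by rewrite invf_div -expr_div_n.
Qed.

End RealInequalities.

(** * The Lyapunov functional *)

(** [X] and [Y] stand for the time derivatives of [<u . grad T>] and [<u . grad rho>]. Of [c1 b],
    one quarter absorbs [k C2 b] and one quarter [y b]; of [k c2 r], one half absorbs [y r]. *)
Lemma combine_cross_terms (R : realType) (c1 c2 c3 k y C1 C2 b r g X Y : R) :
  0 <= k -> 0 <= b -> 0 <= r -> k * C2 <= c1 / 4 -> y <= c1 / 4 -> y <= k * c2 / 2 ->
  c3 <= c1 / 2 -> c3 <= k * c2 / 2 ->
  c1 * b - y * (b + r) - C1 * g <= X -> c2 * r - C2 * (g + b) <= - Y ->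
  c3 * (b + r) - (C1 + k * C2) * g <= X - k * Y.
Proof.
move=> k0 b0 r0 kC2 yc1 yc2 c3c1 c3c2 h1 h2.
have h2' := ler_wpM2l k0 h2.
have p1 := ler_wpM2r b0 kC2; have p2 := ler_wpM2r b0 yc1; have p3 := ler_wpM2r r0 yc2.
have p4 := ler_wpM2r b0 c3c1; have p5 := ler_wpM2r r0 c3c2.
lra.
Qed.

(** Used with [e = eta^(P+1)] and [w = eta (b + r)]: the cross terms supply [w] and cost at most
    half of the dissipation [c0 a]. *)
Lemma combine_lyapunov (R : realType) (c0 m x1 x2 a e w X Y mE : R) :
  0 <= a -> 0 <= w -> m <= c0 / 2 -> m <= x1 -> x2 <= c0 / 2 ->
  Y <= - c0 * a -> x1 * w - x2 * (a + e) <= X -> mE <= m * (a + e + w) ->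
  Y - X <= - mE + (m + x2) * e.
Proof.
move=> a0 w0 mc0 mx1 x2c hY hX hm.
have p1 := ler_wpM2r a0 mc0; have p2 := ler_wpM2r w0 mx1; have p3 := ler_wpM2r a0 x2c.
lra.
Qed.

Lemma combine_decay (R : realType) (l et e1 A p ex e x z : R) :
  l <= e + x + z -> z <= 3 / 2 * e1 * ex -> et / 2 - e <= l -> 0 <= A * ex -> 0 <= e1 * p ->
  e + x <= A * p -> e <= p -> 0 <= ex ->
  et <= (3 * e1 + 2 * A + 2) * (ex + p).
Proof. by move=> *; lra. Qed.

(** Serves the choice of small parameters; the denominator [C + 1] covers the case [C = 0]. *)
Lemma div_succ_mul_le (R : realType) (c C d : R) : 0 < d -> 0 <= c -> 0 <= C ->
  c / (d * (C + 1)) * C <= c / d.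
Proof.
move=> d0 c0 C0; have C1 : 0 < C + 1 by rewrite ltr_wpDl.
rewrite mulrAC ler_pdivrMr ?mulr_gt0// mulrA divfK ?gt_eqF// mulrDr mulr1.
by rewrite lerDl.
Qed.

Section Lyapunov.
Variables (R : realType) (N : nat) (mu kappa : R).
Variables (rho : 'rV[R]_N.+1 -> R) (u : 'I_N -> 'rV[R]_N.+1 -> R)
  (T : 'rV[R]_N.+1 -> R) (rho_m T_m : R).
Notation ST := 'rV[R]_N.+1.
Hypotheses (N0 : (0 < N)%N) (mu0 : 0 < mu) (kappa0 : 0 < kappa).
Hypotheses (Crho : Cb rho) (Cu : forall i, Cb (u i)) (CT : Cb T).
Hypothesis eqs : forall z, Ut z -> NSF_at mu kappa rho u T z.
Hypothesis norms : forall t : R, 0 < t ->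
     [/\ space_int rho t = 1,
         (forall j, space_int (fun w => rho w * u j w) t = 0) &
         space_int (fun w => rho w * usq u w / 2) t
           + N%:R / 2 * space_int (fun w => rho w * T w) t = N%:R / 2].
Hypotheses (rm0 : 0 < rho_m) (Tm0 : 0 < T_m).
Hypothesis low : forall z, Ut z -> rho_m <= rho z /\ T_m <= T z.

Let nrho : nice rho := Cb_nice Crho.
Let nu i : nice (u i) := Cb_nice (Cu i).
Let nT : nice T := Cb_nice CT.
Let rho0 z : Ut z -> 0 < rho z. Proof. by move=> /low[h _]; exact: lt_le_trans h. Qed.
Let T0 z : Ut z -> 0 < T z. Proof. by move=> /low[_ h]; exact: lt_le_trans h. Qed.
Let N0r : 0 < N%:R :> R. Proof. by rewrite ltr0n. Qed.

Definition En (t : R) : R := space_int (ent rho T) t.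
Definition qq : ST -> R := fun w => (rho w - 1) ^+ 2 + (usq u w + (T w - 1) ^+ 2).
Definition Q (t : R) : R := space_int qq t.

(** [ent] plus a constant and multiples of the mass and energy densities, of total integral zero by
    the normalization. In the form [ent_relE] each term is nonnegative for positive [rho] and [T],
    and of second order at equilibrium. *)
Definition ent_rel : ST -> R := fun w => ent rho T w
  + ((1 + rho w * usq u w / 2) + (N%:R / 2 * (rho w * T w) - (1 + N%:R / 2) * rho w)).

Let nent : nice (ent rho T). Proof. exact: nice_ent. Qed.
Let nusq : nice (usq u). Proof. exact: nice_usq. Qed.

Lemma nice_qq : nice qq. Proof. by rewrite /qq; nice. Qed.

Lemma nice_ent_rel : nice ent_rel. Proof. by rewrite /ent_rel; nice. Qed.

Lemma ent_relE w : ent_rel w = (rho w * ln (rho w) - rho w + 1)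
  + (rho w * usq u w / 2 + N%:R / 2 * (rho w * (T w - 1 - ln (T w)))).
Proof. by rewrite /ent_rel /ent; ring. Qed.

Lemma int_ent_rel t : 0 < t -> space_int ent_rel t = En t.
Proof.
move=> t0; have [r1 _ en] := norms t0.
have n1 : nice (fun w => rho w * usq u w / 2) by nice.
have n2 : nice (fun w => rho w * T w) by nice.
rewrite /ent_rel (siD t0 nent (niceD (niceD (nice_cst 1) n1)
  (niceD (niceM (nice_cst _) n2) (niceN (niceM (nice_cst _) nrho))))).
rewrite (siD t0 (niceD (nice_cst 1) n1)
  (niceD (niceM (nice_cst _) n2) (niceN (niceM (nice_cst _) nrho)))).
rewrite (siD t0 (nice_cst 1) n1) (siB t0 (niceM (nice_cst _) n2) (niceM (nice_cst _) nrho)).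
rewrite (siZ t0 _ n2) (siZ t0 _ nrho) r1 si_cst -/(En t).
by move: en; move: (space_int _ t) (space_int _ t) (En t) => x y e; lra.
Qed.

Lemma En_lower : exists2 c, 0 < c & forall t, 0 < t -> c * Q t <= En t.
Proof.
have [K1 K10 hK1] := Cb_bnd Crho; have [K2 K20 hK2] := Cb_bnd CT.
pose c1 := (2 * K1 + 2)^-1; pose c2 := rho_m / 2.
pose c3 := N%:R / 2 * (rho_m * (2 * K2 + 2)^-1).
have c10 : 0 < c1 by rewrite invr_gt0; lra.
have c20 : 0 < c2 by rewrite divr_gt0.
have c30 : 0 < c3 by rewrite mulr_gt0 ?mulr_gt0 ?divr_gt0 ?invr_gt0//; lra.
exists (Num.min c1 (Num.min c2 c3)); first by rewrite !lt_min c10 c20.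
move=> t t0; rewrite -int_ent_rel// -(siZ t0 _ nice_qq).
apply: (le_si t0 (niceM (nice_cst _) nice_qq) nice_ent_rel) => w Uw.
have [hr hT] := low Uw; have r0 := rho0 Uw; have tt0 := T0 Uw.
have r1 : rho w <= K1 by exact: le_trans (ler_norm _) (hK1 _ Uw).
have t1 : T w <= K2 by exact: le_trans (ler_norm _) (hK2 _ Uw).
set c := Num.min _ _.
have cc1 : c <= c1 by rewrite ge_min lexx.
have cc2 : c <= c2 by rewrite !ge_min lexx orbT.
have cc3 : c <= c3 by rewrite !ge_min lexx !orbT.
rewrite ent_relE /qq 2!(mulrDr c); apply: lerD; last apply: lerD.
- apply: (le_trans (ler_wpM2r (sqr_ge0 _) cc1)).
  by rewrite /c1 mulrC; exact: xlnx_lower.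
- have q0 := usq_ge0 u w.
  apply: (le_trans (ler_wpM2r q0 cc2)); rewrite /c2 mulrAC.
  by rewrite ler_pM2r ?invr_gt0//; exact: ler_wpM2r.
- apply: (le_trans (ler_wpM2r (sqr_ge0 _) cc3)).
  rewrite (_ : c3 * _ = N%:R / 2 * (rho_m * ((T w - 1) ^+ 2 / (2 * K2 + 2)))); last first.
    by rewrite /c3; ring.
  apply: ler_wpM2l; first by rewrite divr_ge0// ltW.
  apply: ler_pM => //; [exact: ltW| |exact: subr_ln_lower].
  by rewrite divr_ge0 ?sqr_ge0//; lra.
Qed.

Lemma En_upper : exists2 C, 0 <= C & forall t, 0 < t -> En t <= C * Q t.
Proof.
have [K1 K10 hK1] := Cb_bnd Crho.
pose c3 := N%:R / 2 * (K1 * T_m^-1).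
have c30 : 0 <= c3 by rewrite mulr_ge0 ?mulr_ge0 ?invr_ge0// ltW.
exists (1 + (K1 + c3)); first by lra.
move=> t t0; rewrite -int_ent_rel// -(siZ t0 _ nice_qq).
apply: (le_si t0 nice_ent_rel (niceM (nice_cst _) nice_qq)) => w Uw.
have [hr hT] := low Uw; have r0 := rho0 Uw; have tt0 := T0 Uw.
have r1 : rho w <= K1 by exact: le_trans (ler_norm _) (hK1 _ Uw).
set c := 1 + _.
have q0 := usq_ge0 u w.
rewrite ent_relE /qq 2!(mulrDr c); apply: lerD; last apply: lerD.
- apply: (le_trans (xlnx_upper r0)); rewrite ler_peMl ?sqr_ge0// /c; lra.
- have h1 : rho w * usq u w <= K1 * usq u w by apply: ler_wpM2r.
  have h2 : K1 * usq u w <= c * usq u w by apply: ler_wpM2r => //; rewrite /c; lra.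
  have h3 : 0 <= K1 * usq u w by rewrite mulr_ge0.
  move: h1 h2 h3; move: (rho w * _) (K1 * _) (c * _) => x y z; lra.
- apply: (@le_trans _ _ (c3 * (T w - 1) ^+ 2)); last first.
    by apply: ler_wpM2r; [exact: sqr_ge0|rewrite /c; lra].
  rewrite (_ : c3 * _ = N%:R / 2 * (K1 * (T_m^-1 * (T w - 1) ^+ 2))); last first.
    by rewrite /c3; ring.
  apply: ler_wpM2l; first by rewrite divr_ge0// ltW.
  apply: ler_pM => //; [exact: ltW| |exact: subr_ln_upper].
  by rewrite subr_ge0; exact: ln_le_subr1.
Qed.

Variable P : nat.
Local Notation G1 := (maj1 u T P).
Local Notation G3 := (maj3 rho u T P).
Local Notation aa := (heat_strain_sq u T).
Local Notation bb := (div_sq u).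
Local Notation rr := (grad_rho_sq rho).

Lemma Q_dom : dom (fun _ => Q) G3.
Proof.
have n1 : nice (fun w => (rho w - 1) ^+ 2) by nice.
have n2 : nice (fun w => (T w - 1) ^+ 2) by nice.
have nu2 i : nice (fun w => u i w ^+ 2) by exact: niceX.
have [C C0 hC] : dom (fun _ t => space_int (fun w => (rho w - 1) ^+ 2) t +
   (\sum_(i < N) space_int (fun w => u i w ^+ 2) t + space_int (fun w => (T w - 1) ^+ 2) t)) G3.
  apply: domD; first exact: (O_rho1 Crho Cu CT norms P).2.
  apply: domD; last exact: (O_T1 N0 Crho Cu CT norms P).2.
  apply: dom_sum => i; have [_ d] := O_u N0 Crho Cu CT norms P i.
  exact: dom_trans d (dom_maj23 Crho Cu CT P).
exists C => // eta t he t0; apply: le_trans (hC _ _ he t0).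
by rewrite /Q /qq (siD t0 n1 (niceD nusq n2)) (siD t0 nusq n2) (si_sum t0 _ nu2).
Qed.

Lemma dt_entropy_le : exists2 c, 0 < c & forall t, 0 < t -> space_int (dt (ent rho T)) t <= - c * aa t.
Proof.
have [K K0 hK] := Cb_bnd CT.
have K1 : 0 < K + 1 by lra.
pose c1 := 2 * mu / (K + 1); pose c2 := N%:R / 2 * kappa / (K + 1) ^+ 2.
have c10 : 0 < c1 by rewrite divr_gt0// mulr_gt0.
have c20 : 0 < c2 by rewrite divr_gt0 ?exprn_gt0// mulr_gt0// divr_gt0.
exists (Num.min c1 c2); first by rewrite lt_min c10.
set c := Num.min _ _.
have cc1 : c <= c1 by rewrite ge_min lexx.
have cc2 : c <= c2 by rewrite ge_min lexx orbT.
move=> t t0; rewrite (int_dt_ent N0 nrho nu nT eqs rho0 T0 t0) mulNr lerN2 /heat_strain_sq mulrDr addrC.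
have nS := nice_strain_sq nu; have niT := nice_invT nT T0.
have ndT i : nice (fun w => dx i T w ^+ 2) by exact/niceX/nice_dx.
have S0 w : 0 <= strain_sq u w.
  by apply: sumr_ge0 => i _; apply: sumr_ge0 => j _; exact: sqr_ge0.
have iT w : Ut w -> (K + 1)^-1 <= (T w)^-1.
  move=> Uw; rewrite lef_pV2 ?posrE ?T0//.
  by apply: (le_trans (le_trans (ler_norm _) (hK _ Uw))); rewrite lerDl.
apply: lerD.
  have i0 : 0 <= space_int (strain_sq u) t by exact: si_ge0.
  apply: (le_trans (ler_wpM2r i0 cc1)).
  rewrite (_ : c1 * _ = 2 * mu * ((K + 1)^-1 * space_int (strain_sq u) t)); last first.
    by rewrite /c1; ring.
  apply: ler_wpM2l; first by rewrite mulr_ge0// ltW.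
  rewrite -(siZ t0 _ nS); apply: (le_si t0 (niceM (nice_cst _) nS) (niceM nS niT)) => w Uw.
  by rewrite mulrC; apply: ler_wpM2l; [exact: S0|exact: iT].
have i0 : 0 <= \sum_(i < N) space_int (fun w => dx i T w ^+ 2) t.
  by apply: sumr_ge0 => i _; apply: (si_ge0 t0 (ndT i)) => w _; exact: sqr_ge0.
apply: (le_trans (ler_wpM2r i0 cc2)).
rewrite (_ : c2 * _ = N%:R / 2 * kappa * ((K + 1) ^- 2
   * \sum_(i < N) space_int (fun w => dx i T w ^+ 2) t)); last by rewrite /c2; ring.
apply: ler_wpM2l; first by rewrite mulr_ge0 ?divr_ge0// ltW.
rewrite mulr_sumr; apply: ler_sum => i _.
rewrite -(siZ t0 _ (ndT i)).
apply: (le_si t0 (niceM (nice_cst _) (ndT i)) (niceM (ndT i) (niceX 2 niT))) => w Uw.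
rewrite mulrC; apply: ler_wpM2l; first exact: sqr_ge0.
by rewrite -exprVn ler_pXn2r ?nnegrE ?invr_ge0 ?iT// ltW// T0.
Qed.

(** The analogue of [maj1] with [Q] in place of the dissipation: it measures the cross functionals
    themselves rather than their time derivatives. *)
Definition GQ (eta t : R) : R := eta^-1 * Q t + eta ^+ P.

Lemma Q_ge0 t : 0 < t -> 0 <= Q t.
Proof.
move=> t0; apply: (si_ge0 t0 nice_qq) => w _.
by rewrite !addr_ge0 ?sqr_ge0 ?usq_ge0.
Qed.

Lemma nng_GQ : nng GQ.
Proof.
move=> eta t /andP[e0 _] t0; rewrite addr_ge0 ?exprn_ge0 ?(ltW e0)//.
by rewrite mulr_ge0 ?invr_ge0 ?Q_ge0// ltW.
Qed.

Lemma sqint_le_Q f : nice f -> (forall w, f w ^+ 2 <= qq w) -> forall t, 0 < t ->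
  space_int (fun w => f w ^+ 2) t <= Q t.
Proof. by move=> nf h t t0; apply: (le_si t0 (niceX 2 nf) nice_qq) => w _; exact: h. Qed.

Lemma O_dx_GQ i f : Cb f -> (forall w, f w ^+ 2 <= qq w) -> sqO (dx i f) GQ.
Proof.
move=> Cf h; have nf := Cb_nice Cf; split; first exact: nice_dx.
have [C C0 hC] := Cb_interp i P Cf; exists C => // eta t he t0.
apply: (le_trans (hC _ _ he t0)); apply: ler_wpM2l => //.
rewrite /GQ lerD2r; apply: ler_wpM2l; last exact: sqint_le_Q.
by rewrite invr_ge0 ltW//; case/andP: he.
Qed.

Lemma u_le_qq i w : u i w ^+ 2 <= qq w.
Proof.
apply: (@le_trans _ _ (usq u w)).
  by apply: (@ler_sum1 _ _ (fun i => u i w ^+ 2)) => j; exact: sqr_ge0.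
rewrite /qq; have := sqr_ge0 (rho w - 1); have := sqr_ge0 (T w - 1).
by move: (_ ^+ 2) (_ ^+ 2) (usq u w) => a b c; lra.
Qed.

Lemma O_u_GQ i : sqO (u i) GQ.
Proof.
split=> //; exists 1 => // eta t he t0; rewrite mul1r.
apply: (le_trans (sqint_le_Q (nu i) (u_le_qq i) t0)).
have /andP[e0 e1] := he.
rewrite /GQ -[leLHS]addr0 lerD// ?exprn_ge0 ?(ltW e0)//.
by rewrite ler_peMl ?Q_ge0// invf_ge1.
Qed.

Lemma O_dx_shift_GQ i f : Cb f -> (forall w, (f w - 1) ^+ 2 <= qq w) -> sqO (dx i f) GQ.
Proof.
move=> Cf h; have C1 : Cb (fun w => 1 * f w + (-1) * (fun=> 1) w).
  exact: (Cb_lin 1 (-1) Cf (@Cb_cst R N 1)).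
have := O_dx_GQ i C1; set g := (fun w => _) => hg.
have h' w : g w ^+ 2 <= qq w by rewrite /g mul1r mulN1r.
have nf := Cb_nice Cf.
apply: sqO_eq (hg h'); first exact: nice_dx.
move=> w Uw; rewrite /dx /g (pdD _ Uw); [|exact: niceM (nice_cst _) nf|exact: nice_cst].
by rewrite (pdZ _ Uw _ nf) pd_cst mul1r addr0.
Qed.

Lemma adv_bound f : (forall i, sqO (dx i f) GQ) ->
  dom (fun _ t => `|space_int (advection u f) t|) GQ.
Proof.
move=> Of.
have [C C0 hC] : dom (fun eta t => \sum_(i < N)
    (`|space_int (fun w => u i w * dx i f w) t| - 1 * GQ eta t)) GQ.
  by apply: dom_sum => i; exact: (young_dom nng_GQ nng_GQ (O_u_GQ i) (Of i) ltr01).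
exists (C + N%:R); first by rewrite addr_ge0// ltW.
move=> eta t he t0; have := hC _ _ he t0.
rewrite sumrB sumr_const card_ord -[(1 * _) *+ N]mulr_natl mul1r lerBlDr -mulrDl.
move=> h; apply: le_trans h.
have n1 i : nice (fun w => u i w * dx i f w).
  by apply: niceM; [exact: nu|case: (Of i)].
rewrite /advection (si_sum t0 _ n1); exact: ler_norm_sum.
Qed.

Lemma int_advT_bound : dom (fun _ t => `|space_int (advection u T) t|) GQ.
Proof.
apply: adv_bound => i; apply: O_dx_shift_GQ => // w.
rewrite /qq; have := sqr_ge0 (rho w - 1); have := usq_ge0 u w.
by move: (_ ^+ 2) (_ ^+ 2) (usq u w) => a b c; lra.
Qed.

Lemma int_advrho_bound : dom (fun _ t => `|space_int (advection u rho) t|) GQ.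
Proof.
apply: adv_bound => i; apply: O_dx_shift_GQ => // w.
rewrite /qq; have := sqr_ge0 (T w - 1); have := usq_ge0 u w.
by move: (_ ^+ 2) (_ ^+ 2) (usq u w) => a b c; lra.
Qed.

(** The order of choice avoids circularity: [C2] does not depend on [y], so [C2] fixes [k], then [k]
    fixes [y], [y] yields [C1], and [eps] and [m] come last. None depends on [eta]. *)
Lemma lyapunov_estimates : exists eps k c C : R, [/\ 0 < c, 0 <= C &
  forall eta t, 0 < eta <= 1 -> 0 < t ->
   space_int (dt (ent rho T)) t
     - eps * eta * (space_int (dt (advection u T)) t - k * space_int (dt (advection u rho)) t)
     <= - c * (eta * En t) + C * eta ^+ P.+1 /\
   `|eps * eta * (space_int (advection u T) t - k * space_int (advection u rho) t)|
     <= En t / 2 + eta ^+ P.+1].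
Proof.
have [c0 c00 hE] := dt_entropy_le; have [c2 [C2 [c20 C20 hM2]]] := dt_int_advrho_le N0 Crho Cu CT eqs rm0 Tm0 low P.
pose c1 := 2 / N%:R * T_m; have c10 : 0 < c1 by rewrite mulr_gt0// divr_gt0.
pose k := c1 / (4 * (C2 + 1)).
have k0 : 0 < k by rewrite divr_gt0//; lra.
pose y := Num.min (c1 / 4) (k * c2 / 2).
have y0 : 0 < y by rewrite lt_min !divr_gt0// mulr_gt0.
have yc1 : y <= c1 / 4 by rewrite ge_min lexx.
have yc2 : y <= k * c2 / 2 by rewrite ge_min lexx orbT.
have [C1 C10 hM1] := dt_int_advT_ge N0 Crho Cu CT eqs rm0 low P y0.
have [CE CE0 hCE] := En_upper; have [CQ CQ0 hCQ] := Q_dom.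
have [cl cl0 hcl] := En_lower; have [B1 B10 hB1] := int_advT_bound; have [B2 B20 hB2] := int_advrho_bound.
pose D := CE * CQ; have D0 : 0 <= D by rewrite mulr_ge0.
pose CM := B1 + k * B2; have CM0 : 0 <= CM by rewrite addr_ge0// mulr_ge0// ltW.
pose C3 := C1 + k * C2; have C30 : 0 <= C3 by rewrite addr_ge0// mulr_ge0// ltW.
pose c3 := Num.min (c1 / 2) (k * c2 / 2).
have c30 : 0 < c3 by rewrite lt_min !divr_gt0// mulr_gt0.
have c3c1 : c3 <= c1 / 2 by rewrite ge_min lexx.
have c3c2 : c3 <= k * c2 / 2 by rewrite ge_min lexx orbT.
(* Three requirements: the dissipation absorbs the cost of the cross terms ([e1]), their size is at
   most half of the entropy ([e2]), and the remainder has coefficient at most 1 ([e3]). *)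
pose eps := Num.min (c0 / (2 * (C3 + 1))) (Num.min (cl / (2 * (CM + 1))) (CM + 1)^-1).
have eps0 : 0 < eps by rewrite !lt_min !divr_gt0 ?invr_gt0//; lra.
have e1 : eps * C3 <= c0 / 2.
  apply: (@le_trans _ _ (c0 / (2 * (C3 + 1)) * C3)).
    by apply: ler_wpM2r => //; rewrite ge_min lexx.
  exact: div_succ_mul_le (ltr0n _ 2) (ltW c00) C30.
have e2 : eps * CM <= cl / 2.
  apply: (@le_trans _ _ (cl / (2 * (CM + 1)) * CM)).
    by apply: ler_wpM2r => //; rewrite !ge_min lexx orbT.
  exact: div_succ_mul_le (ltr0n _ 2) (ltW cl0) CM0.
have e3 : eps * CM <= 1.
  apply: (@le_trans _ _ ((CM + 1)^-1 * CM)).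
    by apply: ler_wpM2r => //; rewrite !ge_min lexx !orbT.
  by rewrite mulrC ler_pdivrMr ?mul1r ?lerDl// ltr_wpDl.
have kC2 : k * C2 <= c1 / 4.
  exact: div_succ_mul_le (ltr0n _ 4) (ltW c10) C20.
pose m := Num.min (c0 / 2) (eps * c3).
have m0 : 0 < m by rewrite lt_min divr_gt0//= mulr_gt0.
have mc0 : m <= c0 / 2 by rewrite ge_min lexx.
have mc3 : m <= eps * c3 by rewrite ge_min lexx orbT.
have D1 : 0 < D + 1 by rewrite ltr_wpDl.
exists eps, k, (m / (D + 1)), (m + eps * C3).
split; [by rewrite divr_gt0|by rewrite addr_ge0 ?mulr_ge0// ltW|].
move=> eta t he t0; have /andP[eta0 eta1] := he.
have a0 : 0 <= aa t by exact: heat_strain_sq_ge0.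
have b0 : 0 <= bb t by exact: div_sq_ge0.
have r0 : 0 <= rr t by exact: grad_rho_sq_ge0.
pose e := eta ^+ P.+1; have pe0 : 0 <= e by rewrite exprn_ge0// ltW.
(* The prefactor [eta] cancels the [1 / eta] of interpolation, so that [aa] appears with a
   coefficient uniform in [eta]. *)
have eG1 : eta * G1 eta t = aa t + e.
  by rewrite /maj1 mulrDr mulrA mulfV ?gt_eqF// mul1r -exprS.
have Q0 := Q_ge0 t0.
have eGQ : eta * GQ eta t = Q t + e.
  by rewrite /GQ mulrDr mulrA mulfV ?gt_eqF// mul1r -exprS.
split; last first.
  have h1 := hB1 _ _ he t0; have h2 := hB2 _ _ he t0.
  have h : `|space_int (advection u T) t - k * space_int (advection u rho) t| <= CM * GQ eta t.
    apply: (le_trans (ler_normB _ _)); rewrite normrM (gtr0_norm k0) /CM [leRHS]mulrDl.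
    apply: lerD => //; rewrite -[leRHS]mulrA.
    exact: (ler_wpM2l (ltW k0) h2).
  rewrite normrM (gtr0_norm (mulr_gt0 eps0 eta0)).
  apply: (le_trans (ler_wpM2l (ltW (mulr_gt0 eps0 eta0)) h)).
  rewrite (_ : _ * _ = eps * CM * (eta * GQ eta t)); last by ring.
  rewrite eGQ mulrDr; apply: lerD.
    apply: (le_trans (ler_wpM2r Q0 e2)).
    by rewrite mulrAC ler_pM2r ?invr_gt0//; exact: hcl.
  by rewrite -[leRHS]mul1r; apply: ler_wpM2r.
have h1 := hM1 _ _ he t0; have h2 := hM2 _ _ he t0; have h3 := hE t t0.
have g0 : 0 <= G1 eta t by apply: nng_maj1.
have s1 : c3 * (bb t + rr t) - C3 * G1 eta t <=
   space_int (dt (advection u T)) t - k * space_int (dt (advection u rho)) t.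
  exact: (combine_cross_terms (ltW k0) b0 r0 kC2 yc1 yc2 c3c1 c3c2 h1 h2).
have s2 := ler_wpM2l (ltW (mulr_gt0 eps0 eta0)) s1.
have s3 : eta * En t <= D * (aa t + e + eta * (bb t + rr t)).
  have := ler_wpM2l CE0 (hCQ _ _ he t0); rewrite mulrA -/D => hD.
  have h := le_trans (hCE t t0) hD.
  apply: (le_trans (ler_wpM2l (ltW eta0) h)).
  by rewrite mulrCA /maj3 /maj2 -addrA mulrDr eG1.
have w1 : 0 <= eta * (bb t + rr t) by exact: mulr_ge0 (ltW eta0) (addr_ge0 b0 r0).
have s4 : m / (D + 1) * (eta * En t) <= m * (aa t + e + eta * (bb t + rr t)).
  have w0 : 0 <= aa t + e + eta * (bb t + rr t).
    exact: addr_ge0 (addr_ge0 a0 pe0) w1.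
  rewrite mulrAC ler_pdivrMr// -mulrA; apply: ler_wpM2l; first exact: ltW.
  by apply: (le_trans s3); rewrite mulrC ler_wpM2l// lerDl.
rewrite -/e.
have s2' : eps * c3 * (eta * (bb t + rr t)) - eps * C3 * (aa t + e) <=
   eps * eta * (space_int (dt (advection u T)) t - k * space_int (dt (advection u rho)) t).
  apply: le_trans s2; rewrite -eG1 le_eqVlt; apply/orP; left; apply/eqP; ring.
rewrite mulNr; exact: (combine_lyapunov a0 w1 mc0 mc3 e1 h3 s2' s4).
Qed.

Lemma En_ge0 t : 0 < t -> 0 <= En t.
Proof.
move=> t0; have [c c0 h] := En_lower.
by apply: le_trans (h t t0); rewrite mulr_ge0 ?Q_ge0// ltW.
Qed.

Lemma En_decay : exists c C : R, [/\ 0 < c, 0 <= C &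
  forall eta t, 0 < eta <= 1 -> 1 <= t ->
    En t <= C * (expR (- (c * eta * (t - 1))) + eta ^+ P)].
Proof.
have [eps [k [c [C [c0 C0 H]]]]] := lyapunov_estimates.
(* [L <= 3 / 2 E + e] turns the rate [c] in front of [E] into [2 c / 3] in front of [L]. *)
pose c' := 2 / 3 * c; have c'0 : 0 < c' by rewrite mulr_gt0// divr_gt0.
have En1 := En_ge0 (ltr01 : 0 < 1).
pose A := 1 + C / c'; have A0 : 0 <= A by rewrite addr_ge0// divr_ge0// ltW.
exists c', (3 * En 1 + 2 * A + 2); split=> //; first by lra.
move=> eta t he t1; have /andP[eta0 eta1] := he.
have t0 : 0 < t by exact: lt_le_trans t1.
(* [eta] is frozen along the evolution: [L] depends on it, the constants [c'], [A] and [En 1] of the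
   bound do not. *)
pose L s := En s - eps * eta * (space_int (advection u T) s - k * space_int (advection u rho) s).
pose L' s := space_int (dt (ent rho T)) s
     - eps * eta * (space_int (dt (advection u T)) s - k * space_int (dt (advection u rho)) s).
have dL (s : R) : 0 < s -> is_derive s 1 L (L' s).
  move=> s0; have d1 := si_dt s0 nent.
  have d2 := si_dt s0 (nice_advection nu nT); have d3 := si_dt s0 (nice_advection nu nrho).
  exact: (is_deriveB d1 (is_deriveZ (eps * eta) (is_deriveB d2 (is_deriveZ k d3)))).
pose e := eta ^+ P.+1; pose p := eta ^+ P.
have p0 : 0 <= p by rewrite exprn_ge0// ltW.
have ep : e = eta * p by rewrite /e exprS.
have e0 : 0 <= e by rewrite ep mulr_ge0// ltW.
have elep : e <= p by rewrite ep ler_piMl.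
have bL s : 0 < s -> En s / 2 - e <= L s <= 3 / 2 * En s + e.
  move=> s0; have [_] := H eta s he s0; rewrite ler_norml -/e /L.
  by move: (eps * eta * _) (En s) => x z /andP[h1 h2]; apply/andP; split; lra.
have k0 : 0 < c' * eta by rewrite mulr_gt0.
have hL s : 0 < s -> L' s <= - (c' * eta) * L s + c' * eta * (e + C / c' * p).
  move=> s0; have [h _] := H eta s he s0; rewrite -/(L' s) -/e in h.
  have /andP[_ hs] := bL s s0.
  have := ler_wpM2l (ltW k0) hs.
  have E1 : c' * eta * (3 / 2 * En s + e) = c * (eta * En s) + c' * eta * e.
    by rewrite /c'; field.
  have E2 : c' * eta * (e + C / c' * p) = c' * eta * e + C * e.
    by rewrite ep; field; rewrite gt_eqF.
  rewrite E1 E2 => hk; apply: (le_trans h); rewrite !mulNr addrA lerD2r.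
  by rewrite addrC lerBrDr addrC lerBlDr addrC.
have G := gronwall k0 dL hL t1.
have Mp : e + C / c' * p <= A * p by rewrite /A mulrDl mul1r lerD2r.
have M0 : 0 <= C / c' * p by rewrite mulr_ge0// divr_ge0// ltW.
have ex0 := expR_ge0 (- (c' * eta * (t - 1))).
set ex := expR _ in G ex0 *.
have /andP[_ h1] := bL 1 ltr01; have /andP[h2 _] := bL t t0.
have q1 : (L 1 - (e + C / c' * p)) * ex <= 3 / 2 * En 1 * ex.
  by apply: ler_wpM2r => //; rewrite lerBlDr addrA (le_trans h1)// lerDl.
exact: (combine_decay G q1 h2 (mulr_ge0 A0 ex0) (mulr_ge0 En1 p0) Mp elep ex0).
Qed.

End Lyapunov.

(** * From entropy decay to pointwise decay of all derivatives *)

Section FastDecay.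
Variables (R : realType) (N : nat).
Notation ST := 'rV[R]_N.+1.
Implicit Types (f : ST -> R) (i : 'I_N).

Lemma exp_to_power (F : R -> R) :
  (forall P : nat, exists c C : R, [/\ 0 < c, 0 <= C &
    forall eta t, 0 < eta <= 1 -> 1 <= t ->
      F t <= C * (expR (- (c * eta * (t - 1))) + eta ^+ P)]) ->
  forall m : nat, exists2 C, 0 <= C & forall t, 2 <= t -> F t <= C * t ^- m.
Proof.
(* With [eta = t^(-1/2)] the remainder of order [2 m] is exactly [t^(-m)]. *)
move=> H m; have [c [C [c0 C0 h]]] := H (2 * m)%N.
pose A := (2 * m).+1%:R ^+ (2 * m).+1 / (c / 2) ^+ (2 * m).+1.
have c20 : 0 < c / 2 by rewrite divr_gt0.
have A0 : 0 <= A by rewrite divr_ge0 ?exprn_ge0// ltW.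
exists (C * (A + 1)); first by rewrite mulr_ge0// addr_ge0.
move=> t t2; have t0 : 0 < t by lra.
pose s := Num.sqrt t.
have ts : t = s ^+ 2 by rewrite sqr_sqrtr// ltW.
have s0 : 0 < s by rewrite sqrtr_gt0.
have s1 : 1 <= s by rewrite -sqrtr1 ler_wsqrtr//; lra.
have es : 0 < s^-1 <= 1 by rewrite invr_gt0 s0/= invf_le1.
have t1 : 1 <= t by lra.
apply: (le_trans (h _ _ es t1)); rewrite -[leRHS]mulrA; apply: ler_wpM2l => //.
have tm : t ^- m = s^-1 ^+ (2 * m) by rewrite ts -exprM exprVn.
rewrite tm [leRHS]mulrDl mul1r lerD2r -tm.
have x0 : 0 < c / 2 * s by rewrite mulr_gt0.
(* [t >= 2] gives [t - 1 >= t / 2]. *)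
have le1 : c / 2 * s <= c * s^-1 * (t - 1).
  rewrite -subr_ge0.
  have -> : c * s^-1 * (t - 1) - c / 2 * s = c / 2 * s^-1 * (t - 2).
    by rewrite ts; field; rewrite gt_eqF.
  by rewrite mulr_ge0 ?subr_ge0// mulr_ge0// ltW// invr_gt0.
apply: (@le_trans _ _ (expR (- (c / 2 * s)))); first by rewrite ler_expR lerN2.
apply: (le_trans (expRN_le (2 * m) x0)).
rewrite exprMn invfM mulrA -/A; apply: ler_wpM2l => //.
rewrite ts -exprM lef_pV2 ?posrE ?exprn_gt0//.
by rewrite ler_weXn2l.
Qed.

Definition fast2 f := forall m : nat, exists2 C, 0 <= C &
  forall t, 2 <= t -> space_int (fun w => f w ^+ 2) t <= C * t ^- m.

(** Interpolation with [P = 1] and [eta = t^(-m)], fed with the decay of [f] at order [2 m]. Half of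
    the exponent is lost, which is harmless as [m] is arbitrary. *)
Lemma fast2_dx i f : Cb f -> fast2 f -> fast2 (dx i f).
Proof.
move=> Cf Ff m; have [C C0 hC] := Cb_interp i 1 Cf; have [D D0 hD] := Ff (m + m)%N.
exists (C * (D + 1)); first by rewrite mulr_ge0// addr_ge0.
move=> t t2; have t0 : 0 < t by lra.
have e0 : 0 < t ^- m by rewrite invr_gt0 exprn_gt0.
have e1 : t ^- m <= 1 by rewrite invf_le1 ?exprn_gt0// exprn_ege1//; lra.
have he : 0 < t ^- m <= 1 by rewrite e0.
apply: (le_trans (hC _ _ he t0)); rewrite -[leRHS]mulrA; apply: ler_wpM2l => //.
rewrite expr1 mulrDl mul1r lerD2r invrK.
have := ler_wpM2l (ltW (exprn_gt0 m t0)) (hD t t2).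
by rewrite mulrCA exprD invfM mulVKf// gt_eqF// exprn_gt0.
Qed.

Lemma Cb_pds js f : Cb f -> Cb (pds [seq xc i | i <- js] f).
Proof. by move=> Cf; elim: js => //= i js IH; exact: Cb_dx. Qed.

Lemma fast2_pds js f : Cb f -> fast2 f -> fast2 (pds [seq xc i | i <- js] f).
Proof.
move=> Cf Ff; elim: js => //= i js IH.
by apply: fast2_dx => //; exact: Cb_pds.
Qed.

Lemma fast2_sup f (beta : R) : Cb f -> fast2 f -> exists2 C, 0 <= C &
  forall z, 2 <= time z -> `|f z| <= C * time z `^ (- beta).
Proof.
move=> Cf Ff; have nf := Cb_nice Cf.
have [K K0 hK] := Cb_bnd Cf.
have /boolp.choice[B hB] : forall i, exists b : R, 0 <= b /\
    forall w, Ut w -> `|dx i f w| <= b.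
  by move=> i; have [b b0 h] := Cb_bnd (Cb_dx i Cf); exists b.
pose L := \sum_(i < N) 2 * (K * B i).
have B0 i : 0 <= 2 * (K * B i) by rewrite !mulr_ge0//; case: (hB i).
have L0 : 0 <= L by exact: sumr_ge0.
(* [si_sup] raises [f^2] to the power [2^N], so [|f|] appears with exponent [2^(N+1)]; the L2 decay
   is then used at an integer order [m] above [beta n]. *)
pose n := (2 ^ N.+1)%N.
pose m := Num.bound (`|beta * n%:R|).
have [C C0 hC] := Ff m.
pose c := 1 + K ^+ 2 + 2 * L.
have c0 : 0 < c by have := sqr_ge0 K; rewrite /c; lra.
pose A := c ^+ (2 ^ N) * (C / c).
have A0 : 0 <= A by rewrite mulr_ge0 ?exprn_ge0 ?divr_ge0// ltW.
(* As [A + 1 >= 1], its [n]-th power still dominates [A]. *)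
exists (A + 1); first by rewrite addr_ge0.
move=> z t2; set t := time z in t2 *; have t0 : 0 < t by lra.
have Uz : Ut z by exact: t0.
have hsup : (f z ^+ 2 / c) ^+ (2 ^ N) <= space_int (fun w => f w ^+ 2) t / c.
  apply: (si_sup (niceX 2 nf) Uz (sqr_ge0 K) L0).
    move=> w Uw; rewrite sqr_ge0/= -real_normK ?num_real//.
    by rewrite ler_pXn2r ?nnegrE// hK.
  move=> i w Uw; rewrite /dx (pdX2 _ Uw nf) !normrM ger0_norm//.
  apply: (@le_trans _ _ (2 * (K * B i))).
    by apply: ler_wpM2l => //; apply: ler_pM => //; [exact: hK|exact: (hB i).2].
  exact: (@ler_sum1 _ _ (fun i => 2 * (K * B i))).
have pA : `|f z| ^+ n <= A * t ^- m.
  rewrite /n expnS exprM real_normK ?num_real//.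
  move: hsup; rewrite exprMn exprVn ler_pdivrMr ?exprn_gt0// => h; apply: (le_trans h).
  rewrite mulrC /A -!mulrA; apply: ler_wpM2l; first by rewrite exprn_ge0// ltW.
  by rewrite [leRHS]mulrCA [leRHS]mulrC ler_pM2r ?invr_gt0// hC.
have n0 : (0 < n)%N by rewrite expn_gt0.
have pw : t ^- m <= (t `^ (- beta)) ^+ n.
  rewrite -[leRHS]powR_mulrn ?powR_ge0// -powRrM -powR_invn; last exact: ltW.
  apply: ler_powR; first by lra.
  rewrite mulNr lerN2; apply: ltW; apply: le_lt_trans (ler_norm _) _.
  exact: archi_boundP.
have pb0 : 0 <= t `^ (- beta) by exact: powR_ge0.
rewrite -(@ler_pXn2r _ n) ?nnegrE ?mulr_ge0 ?addr_ge0//.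
apply: (le_trans pA); rewrite exprMn; apply: ler_pM => //.
  by rewrite invr_ge0 exprn_ge0// ltW.
apply: (@le_trans _ _ (A + 1)); first by rewrite lerDl.
by rewrite ler_eXnr// lerDr.
Qed.

(** The constant has to serve all multi-indices of length at most [k]; these are finitely many, so
    their constants are summed. *)
Lemma fast2_Ck_decay f : Cb f -> fast2 f -> Ck_decay_fast f.
Proof.
move=> Cf Ff k beta _.
have /boolp.choice[B hB] : forall js : seq 'I_N, exists b : R, 0 <= b /\
    forall z, 2 <= time z -> `|pds [seq xc i | i <- js] f z| <= b * time z `^ (- beta).
  move=> js; have [b b0 h] := fast2_sup beta (Cb_pds js Cf) (fast2_pds js Cf Ff).
  by exists b.
have B0 js : 0 <= B js by case: (hB js).
exists (\sum_(j < k.+1) \sum_(s : j.-tuple 'I_N) B s), 2 => z t2 js jsk.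
apply: (le_trans ((hB js).2 z t2)); apply: ler_wpM2r; first exact: powR_ge0.
rewrite -ltnS in jsk.
have h1 := @ler_sum1 R _ (fun j : 'I_k.+1 => \sum_(s : j.-tuple 'I_N) B s) (Ordinal jsk).
apply: le_trans (h1 _); last by move=> j; exact: sumr_ge0.
exact: (@ler_sum1 R _ (fun s : (size js).-tuple 'I_N => B s) (in_tuple js)).
Qed.

End FastDecay.

Theorem theorem16p1 (R : realType) (N : nat) (mu kappa : R)
    (rho : 'rV[R]_N.+1 -> R) (u : 'I_N -> 'rV[R]_N.+1 -> R)
    (T : 'rV[R]_N.+1 -> R) (rho_m T_m : R) :
  (1 <= N)%N -> 0 < mu -> 0 < kappa ->
  smooth_on [set z | 0 < time z] rho ->
  (forall i, smooth_on [set z | 0 < time z] (u i)) ->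
  smooth_on [set z | 0 < time z] T ->
  xperiodic rho -> (forall i, xperiodic (u i)) -> xperiodic T ->
  (forall z, 0 < time z -> NSF_at mu kappa rho u T z) ->
  (forall t : R, 0 < t ->
     [/\ space_int rho t = 1,
         (forall j, space_int (fun w => rho w * u j w) t = 0) &
         space_int (fun w => rho w * usq u w / 2) t
           + N%:R / 2 * space_int (fun w => rho w * T w) t = N%:R / 2]) ->
  Ck_bounded rho -> (forall i, Ck_bounded (u i)) -> Ck_bounded T ->
  0 < rho_m -> 0 < T_m ->
  (forall z, 0 < time z -> rho_m <= rho z /\ T_m <= T z) ->
  [/\ Ck_decay_fast (fun z => rho z - 1),
      (forall i, Ck_decay_fast (u i)) &
      Ck_decay_fast (fun z => T z - 1)].
Proof.
move=> N0 mu0 kappa0 srho su sT prho pu pT eqs norms brho bu bT rm0 Tm0 low.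
have Crho : Cb rho by exact: Cb_of_Ck (conj srho prho) brho.
have Cu i : Cb (u i) by exact: Cb_of_Ck (conj (su i) (pu i)) (bu i).
have CT : Cb T by exact: Cb_of_Ck (conj sT pT) bT.
have shift (f : 'rV[R]_N.+1 -> R) : Cb f -> Cb (fun z => f z - 1).
  move=> Cf; rewrite (_ : (fun z => _) = (fun z => 1 * f z + (-1) * (fun=> 1) z)).
    exact: (Cb_lin 1 (-1) Cf (@Cb_cst R N 1)).
  by apply/funext => z; rewrite mul1r mulN1r.
have FE := exp_to_power (En_decay N0 mu0 kappa0 Crho Cu CT eqs norms rm0 Tm0 low).
have [c c0 hc] := En_lower N0 Crho Cu CT norms rm0 Tm0 low.
(* [En_lower] transfers the decay of the entropy to [Q], which dominates each squared
   perturbation. *)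
have fast f : nice f -> (forall w, f w ^+ 2 <= qq rho u T w) -> fast2 f.
  move=> nf hf m; have [C C0 hC] := FE m.
  exists (c^-1 * C); first by rewrite mulr_ge0// invr_ge0 ltW.
  move=> t t2; have t0 : 0 < t by lra.
  apply: (le_trans (sqint_le_Q Crho Cu CT nf hf t0)).
  rewrite -mulrA ler_pdivlMl//; exact: le_trans (hc t t0) (hC t t2).
have hr w : (rho w - 1) ^+ 2 <= qq rho u T w.
  by rewrite /qq lerDl addr_ge0 ?usq_ge0 ?sqr_ge0.
have hT w : (T w - 1) ^+ 2 <= qq rho u T w.
  by rewrite /qq addrA lerDr addr_ge0 ?usq_ge0 ?sqr_ge0.
split.
- exact (fast2_Ck_decay (shift _ Crho) (fast _ (Cb_nice (shift _ Crho)) hr)).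
- by move=> i; exact (fast2_Ck_decay (Cu i) (fast _ (Cb_nice (Cu i)) (u_le_qq rho u T i))).
- exact (fast2_Ck_decay (shift _ CT) (fast _ (Cb_nice (shift _ CT)) hT)).
Qed.
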